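(* Let $M=(M^{2m+1};\varphi,\xi,\eta,g)\in\mathcal A_4$ (i.e. $M$ is quasi-Sasakian) and let $f:M\to N$ be a $(\pm)$-holomorphic map. (1) If $N\in\mathcal A_1\cup\mathcal A_4\cup\mathcal B_1$, then: (i) the following are equivalent: (a) $f$ is harmonic; (b) $\lambda$ is constant along $\xi$; (c) $\lambda$ is constant. (ii) $f$ is $D$-pluriharmonic. (2) Let $N\in\mathcal A_1\cup\mathcal A_4\cup\mathcal B_1$ and let $f$ be weakly conformal. If $\lambda$ is constant along $\xi$, then $f$ is homothetic with minimal image. (3) Let $N\in\mathcal A_3\cup\mathcal B_3$. (i) Any two of the following imply the third: $f$ is harmonic; $\lambda$ is constant along $\xi$ (and therefore $\lambda$ is constant); $f$ is constant along $D^M$. (ii) There is no non-constant $(\pm)$-holomorphic harmonic weakly conformal map from $M$ into $N$. (4) Let $N\in\mathcal C_1$. (i) $f$ is harmonic and $D$-pluriharmonic. (ii) There is no non-constant $(\pm)$-holomorphic weakly conformal map from $M$ into $N$.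
   Context: Manifolds and maps are smooth; $\nabla$ denotes Levi-Civita connections. An almost contact metric manifold $M=(M^{2m+1};\varphi,\xi,\eta,g)$ is a $(2m+1)$-dimensional Riemannian manifold with a $(1,1)$-tensor $\varphi$, a vector field $\xi$ and a 1-form $\eta$ such that $\varphi^2X=-X+\eta(X)\xi$, $\eta(\xi)=1$, $g(\varphi X,\varphi Y)=g(X,Y)-\eta(X)\eta(Y)$. Put $D^M=\varphi(TM)=\ker\eta$, $\Omega(X,Y)=g(X,\varphi Y)$, $P(X,Y)=(\nabla_X\varphi)Y+(\nabla_{\varphi X}\varphi)\varphi Y$, $W_X=\nabla_XX+\nabla_{\varphi X}(\varphi X)$, $2\mathfrak h=\mathcal L_\xi\varphi$. Conventions: $2d\eta(X,Y)=X\eta(Y)-Y\eta(X)-\eta([X,Y])$; $d\Omega(X,Y,Z)$ is the cyclic sum of $(\nabla_X\Omega)(Y,Z)$ and $(\eta\wedge\Omega)(X,Y,Z)$ the cyclic sum of $\eta(X)\Omega(Y,Z)$; $\{e_i;\varphi e_i;\xi\}_{1\le i\le m}$ is any local orthonormal frame; $\delta\eta=\eta(\sum_iW_{e_i})=-\operatorname{div}\xi$; $\delta\Omega(X)=g(-\varphi(\nabla_\xi\xi)+\sum_iP(e_i,e_i),X)$. $M$ is normal if $[\varphi,\varphi]+2d\eta\otimes\xi=0$, where $[\varphi,\varphi](X,Y)=\varphi^2[X,Y]+[\varphi X,\varphi Y]-\varphi[\varphi X,Y]-\varphi[X,\varphi Y]$. Classes. $\mathcal A_1$: $\alpha$-contact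 metric manifolds ($d\eta=\alpha\Omega$, $\alpha\neq0$ a real constant); quasi-contact metric manifolds ($P(X,Y)=2g(X,Y)\xi-\eta(Y)\{X+\eta(X)\xi+\mathfrak hX\}$); quasi-$\mathcal K$-Sasakian manifolds ($P(X,Y)=2g(X,Y)\xi-2\eta(Y)X+\eta(Y)\nabla_{\varphi X}\xi$); strongly pseudoconvex CR-manifolds ($d\eta=\Omega$ and $(\nabla_X\varphi)Y=g(X+\mathfrak hX,Y)\xi-\eta(Y)(X+\mathfrak hX)$); $\alpha$-Sasakian manifolds ($d\eta=\alpha\Omega$, $\alpha\neq0$ constant, and normal). $\mathcal A_3$: trans-Sasakian manifolds of type $(\wp,\theta)$: normal with $(\nabla_X\varphi)Y=\wp\{g(X,Y)\xi-\eta(Y)X\}+\theta\{g(\varphi X,Y)\xi-\eta(Y)\varphi X\}$, where $2m\wp=\delta\Omega(\xi)$, $2m\theta=-\delta\eta$ and $\wp,\theta$ vanish nowhere. $\mathcal A_4$: quasi-Sasakian manifolds (normal, $d\Omega=0$, and $\eta\wedge(d\eta)^r\neq0$, $(d\eta)^{r+1}=0$ for some $1\le r\le m-1$). $\mathcal B_1$: cosymplectic ($d\eta=0$, $d\Omega=0$, normal), almost cosymplectic ($d\eta=0$, $d\Omega=0$), nearly cosymplectic ($(\nabla_X\varphi)X=0$), nearly-$\mathcal K$-cosymplectic ($(\nabla_X\varphi)X=0$ and $(\nabla_X\varphi)\xi=0$), quasi-$\mathcal K$-cosymplectic ($P(X,Y)=\eta(Y)\nabla_{\varphi X}\xi$)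 manifolds. $\mathcal B_3$: almost $\beta$-Kenmotsu manifolds ($d\Omega=2\beta\,\eta\wedge\Omega$, $d\eta=0$, $d\beta\wedge\eta=0$ for a nowhere vanishing smooth function $\beta$), including the $\beta$-Kenmotsu (normal) and the CR-integrable ($(\nabla_X\varphi)Y=g(\mathfrak hX,Y)\xi-\eta(Y)\mathfrak hX+\beta\{g(\varphi X,Y)\xi-\eta(Y)\varphi X\}$) ones. $\mathcal C_1$: almost Hermitian manifolds $(H;J,G)$ that are Kähler ($\nabla J=0$), nearly Kähler ($(\nabla_XJ)X=0$), almost Kähler ($d\Phi=0$, $\Phi(X,Y)=G(X,JY)$) or quasi-Kähler ($(\nabla_{JX}J)X-(\nabla_XJ)JX=0$). An almost contact metric target is written $N=(N^{2n+1};\phi,\gamma,\sigma,h)$, with the same notions for $(\phi,\gamma,\sigma,h,n)$. $f$ is $(\pm)$-holomorphic if $f_*\varphi=\pm\psi f_*$ (one fixed sign), with $\psi=\phi$, resp. $\psi=J$ for an almost Hermitian target. For an almost contact metric target, $\lambda\in C^\infty(M)$ is the function with $f_*\xi=\lambda\gamma$ (it exists for $(\pm)$-holomorphic $f$); ''$\lambda$ is constant along $\xi$'' means $d\lambda(\xi)=0$. $f$ is constant along $D^M$ if $f_*X=0$ for all $X\in\Gamma(D^M)$; harmonic if its tension field vanishes; $D$-pluriharmonic if $(\nabla f_* )(X,X)+(\nabla f_* )(\varphi X,\varphi X)=0$ for all $X\in\Gamma(D^M)$, $\nabla f_*$ the second fundamental form. $f$ is weakly conformal if $h(f_*X,f_*Y)=\mu^2g(X,Y)$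 for all $X,Y$ and some function $\mu\ge0$ (with $h$ the target metric), homothetic if moreover $\mu$ is constant.
   Formalization: M is assumed connected; otherwise ''λ constant along ξ implies λ constant'' and the non-existence of non-constant maps fail, e.g. for the identity on one component of M and a constant map on another. *)

(* Defs.v *)
From HB Require Import structures.
From mathcomp Require Import all_boot all_order all_algebra all_fingroup.
From mathcomp Require Import all_classical all_reals all_analysis.
Import Order.TTheory GRing.Theory Num.Theory.
Import numFieldNormedType.Exports.

Set Implicit Arguments.
Unset Strict Implicit.
Unset Printing Implicit Defensive.

Local Open Scope classical_set_scope.
Local Open Scope ring_scope.

(* Manifolds are given by smooth atlases, and tensor fields by their components
   in the charts, subject to the transformation law under changes of charts.
   Tangent vectors are row vectors; a (1,1)-tensor is a matrix acting on the
   right, [u |-> u *m T]; a metric is a Gram matrix; a 1-form is a column.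
   All operations (bracket, Levi-Civita connection, second fundamental form...)
   are defined in a chart, for vector fields on the image of the chart. *)

Definition bvec {R : realType} {d : nat} (a : 'I_d) : 'rV[R]_d := delta_mx 0 a.

Fixpoint Ck (k : nat) {R : realType} {d : nat} {V : normedModType R}
    (U : set 'rV[R]_d) (F : 'rV[R]_d -> V) : Prop :=
  (forall x, U x -> {for x, continuous F}) /\
  if k is k'.+1 then
    forall a : 'I_d, (forall x, U x -> derivable F x (bvec a)) /\
                     Ck k' U (fun x => 'D_(bvec a) F x)
  else True.

Definition smooth_on {R : realType} {d : nat} {V : normedModType R}
    (U : set 'rV[R]_d) (F : 'rV[R]_d -> V) : Prop := forall k, Ck k U F.

Definition vfield (R : realType) (d : nat) := 'rV[R]_d -> 'rV[R]_d.

(* constant field; [cfield (bvec a)] is the coordinate field d/dx_a *)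
Definition cfield {R : realType} {d : nat} (u : 'rV[R]_d) : vfield R d :=
  fun=> u.

(* X(F), also for vector-valued F *)
Definition Lder {R : realType} {d : nat} {V : normedModType R}
    (X : vfield R d) (F : 'rV[R]_d -> V) : 'rV[R]_d -> V :=
  fun x => 'D_(X x) F x.

Definition bracket {R : realType} {d : nat} (X Y : vfield R d) : vfield R d :=
  fun x => Lder X Y x - Lder Y X x.

(* y_* X, a field along y *)
Definition pushf {R : realType} {d e : nat} (y : 'rV[R]_d -> 'rV[R]_e)
    (X : vfield R d) : 'rV[R]_d -> 'rV[R]_e := fun x => 'D_(X x) y x.

Definition ip {R : realType} {d : nat} (G : 'M[R]_d) (u v : 'rV[R]_d) : R :=
  (u *m G *m v^T) 0 0.

Definition mfield (R : realType) (d : nat) := 'rV[R]_d -> 'M[R]_d.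

Definition app_end {R : realType} {d : nat} (T : mfield R d) (X : vfield R d) :
  vfield R d := fun x => X x *m T x.

Definition ipf {R : realType} {d : nat} (g : mfield R d) (X Y : vfield R d) :
  'rV[R]_d -> R := fun x => ip (g x) (X x) (Y x).

Definition christoffel {R : realType} {d : nat} (g : mfield R d) (x : 'rV[R]_d)
    (i j k : 'I_d) : R :=
  2^-1 * \sum_l invmx (g x) k l *
    ('D_(bvec i) (fun z => g z j l) x + 'D_(bvec j) (fun z => g z i l) x
     - 'D_(bvec l) (fun z => g z i j) x).

Definition christoffel_form {R : realType} {d : nat} (g : mfield R d)
    (x : 'rV[R]_d) (u v : 'rV[R]_d) : 'rV[R]_d :=
  \row_k \sum_i \sum_j christoffel g x i j k * u 0 i * v 0 j.

Definition nabla {R : realType} {d : nat} (g : mfield R d) (X Y : vfield R d) :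
  vfield R d := fun x => Lder X Y x + christoffel_form g x (X x) (Y x).

(* (nabla_X T) Y *)
Definition nabla_end {R : realType} {d : nat} (g T : mfield R d)
    (X Y : vfield R d) : vfield R d :=
  fun x => nabla g X (app_end T Y) x - nabla g X Y x *m T x.

(* Omega(X,Y) = g(X,TY) *)
Definition fund {R : realType} {d : nat} (g T : mfield R d) (X Y : vfield R d) :
  'rV[R]_d -> R := ipf g X (app_end T Y).

(* (nabla_X Omega)(Y,Z) *)
Definition nabla_fund {R : realType} {d : nat} (g T : mfield R d)
    (X Y Z : vfield R d) : 'rV[R]_d -> R :=
  fun x => Lder X (fund g T Y Z) x - fund g T (nabla g X Y) Z x
           - fund g T Y (nabla g X Z) x.

Definition dfund {R : realType} {d : nat} (g T : mfield R d)
    (X Y Z : vfield R d) : 'rV[R]_d -> R :=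
  fun x => nabla_fund g T X Y Z x + nabla_fund g T Y Z X x
           + nabla_fund g T Z X Y x.

(* connection of y^{-1}TN induced by the Levi-Civita connection of h *)
Definition nabla_along {R : realType} {d e : nat} (h : mfield R e)
    (y : 'rV[R]_d -> 'rV[R]_e) (X : vfield R d) (V : 'rV[R]_d -> 'rV[R]_e) :
    'rV[R]_d -> 'rV[R]_e :=
  fun x => Lder X V x + christoffel_form h (y x) (pushf y X x) (V x).

(* second fundamental form of y : (R^d, g) -> (R^e, h) *)
Definition sff {R : realType} {d e : nat} (g : mfield R d) (h : mfield R e)
    (y : 'rV[R]_d -> 'rV[R]_e) (X Y : vfield R d) : 'rV[R]_d -> 'rV[R]_e :=
  fun x => nabla_along h y X (pushf y Y) x - pushf y (nabla g X Y) x.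

Definition tension {R : realType} {d e : nat} (g : mfield R d) (h : mfield R e)
    (y : 'rV[R]_d -> 'rV[R]_e) : 'rV[R]_d -> 'rV[R]_e :=
  fun x => \sum_a \sum_b
    invmx (g x) a b *: sff g h y (cfield (bvec a)) (cfield (bvec b)) x.

Definition pullback_metric {R : realType} {d e : nat} (h : mfield R e)
    (y : 'rV[R]_d -> 'rV[R]_e) : mfield R d :=
  fun x => \matrix_(a, b) ip (h (y x)) ('D_(bvec a) y x) ('D_(bvec b) y x).

Definition kform (R : realType) (d k : nat) :=
  ('I_k -> vfield R d) -> 'rV[R]_d -> R.

Definition wedge_form {R : realType} {d p q : nat} (om : kform R d p)
    (ta : kform R d q) : kform R d (p + q) :=
  fun X x => ((p`! * q`!)%N%:R)^-1 * \sum_(s : 'S_(p + q))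
    (-1) ^+ s * om (fun i => X (s (lshift q i))) x
              * ta (fun j => X (s (rshift p j))) x.

Fixpoint wedge_pow {R : realType} {d : nat} (om : kform R d 2) (r : nat) :
    kform R d (r * 2) :=
  if r is r'.+1 then wedge_form om (@wedge_pow R d om r') else fun _ _ => 1.
Arguments wedge_pow {R d} om r _ _.

(* [idx] indexes an atlas, which need not be maximal *)
Record manifold (R : realType) (d : nat) := Manifold {
  mpt :> topologicalType;
  m_hausdorff : hausdorff_space mpt;
  m_countable : @second_countable mpt;
  idx : Type;
  dom : idx -> set mpt;
  chart : idx -> mpt -> 'rV[R]_d;
  chart_inv : idx -> 'rV[R]_d -> mpt;
  im := fun i => chart i @` dom i;
  dom_open : forall i, open (dom i);
  dom_cover : forall p, exists i, dom i p;
  im_open : forall i, open (im i);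
  chartK : forall i p, dom i p -> chart_inv i (chart i p) = p;
  chart_cont : forall i p, dom i p -> {for p, continuous (chart i)};
  chart_inv_cont : forall i x, im i x -> {for x, continuous (chart_inv i)};
  trans := fun i j x => chart j (chart_inv i x);
  overlap := fun i j => [set x | im i x /\ dom j (chart_inv i x)];
  trans_smooth : forall i j, smooth_on (overlap i j) (trans i j)
}.
Arguments dom {R d m}.
Arguments chart {R d m}.
Arguments chart_inv {R d m}.
Arguments im {R d m}.
Arguments trans {R d m}.
Arguments overlap {R d m}.

Definition smooth_fun {R : realType} {d : nat} {M : manifold R d} (u : M -> R) :
  Prop := forall i, smooth_on (im i) (fun x => u (chart_inv i x)).

Definition is_metric {R : realType} {d : nat} {M : manifold R d}
    (g : idx M -> mfield R d) : Prop :=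
  [/\ forall i, smooth_on (im i) (g i),
      forall i x, im i x -> (g i x)^T = g i x,
      forall i x, im i x -> forall u, u != 0 -> 0 < ip (g i x) u u
    & forall i j x, overlap i j x -> forall u v,
        ip (g j (trans i j x)) ('D_u (trans i j) x) ('D_v (trans i j) x)
        = ip (g i x) u v].

Definition is_endo {R : realType} {d : nat} {M : manifold R d}
    (T : idx M -> mfield R d) : Prop :=
  (forall i, smooth_on (im i) (T i)) /\
  forall i j x, overlap i j x -> forall u,
    'D_(u *m T i x) (trans i j) x = 'D_u (trans i j) x *m T j (trans i j x).

Definition is_vfield {R : realType} {d : nat} {M : manifold R d}
    (X : idx M -> vfield R d) : Prop :=
  (forall i, smooth_on (im i) (X i)) /\
  forall i j x, overlap i j x -> 'D_(X i x) (trans i j) x = X j (trans i j x).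

Definition is_oneform {R : realType} {d : nat} {M : manifold R d}
    (w : idx M -> 'rV[R]_d -> 'cV[R]_d) : Prop :=
  (forall i, smooth_on (im i) (w i)) /\
  forall i j x, overlap i j x -> forall u,
    'D_u (trans i j) x *m w j (trans i j x) = u *m w i x.

(* expression of f : M -> N in the charts i of M and j of N *)
Definition locdom {R : realType} {d e : nat} {M : manifold R d}
    {N : manifold R e} (f : M -> N) (i : idx M) (j : idx N) : set 'rV[R]_d :=
  [set x | im i x /\ dom j (f (chart_inv i x))].

Definition loc {R : realType} {d e : nat} {M : manifold R d}
    {N : manifold R e} (f : M -> N) (i : idx M) (j : idx N) :
  'rV[R]_d -> 'rV[R]_e := fun x => chart j (f (chart_inv i x)).

Definition smooth_map {R : realType} {d e : nat} {M : manifold R d}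
    {N : manifold R e} (f : M -> N) : Prop :=
  continuous f /\ forall i j, smooth_on (locdom f i j) (loc f i j).

Definition constant_map {A B : Type} (f : A -> B) : Prop :=
  forall p q, f p = f q.

Definition harmonic_map {R : realType} {d e : nat} {M : manifold R d}
    {N : manifold R e} (g : idx M -> mfield R d) (h : idx N -> mfield R e)
    (f : M -> N) : Prop :=
  forall i j x, locdom f i j x -> tension (g i) (h j) (loc f i j) x = 0.

Definition conformal_with {R : realType} {d e : nat} {M : manifold R d}
    {N : manifold R e} (g : idx M -> mfield R d) (h : idx N -> mfield R e)
    (f : M -> N) (mu : M -> R) : Prop :=
  (forall p, 0 <= mu p) /\
  forall i j x, locdom f i j x -> forall u v,
    ip (h j (loc f i j x)) ('D_u (loc f i j) x) ('D_v (loc f i j) x)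
    = mu (chart_inv i x) ^+ 2 * ip (g i x) u v.

Definition weakly_conformal {R : realType} {d e : nat} {M : manifold R d}
    {N : manifold R e} (g : idx M -> mfield R d) (h : idx N -> mfield R e)
    (f : M -> N) : Prop := exists mu : M -> R, conformal_with g h f mu.

Definition homothetic {R : realType} {d e : nat} {M : manifold R d}
    {N : manifold R e} (g : idx M -> mfield R d) (h : idx N -> mfield R e)
    (f : M -> N) : Prop := exists c : R, conformal_with g h f (fun=> c).

Definition immersion {R : realType} {d e : nat} {M : manifold R d}
    {N : manifold R e} (f : M -> N) : Prop :=
  forall i j x, locdom f i j x -> forall u, 'D_u (loc f i j) x = 0 -> u = 0.

(* The image of f is minimal: f is an immersion and, M carrying the metric
   f^*h induced on the image, the mean curvature (the trace of the second
   fundamental form of the isometric immersion f : (M, f^*h) -> (N, h))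
   vanishes.  A homothetic map with zero factor on a connected M is constant;
   its image, a point, is a (zero-dimensional) minimal submanifold. *)
Definition minimal_image {R : realType} {d e : nat} {M : manifold R d}
    {N : manifold R e} (h : idx N -> mfield R e) (f : M -> N) : Prop :=
  constant_map f \/
  immersion f /\
  forall i j x, locdom f i j x ->
    tension (pullback_metric (h j) (loc f i j)) (h j) (loc f i j) x = 0.

(* f_* phi = psi f_* if s is false, f_* phi = - psi f_* if s is true *)
Definition holomorphic_sign {R : realType} {d e : nat} {M : manifold R d}
    {N : manifold R e} (phi : idx M -> mfield R d) (psi : idx N -> mfield R e)
    (s : bool) (f : M -> N) : Prop :=
  forall i j x, locdom f i j x -> forall u,
    'D_(u *m phi i x) (loc f i j) x
    = (-1) ^+ s *: ('D_u (loc f i j) x *m psi j (loc f i j x)).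

Definition pm_holomorphic {R : realType} {d e : nat} {M : manifold R d}
    {N : manifold R e} (phi : idx M -> mfield R d) (psi : idx N -> mfield R e)
    (f : M -> N) : Prop := exists s : bool, holomorphic_sign phi psi s f.

Record acm_coords (R : realType) (d : nat) := AcmCoords {
  cg : mfield R d;
  cphi : mfield R d;
  cxi : vfield R d;
  ceta : 'rV[R]_d -> 'cV[R]_d
}.

Definition etaf {R : realType} {d : nat} (S : acm_coords R d)
  (X : vfield R d) : 'rV[R]_d -> R := fun x => (X x *m ceta S x) 0 0.

Definition gf {R : realType} {d : nat} (S : acm_coords R d)
  (X Y : vfield R d) : 'rV[R]_d -> R := ipf (cg S) X Y.

Definition phif {R : realType} {d : nat} (S : acm_coords R d)
  (X : vfield R d) : vfield R d := app_end (cphi S) X.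

Definition nab {R : realType} {d : nat} (S : acm_coords R d)
  (X Y : vfield R d) : vfield R d := nabla (cg S) X Y.

(* (nabla_X phi) Y *)
Definition nabphi {R : realType} {d : nat} (S : acm_coords R d)
  (X Y : vfield R d) : vfield R d := nabla_end (cg S) (cphi S) X Y.

Definition Omega {R : realType} {d : nat} (S : acm_coords R d)
  (X Y : vfield R d) : 'rV[R]_d -> R := fund (cg S) (cphi S) X Y.

Definition dOmega {R : realType} {d : nat} (S : acm_coords R d)
  (X Y Z : vfield R d) : 'rV[R]_d -> R := dfund (cg S) (cphi S) X Y Z.

Definition eta_Omega {R : realType} {d : nat} (S : acm_coords R d)
    (X Y Z : vfield R d) : 'rV[R]_d -> R :=
  fun x => etaf S X x * Omega S Y Z x + etaf S Y x * Omega S Z X x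
           + etaf S Z x * Omega S X Y x.

Definition deta {R : realType} {d : nat} (S : acm_coords R d)
    (X Y : vfield R d) : 'rV[R]_d -> R :=
  fun x => 2^-1 *
    (Lder X (etaf S Y) x - Lder Y (etaf S X) x - etaf S (bracket X Y) x).

Definition eta_form {R : realType} {d : nat} (S : acm_coords R d) :
  kform R d 1 := fun X => etaf S (X ord0).

Definition deta_form {R : realType} {d : nat} (S : acm_coords R d) :
  kform R d 2 := fun X => deta S (X ord0) (X ord_max).

Definition Pten {R : realType} {d : nat} (S : acm_coords R d)
    (X Y : vfield R d) : vfield R d :=
  fun x => nabphi S X Y x + nabphi S (phif S X) (phif S Y) x.

Definition Wten {R : realType} {d : nat} (S : acm_coords R d)
    (X : vfield R d) : vfield R d :=
  fun x => nab S X X x + nab S (phif S X) (phif S X) x.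

(* half of (L_xi phi) X *)
Definition hten {R : realType} {d : nat} (S : acm_coords R d)
    (X : vfield R d) : vfield R d :=
  fun x => 2^-1 *: (bracket (cxi S) (phif S X) x
                    - phif S (bracket (cxi S) X) x).

Definition nijenhuis {R : realType} {d : nat} (S : acm_coords R d)
    (X Y : vfield R d) : vfield R d :=
  fun x => phif S (phif S (bracket X Y)) x
           + bracket (phif S X) (phif S Y) x
           - phif S (bracket (phif S X) Y) x
           - phif S (bracket X (phif S Y)) x.

Definition phi_frame {R : realType} {d n : nat} (S : acm_coords R d)
    (V : set 'rV[R]_d) (e : 'I_n -> vfield R d) : Prop :=
  (forall i, smooth_on V (e i)) /\
  forall x, V x ->
    gf S (cxi S) (cxi S) x = 1 /\
    forall i, [/\ gf S (e i) (cxi S) x = 0,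
                  gf S (phif S (e i)) (cxi S) x = 0 &
                  forall j, [/\ gf S (e i) (e j) x = (i == j)%:R,
                                gf S (e i) (phif S (e j)) x = 0 &
                                gf S (phif S (e i)) (phif S (e j)) x
                                = (i == j)%:R]].

(* e is the part e_1..e_n of a local orthonormal frame {e_i; phi e_i; xi} *)
Definition delta_eta {R : realType} {d n : nat} (S : acm_coords R d)
    (e : 'I_n -> vfield R d) : 'rV[R]_d -> R :=
  etaf S (fun x => \sum_i Wten S (e i) x).

Definition delta_Omega {R : realType} {d n : nat} (S : acm_coords R d)
    (e : 'I_n -> vfield R d) (X : vfield R d) : 'rV[R]_d -> R :=
  gf S (fun x => - phif S (nab S (cxi S) (cxi S)) x
                 + \sum_i Pten S (e i) (e i) x) X.

Record almost_contact_metric (R : realType) (m : nat)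
    (M : manifold R (2 * m).+1) := AlmostContactMetric {
  acs :> idx M -> acm_coords R (2 * m).+1;
  acm_metric : is_metric (fun i => cg (acs i));
  acm_phi : is_endo (fun i => cphi (acs i));
  acm_xi : is_vfield (fun i => cxi (acs i));
  acm_eta : is_oneform (fun i => ceta (acs i));
  acm_phi2 : forall i x, im i x -> forall u,
    u *m cphi (acs i) x *m cphi (acs i) x
    = - u + (u *m ceta (acs i) x) 0 0 *: cxi (acs i) x;
  acm_eta_xi : forall i x, im i x ->
    (cxi (acs i) x *m ceta (acs i) x) 0 0 = 1;
  acm_compat : forall i x, im i x -> forall u v,
    ip (cg (acs i) x) (u *m cphi (acs i) x) (v *m cphi (acs i) x)
    = ip (cg (acs i) x) u v
      - (u *m ceta (acs i) x) 0 0 * (v *m ceta (acs i) x) 0 0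
}.

Definition acm_g {R : realType} {m : nat} {M : manifold R (2 * m).+1}
  (S : almost_contact_metric M) : idx M -> mfield R (2 * m).+1 :=
  fun i => cg (S i).

Definition acm_endo {R : realType} {m : nat} {M : manifold R (2 * m).+1}
  (S : almost_contact_metric M) : idx M -> mfield R (2 * m).+1 :=
  fun i => cphi (S i).

Record almost_hermitian (R : realType) (n : nat) (H : manifold R (2 * n)) :=
    AlmostHermitian {
  ah_g : idx H -> mfield R (2 * n);
  ah_J : idx H -> mfield R (2 * n);
  ah_metric : is_metric ah_g;
  ah_endo : is_endo ah_J;
  ah_J2 : forall i x, im i x -> forall u : 'rV_(2 * n),
    u *m ah_J i x *m ah_J i x = - u;
  ah_compat : forall i x, im i x -> forall u v,
    ip (ah_g i x) (u *m ah_J i x) (v *m ah_J i x) = ip (ah_g i x) u v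
}.

Definition forall_XY {R : realType} {d : nat} {M : manifold R d}
    (Q : idx M -> vfield R d -> vfield R d -> 'rV[R]_d -> Prop) : Prop :=
  forall i X Y, smooth_on (im i) X -> smooth_on (im i) Y ->
    forall x, im i x -> Q i X Y x.

Definition forall_XYZ {R : realType} {d : nat} {M : manifold R d}
    (Q : idx M -> vfield R d -> vfield R d -> vfield R d -> 'rV[R]_d -> Prop) :
    Prop :=
  forall i X Y Z, smooth_on (im i) X -> smooth_on (im i) Y ->
    smooth_on (im i) Z -> forall x, im i x -> Q i X Y Z x.

Definition normal_acm {R : realType} {m : nat} {M : manifold R (2 * m).+1}
    (S : almost_contact_metric M) : Prop :=
  forall_XY (fun i X Y x =>
    nijenhuis (S i) X Y x + (2 * deta (S i) X Y x) *: cxi (S i) x = 0).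

Definition deta_zero {R : realType} {m : nat} {M : manifold R (2 * m).+1}
    (S : almost_contact_metric M) : Prop :=
  forall_XY (fun i X Y x => deta (S i) X Y x = 0).

Definition dOmega_zero {R : realType} {m : nat} {M : manifold R (2 * m).+1}
    (S : almost_contact_metric M) : Prop :=
  forall_XYZ (fun i X Y Z x => dOmega (S i) X Y Z x = 0).

Definition deta_alpha_Omega {R : realType} {m : nat}
    {M : manifold R (2 * m).+1} (S : almost_contact_metric M) (alpha : R) :
    Prop :=
  forall_XY (fun i X Y x => deta (S i) X Y x = alpha * Omega (S i) X Y x).

Definition alpha_contact {R : realType} {m : nat} {M : manifold R (2 * m).+1}
    (S : almost_contact_metric M) : Prop :=
  exists alpha : R, alpha != 0 /\ deta_alpha_Omega S alpha.

Definition quasi_contact {R : realType} {m : nat} {M : manifold R (2 * m).+1}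
    (S : almost_contact_metric M) : Prop :=
  forall_XY (fun i X Y x =>
    Pten (S i) X Y x
    = (2 * gf (S i) X Y x) *: cxi (S i) x
      - etaf (S i) Y x *:
          (X x + etaf (S i) X x *: cxi (S i) x + hten (S i) X x)).

Definition quasi_K_sasakian {R : realType} {m : nat}
    {M : manifold R (2 * m).+1} (S : almost_contact_metric M) : Prop :=
  forall_XY (fun i X Y x =>
    Pten (S i) X Y x
    = (2 * gf (S i) X Y x) *: cxi (S i) x - (2 * etaf (S i) Y x) *: X x
      + etaf (S i) Y x *: nab (S i) (phif (S i) X) (cxi (S i)) x).

Definition strongly_pseudoconvex_CR {R : realType} {m : nat}
    {M : manifold R (2 * m).+1} (S : almost_contact_metric M) : Prop :=
  deta_alpha_Omega S 1 /\
  forall_XY (fun i X Y x =>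
    let XhX := fun z => X z + hten (S i) X z in
    nabphi (S i) X Y x
    = gf (S i) XhX Y x *: cxi (S i) x - etaf (S i) Y x *: XhX x).

Definition alpha_sasakian {R : realType} {m : nat} {M : manifold R (2 * m).+1}
    (S : almost_contact_metric M) : Prop :=
  alpha_contact S /\ normal_acm S.

Definition class_A1 {R : realType} {m : nat} {M : manifold R (2 * m).+1}
    (S : almost_contact_metric M) : Prop :=
  [\/ alpha_contact S, quasi_contact S, quasi_K_sasakian S
    | strongly_pseudoconvex_CR S \/ alpha_sasakian S].

(* g(phi X, Y) xi - eta(Y) phi X *)
Definition kenmotsu_term {R : realType} {d : nat} (S : acm_coords R d)
    (X Y : vfield R d) : vfield R d :=
  fun x => gf S (phif S X) Y x *: cxi S x - etaf S Y x *: phif S X x.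

Definition trans_sasakian {R : realType} {m : nat} {M : manifold R (2 * m).+1}
    (S : almost_contact_metric M) (wp theta : M -> R) : Prop :=
  [/\ normal_acm S,
      forall_XY (fun i X Y x =>
        nabphi (S i) X Y x
        = wp (chart_inv i x) *:
            (gf (S i) X Y x *: cxi (S i) x - etaf (S i) Y x *: X x)
          + theta (chart_inv i x) *: kenmotsu_term (S i) X Y x)
    & forall i (V : set _) (e : 'I_m -> vfield R (2 * m).+1), open V ->
        V `<=` im i -> phi_frame (S i) V e -> forall x, V x ->
        (2 * m)%:R * wp (chart_inv i x) = delta_Omega (S i) e (cxi (S i)) x /\
        (2 * m)%:R * theta (chart_inv i x) = - delta_eta (S i) e x].

Definition class_A3 {R : realType} {m : nat} {M : manifold R (2 * m).+1}
    (S : almost_contact_metric M) : Prop :=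
  exists wp theta : M -> R,
    [/\ smooth_fun wp, smooth_fun theta,
        forall p, wp p != 0, forall p, theta p != 0
      & trans_sasakian S wp theta].

(* [eta /\ (deta)^r <> 0] is a pointwise condition, as for volume forms:
   eta has constant rank 2r+1 *)
Definition quasi_sasakian {R : realType} {m : nat} {M : manifold R (2 * m).+1}
    (S : almost_contact_metric M) : Prop :=
  [/\ normal_acm S, dOmega_zero S
    & exists r : nat, [/\ (1 <= r <= m.-1)%N,
        forall i x, im i x ->
          exists X : 'I_(1 + r * 2) -> vfield R (2 * m).+1,
            (forall k, smooth_on (im i) (X k)) /\
            wedge_form (eta_form (S i)) (wedge_pow (deta_form (S i)) r) X x != 0
      & forall i (X : 'I_(r.+1 * 2) -> vfield R (2 * m).+1),
          (forall k, smooth_on (im i) (X k)) -> forall x, im i x ->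
          wedge_pow (deta_form (S i)) r.+1 X x = 0]].

Definition class_A4 {R : realType} {m : nat} {M : manifold R (2 * m).+1}
    (S : almost_contact_metric M) : Prop := quasi_sasakian S.

Definition almost_cosymplectic {R : realType} {m : nat}
    {M : manifold R (2 * m).+1} (S : almost_contact_metric M) : Prop :=
  deta_zero S /\ dOmega_zero S.

Definition cosymplectic {R : realType} {m : nat} {M : manifold R (2 * m).+1}
    (S : almost_contact_metric M) : Prop :=
  [/\ deta_zero S, dOmega_zero S & normal_acm S].

Definition nearly_cosymplectic {R : realType} {m : nat}
    {M : manifold R (2 * m).+1} (S : almost_contact_metric M) : Prop :=
  forall i X, smooth_on (im i) X -> forall x, im i x ->
    nabphi (S i) X X x = 0.

Definition nearly_K_cosymplectic {R : realType} {m : nat}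
    {M : manifold R (2 * m).+1} (S : almost_contact_metric M) : Prop :=
  nearly_cosymplectic S /\
  forall i X, smooth_on (im i) X -> forall x, im i x ->
    nabphi (S i) X (cxi (S i)) x = 0.

Definition quasi_K_cosymplectic {R : realType} {m : nat}
    {M : manifold R (2 * m).+1} (S : almost_contact_metric M) : Prop :=
  forall_XY (fun i X Y x =>
    Pten (S i) X Y x
    = etaf (S i) Y x *: nab (S i) (phif (S i) X) (cxi (S i)) x).

Definition class_B1 {R : realType} {m : nat} {M : manifold R (2 * m).+1}
    (S : almost_contact_metric M) : Prop :=
  [\/ cosymplectic S, almost_cosymplectic S, nearly_cosymplectic S
    | nearly_K_cosymplectic S \/ quasi_K_cosymplectic S].

Definition almost_beta_kenmotsu {R : realType} {m : nat}
    {M : manifold R (2 * m).+1} (S : almost_contact_metric M) (beta : M -> R) :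
    Prop :=
  [/\ smooth_fun beta /\ (forall p, beta p != 0),
      forall_XYZ (fun i X Y Z x =>
        dOmega (S i) X Y Z x
        = 2 * beta (chart_inv i x) * eta_Omega (S i) X Y Z x),
      deta_zero S
    & forall_XY (fun i X Y x =>
        Lder X (fun z => beta (chart_inv i z)) x * etaf (S i) Y x
        - Lder Y (fun z => beta (chart_inv i z)) x * etaf (S i) X x = 0)].

Definition beta_kenmotsu {R : realType} {m : nat} {M : manifold R (2 * m).+1}
    (S : almost_contact_metric M) (beta : M -> R) : Prop :=
  almost_beta_kenmotsu S beta /\ normal_acm S.

Definition CR_almost_beta_kenmotsu {R : realType} {m : nat}
    {M : manifold R (2 * m).+1} (S : almost_contact_metric M) (beta : M -> R) :
    Prop :=
  almost_beta_kenmotsu S beta /\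
  forall_XY (fun i X Y x =>
    nabphi (S i) X Y x
    = gf (S i) (hten (S i) X) Y x *: cxi (S i) x
      - etaf (S i) Y x *: hten (S i) X x
      + beta (chart_inv i x) *: kenmotsu_term (S i) X Y x).

Definition class_B3 {R : realType} {m : nat} {M : manifold R (2 * m).+1}
    (S : almost_contact_metric M) : Prop :=
  exists beta : M -> R,
    [\/ almost_beta_kenmotsu S beta, beta_kenmotsu S beta
      | CR_almost_beta_kenmotsu S beta].

Definition nabJ {R : realType} {n : nat} {H : manifold R (2 * n)}
    (K : almost_hermitian H) (i : idx H) (X Y : vfield R (2 * n)) :
    vfield R (2 * n) := nabla_end (ah_g K i) (ah_J K i) X Y.

Definition kahler {R : realType} {n : nat} {H : manifold R (2 * n)}
    (K : almost_hermitian H) : Prop :=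
  forall_XY (fun i X Y x => nabJ K i X Y x = 0).

Definition nearly_kahler {R : realType} {n : nat} {H : manifold R (2 * n)}
    (K : almost_hermitian H) : Prop :=
  forall i X, smooth_on (im i) X -> forall x, im i x -> nabJ K i X X x = 0.

Definition almost_kahler {R : realType} {n : nat} {H : manifold R (2 * n)}
    (K : almost_hermitian H) : Prop :=
  forall_XYZ (fun i X Y Z x => dfund (ah_g K i) (ah_J K i) X Y Z x = 0).

Definition quasi_kahler {R : realType} {n : nat} {H : manifold R (2 * n)}
    (K : almost_hermitian H) : Prop :=
  forall i X, smooth_on (im i) X -> forall x, im i x ->
    nabJ K i (app_end (ah_J K i) X) X x
    - nabJ K i X (app_end (ah_J K i) X) x = 0.

Definition class_C1 {R : realType} {n : nat} {H : manifold R (2 * n)}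
    (K : almost_hermitian H) : Prop :=
  [\/ kahler K, nearly_kahler K, almost_kahler K | quasi_kahler K].

Definition D_section {R : realType} {m : nat} {M : manifold R (2 * m).+1}
    (S : almost_contact_metric M) (i : idx M) (X : vfield R (2 * m).+1) :
    Prop :=
  smooth_on (im i) X /\ forall x, im i x -> etaf (S i) X x = 0.

Definition constant_along_D {R : realType} {m e : nat}
    {M : manifold R (2 * m).+1} {N : manifold R e}
    (S : almost_contact_metric M) (f : M -> N) : Prop :=
  forall i j X, D_section S i X -> forall x, locdom f i j x ->
    pushf (loc f i j) X x = 0.

Definition D_pluriharmonic {R : realType} {m e : nat}
    {M : manifold R (2 * m).+1} {N : manifold R e}
    (S : almost_contact_metric M) (h : idx N -> mfield R e) (f : M -> N) :
    Prop :=
  forall i j X, D_section S i X -> forall x, locdom f i j x ->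
    sff (cg (S i)) (h j) (loc f i j) X X x
    + sff (cg (S i)) (h j) (loc f i j) (phif (S i) X) (phif (S i) X) x = 0.

Definition xi_factor {R : realType} {m n : nat} {M : manifold R (2 * m).+1}
    {N : manifold R (2 * n).+1} (SM : almost_contact_metric M)
    (SN : almost_contact_metric N) (f : M -> N) (lam : M -> R) : Prop :=
  smooth_fun lam /\
  forall i j x, locdom f i j x ->
    pushf (loc f i j) (cxi (SM i)) x
    = lam (chart_inv i x) *: cxi (SN j) (loc f i j x).

Definition constant_along_xi {R : realType} {m : nat}
    {M : manifold R (2 * m).+1} (S : almost_contact_metric M) (lam : M -> R) :
    Prop :=
  forall i x, im i x ->
    Lder (cxi (S i)) (fun z => lam (chart_inv i z)) x = 0.

(* Main.v *)
Require Import Defs.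
From HB Require Import structures.
From mathcomp Require Import all_boot all_order all_algebra.
From mathcomp Require Import all_classical all_reals all_analysis.
From mathcomp Require Import ring lra.

(* Let J be the differential of f in charts, B its second fundamental form and
   T(u) = (nabla_{phi u} phi) u - (nabla_u phi) phi u, which is P(phi u, u) for u
   in D.  Differentiating phi J = +-J psi and using the symmetry of B gives
     B(u,u) + B(phi u, phi u) = T^N(uJ) - T^M(u) J    for u in D.
   T vanishes on D for quasi-Sasakian manifolds and for the classes A1, A4, B1
   and C1, while T(u) = -2 b |u|^2 xi with b nowhere zero for A3 and B3; all the
   contact classes satisfy nabla_xi xi = 0.  As the trace of B over D only
   involves such sums,
     tau(f) = B(xi,xi) + (1/2) (trace over D of u |-> T^N(uJ)).
   Moreover B(xi,xi) = xi(lambda) gamma, and comparing the gamma-components of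
   B(u,xi) and B(xi,u) yields u(lambda) = 0 for u in D.  Hence
   d lambda = xi(lambda) eta, and d(d lambda) = 0 restricted to D reads
   xi(lambda) d eta = 0.  The rank condition r >= 1 on M makes d eta nowhere zero,
   so lambda is always constant and B(xi,xi) = 0; every assertion follows. *)

Import Order.TTheory GRing.Theory Num.Theory.
Import numFieldNormedType.Exports.

Set Implicit Arguments.
Unset Strict Implicit.
Unset Printing Implicit Defensive.

Local Open Scope classical_set_scope.
Local Open Scope ring_scope.

(** * Differential calculus on row vectors *)

(** Smoothness is stated through iterated partial derivatives and every derivative is directional,
    so even linearity of ['D_u F x] in u must be earned: continuous partials give Frechet
    differentiability. Schwarz's theorem supplies the symmetry of B and of the second derivatives of
    lambda and eta. The class conditions quantify over vector fields; they are evaluated on constant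
    fields and on xi, where they become identities between the pointwise tensors [cov], [cov_end],
    [twist] and [hess]. The sum B(u,u) + B(phi u, phi u) is within reach although neither summand
    is: the unknown B(phi u, u) psi enters the derivatives of phi J = +-J psi along u and along phi
    u, and cancels between the two. No adapted frame is built for the trace over D: for any
    orthonormal basis e_l, both phi e_l and phi^2 e_l compute it, which pairs v with phi v and
    explains the factor 1/2. When b is nowhere zero, tau(f) is -b times a sum of squares times
    gamma, so harmonicity forces df to vanish on D. *)

Section Differentiation.
Context {R : realType}.

Lemma is_derive_line {V W : normedModType R} (f : V -> W) (y v : V) (t : R) :
  derivable f (y + t *: v) v ->
  is_derive t 1 (fun s : R => f (y + s *: v)) ('D_v f (y + t *: v)).
Proof.
have E : (fun h : R => h^-1 *: (f (y + (h *: (1:R) + t) *: v) - f (y + t *: v)))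
     = (fun h : R => h^-1 *: (f (h *: v + (y + t *: v)) - f (y + t *: v))).
  apply/funext => h; congr (_ *: (f _ - _)).
  by rewrite [h *: 1]mulr1 scalerDl addrCA.
move=> fd; apply: DeriveDef; first by rewrite /derivable E.
by rewrite /derive E.
Qed.

(** The length s is not normalised to 1 because [second_difference] moves along two directions with
    the same s. *)
Lemma directional_MVT {V : normedModType R} (f : V -> R) (y v : V) (s : R) :
  0 <= s -> (forall t, 0 <= t <= s -> derivable f (y + t *: v) v) ->
  exists2 t, 0 <= t <= s & f (y + s *: v) - f y = s * 'D_v f (y + t *: v).
Proof.
move=> s0 fd.
have der (t : R) : 0 <= t <= s ->
    is_derive t (1 : R) (fun t : R => f (y + t *: v)) ('D_v f (y + t *: v)).
  by move=> t01; apply/is_derive_line/fd.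
have [t|t tI|c cI] := @MVT_segment R (fun t : R => f (y + t *: v))
  (fun t => 'D_v f (y + t *: v)) 0 s s0.
- by rewrite in_itv /= => /andP[/ltW t0 /ltW t1]; apply: der; rewrite t0.
- apply: (@derivable_within_continuous _ R^o (fun t : R => f (y + t *: v)) `[0,s]) tI => t'.
  by rewrite in_itv /= => s01; have [] := der t' s01.
rewrite scale0r addr0 subr0 mulrC => E.
by exists c => //; move: cI; rewrite in_itv.
Qed.

(** Homogeneity in the direction needs only one variable: on the line through x along v, derivable
    already means differentiable. *)
Lemma derivableZdir {V W : normedModType R} (f : V -> W) (x v : V) (k : R) :
  derivable f x v -> derivable f x (k *: v) /\ 'D_(k *: v) f x = k *: 'D_v f x.
Proof.
have [->|k0] := eqVneq k 0.
  by rewrite !scale0r derive0; split=> //; exact: derivable0.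
move=> fd; have fd0 : derivable f (x + 0 *: v) v by rewrite scale0r addr0.
have := is_derive_line fd0; rewrite scale0r addr0 => gd.
have gd' : is_derive (0:R) (k : R) (fun s : R => f (x + s *: v)) (k *: 'D_v f x).
  have dg : differentiable (fun s : R => f (x + s *: v)) (0:R).
    by apply/derivable1_diffP; case: gd.
  apply: DeriveDef; first exact: diff_derivable.
  rewrite deriveE // -[k in LHS]mulr1 [LHS]linearZ -deriveE //.
  by case: gd => _ ->.
have E : (fun h : R => h^-1 *: (f (h *: (k *: v) + x) - f x))
   = (fun h : R => h^-1 *: ((f (x + (h *: k + 0) *: v)) - f (x + 0 *: v))).
  by apply/funext => h; rewrite scale0r !addr0 scalerA [h *: k]mulrC [k * h]mulrC
    (addrC x).
by case: gd' => gd1 gd2; split; [rewrite /derivable E|rewrite /derive E].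
Qed.

Definition dotl {d : nat} (c : 'I_d -> R) (h : 'rV[R]_d) : R :=
  \sum_a h 0 a * c a.

Lemma dotl_linear d (c : 'I_d -> R) : linear (dotl c).
Proof.
move=> k u v; rewrite /dotl scaler_sumr -big_split; apply: eq_bigr => a _ /=.
by rewrite !mxE mulrDl -mulrA.
Qed.

Lemma dotl_bvec d (c : 'I_d -> R) a : dotl c (bvec a) = c a.
Proof.
rewrite /dotl (bigD1 a) //= big1 => [|b ba].
  by rewrite mxE !eqxx mul1r addr0.
by rewrite mxE (negbTE ba) andbF mul0r.
Qed.

HB.instance Definition _ d (c : 'I_d -> R) :=
  GRing.isLinear.Build R 'rV[R]_d R _ (dotl c) (dotl_linear c).

Lemma normr_entry d (h : 'rV[R]_d) a : `|h 0 a| <= `|h|.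
Proof.
rewrite [leRHS]/Num.Def.normr /= mx_normrE.
exact: (le_bigmax _ (fun ij => `|h ij.1 ij.2|) (0, a)).
Qed.

Lemma continuous_at_sum {T : topologicalType} {V : normedModType R} (I : Type) (r : seq I)
    (F : I -> T -> V) x :
  (forall i, {for x, continuous (F i)}) ->
  {for x, continuous (fun y => \sum_(i <- r) F i y)}.
Proof.
move=> Fc; elim: r => [|i r IH].
  have -> : (fun y => \sum_(i <- [::]) F i y) = cst 0.
    by apply/funext => y; rewrite big_nil.
  exact: cvg_cst.
have -> : (fun y => \sum_(j <- i :: r) F j y) = (fun y => F i y + \sum_(j <- r) F j y).
  by apply/funext => y; rewrite big_cons.
by apply: cvgD; [exact: Fc|exact: IH].
Qed.

Lemma dotl_continuous d (c : 'I_d -> R) : continuous (dotl c).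
Proof.
move=> h; apply: (@continuous_at_sum _ _ _ _ (fun a (y : 'rV[R]_d) => y 0 a * c a)).
by move=> a; apply: continuousM; [exact: coord_continuous|exact: cst_continuous].
Qed.

(** The points x + [trunc_rV k h], for k from 0 to d, form a staircase from x to x + h with one
    coordinate step at a time, so that an increment of f splits into increments along coordinate
    directions. *)
Definition trunc_rV {d : nat} (k : nat) (h : 'rV[R]_d) : 'rV[R]_d :=
  \row_a (if (a < k)%N then h 0 a else 0).

Lemma trunc_rVS d (a : 'I_d) (h : 'rV[R]_d) :
  trunc_rV a.+1 h = trunc_rV a h + h 0 a *: bvec a.
Proof.
apply/rowP => b; rewrite !mxE eqxx /= ltnS leq_eqVlt.
case: (eqVneq b a) => [->|ba]; first by rewrite eqxx ltnn /= mulr1 add0r.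
by rewrite (negbTE ba : nat_of_ord b == a = false) /= mulr0 addr0.
Qed.

(** The remainder is estimated along the staircase: each step is a mean value theorem in one
    coordinate, and continuity of the partial derivatives at x bounds its error by a fraction of e
    times |h|. *)
Lemma C1_differentiable_scalar d (U : set 'rV[R]_d) (f : 'rV[R]_d -> R) (x : 'rV[R]_d) :
  open U -> U x ->
  (forall a y, U y -> derivable f y (bvec a)) ->
  (forall a, {for x, continuous (fun y => 'D_(bvec a) f y)}) ->
  differentiable f x.
Proof.
move=> Uo Ux fd fc; pose c a := 'D_(bvec a) f x.
have key : f \o shift x = cst (f x) + dotl c +o_ (0 : 'rV[R]_d) id.
  apply/eqaddoP => _/posnumP[e].
  (* Each of the d steps may cost e/(d+1); the successor keeps the denominator nonzero for d = 0. *)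
  have e'0 : 0 < e%:num / d.+1%:R by rewrite divr_gt0.
  have nD : nbhs x [set y | forall a, `|'D_(bvec a) f y - c a| <= e%:num / d.+1%:R].
    apply: (@filter_forall _ _ _ _ (nbhs_filter x)) => a;
      have := fc a => /cvgrPdist_le /(_ _ e'0).
    by apply: (@filterS _ _ (nbhs_filter x)) => y; rewrite /= distrC.
  have /nbhs_normP[r /= r0 rU] :=
    @filterI _ _ (nbhs_filter x) _ _ (open_nbhs_nbhs (conj Uo Ux)) nD.
  have {rU}Hr (y : 'rV[R]_d) : `|y| < r -> U (x + y) /\
      forall a, `|'D_(bvec a) f (x + y) - c a| <= e%:num / d.+1%:R.
    by move=> yr; apply: rU; rewrite /= opprD addNKr normrN.
  suff : nbhs (0 : 'rV[R]_d) [set h | `|(f \o shift x - (cst (f x) + dotl c)) h|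
      <= e%:num * `|h|] by [].
  apply: (iffRL (@nbhs_normP R 'rV[R]_d _ _)).
 exists r => //= h; rewrite /= sub0r normrN => hr.
  rewrite /= !fctE /=.
  have IH k : (k <= d)%N -> `|f (x + trunc_rV k h) - f x - dotl c (trunc_rV k h)|
     <= k%:R * (e%:num / d.+1%:R) * `|h|.
    elim: k => [_|k IHk kd].
      have -> : trunc_rV 0 h = 0 by apply/rowP => a; rewrite !mxE.
      by rewrite addr0 subrr linear0 subr0 normr0 !mul0r.
    pose a := Ordinal kd; have -> : trunc_rV k.+1 h = trunc_rV k h + h 0 a *: bvec a.
      exact: (trunc_rVS a h).
    (* In the maximum norm the staircase stays in the ball: no entry exceeds the corresponding entry
       of h in absolute value. *)
    have inU t : 0 <= t <= 1 -> `|trunc_rV k h + t *: (h 0 a *: bvec a)| < r.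
      move=> /andP[t0 t1]; apply: le_lt_trans hr.
      rewrite [leLHS]/Num.Def.normr /= mx_normrE.
      apply: bigmax_le => [|[i b] _ /=]; first exact: normr_ge0.
      rewrite !mxE ord1 eqxx /=; have [->|ba] := eqVneq b a.
        rewrite ltnn add0r mulr1 normrM (ger0_norm t0).
        by rewrite (le_trans (ler_piMl _ t1)) // normr_entry.
      rewrite !mulr0 addr0; case: ifP => _; last by rewrite normr0.
      exact: normr_entry.
    have [t t01|t t01] :=
        @directional_MVT _ f (x + trunc_rV k h) (h 0 a *: bvec a) 1 ler01.
      by apply: (derivableZdir _ _).1; apply: fd; rewrite -addrA; apply: (Hr _ _).1;
        exact: inU.
    rewrite scale1r mul1r.
    have [Ut Dt] := Hr _ (inU t t01).
    rewrite -!addrA in Ut Dt *; rewrite (derivableZdir _ (fd a _ Ut)).2 => Et.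
    have -> : f (x + (trunc_rV k h + h 0 a *: bvec a)) = f (x + trunc_rV k h)
      + h 0 a * 'D_(bvec a) f (x + (trunc_rV k h + t *: (h 0 a *: bvec a))).
      by move/eqP: Et; rewrite subr_eq => /eqP ->; exact: addrC.
    have -> : dotl c (trunc_rV k h + h 0 a *: bvec a) = dotl c (trunc_rV k h) + h 0 a * c a.
      by rewrite linearD linearZ /= dotl_bvec.
    set D := 'D_(bvec a) f _ in Dt *; rewrite -addrA.
    have -> : f (x + trunc_rV k h) + (h 0 a * D + (- f x - (dotl c (trunc_rV k h) + h 0 a
      * c a)))
      = (f (x + trunc_rV k h) - f x - dotl c (trunc_rV k h)) + h 0 a * (D - c a) by ring.
    rewrite (le_trans (ler_normD _ _)) // -natr1 !mulrDl mul1r.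
    apply: lerD; first by apply: IHk; exact: ltnW.
    rewrite normrM mulrC; apply: ler_pM; rewrite ?normr_ge0 //; last exact: normr_entry.
    exact: Dt.
  have := IH d (leqnn d); have -> : trunc_rV d h = h.
    by apply/rowP => a; rewrite !mxE ltn_ord.
  rewrite opprD addrA (addrC h x) => /le_trans; apply.
  rewrite ler_wpM2r // mulrCA ler_piMr // ?ler_pdivrMr //.
  by rewrite mul1r ler_nat.
have E := diff_unique (@dotl_continuous d c) key.
by apply/diff_locallyP; rewrite E; split => //; exact: dotl_continuous.
Qed.

Lemma near_eq_continuous {V W : normedModType R} (F G : V -> W) (x : V) :
  {near x, F =1 G} -> {for x, continuous F} -> {for x, continuous G}.
Proof.
move=> FG Fc; rewrite /prop_for /continuous_at -(nbhs_singleton FG).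
by apply: cvg_trans Fc; apply: near_eq_cvg; apply: filterS FG => y ->.
Qed.

Lemma differentiable_big {V W : normedModType R} (I : Type) (r : seq I)
    (F : I -> V -> W) (x : V) :
  (forall i, differentiable (F i) x) ->
  differentiable (fun y => \sum_(i <- r) F i y) x.
Proof.
move=> Fd; elim: r => [|i r IH].
  have -> : (fun y => \sum_(i <- [::]) F i y) = cst 0.
    by apply/funext => y; rewrite big_nil.
  exact: differentiable_cst.
have -> : (fun y => \sum_(j <- i :: r) F j y) = F i + (fun y => \sum_(j <- r) F j y).
  by apply/funext => y; rewrite big_cons.
exact: differentiableD.
Qed.

Lemma differentiable_mx {V : normedModType R} p q (F : V -> 'M[R]_(p, q)) (x : V) :
  (forall i j, differentiable (fun y => F y i j) x) -> differentiable F x.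
Proof.
move=> Fd; have -> : F = fun y => \sum_i \sum_j F y i j *: delta_mx i j.
  by apply/funext => y; exact: matrix_sum_delta.
apply: differentiable_big => i; apply: differentiable_big => j.
exact: (@differentiableZl _ _ _ (fun y => F y i j)).
Qed.

Lemma differentiable_entry {V : normedModType R} p q (F : V -> 'M[R]_(p, q)) (x : V) i j :
  differentiable F x -> differentiable (fun y => F y i j) x.
Proof.
move=> Fd; apply: (@differentiable_comp _ _ _ _ F (fun N : 'M[R]_(p, q) => N i j)) => //.
exact: differentiable_coord.
Qed.

Lemma entry_continuous {V : normedModType R} p q (F : V -> 'M[R]_(p, q)) (x : V) i j :
  {for x, continuous F} -> {for x, continuous (fun y => F y i j)}.
Proof.
move=> Fc; apply: (@continuous_comp _ _ _ F (fun N : 'M[R]_(p, q) => N i j)) => //.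
exact: coord_continuous.
Qed.

(** * Functions of class C^k on an open set *)

Section Ck_theory.
Context {d : nat}.
Implicit Types (U : set 'rV[R]_d).

Lemma Ck_eq {V : normedModType R} k U (F G : 'rV[R]_d -> V) : open U ->
  (forall x, U x -> F x = G x) -> Ck k U F -> Ck k U G.
Proof.
move=> Uo; have near_eq (F1 G1 : 'rV[R]_d -> V) (x : 'rV[R]_d) :
    (forall x, U x -> F1 x = G1 x) -> U x -> {near x, F1 =1 G1}.
  by move=> FG Ux; apply: (@filterS _ _ (nbhs_filter x) U) => //; exact: open_nbhs_nbhs.
elim: k F G => [|k IH] F G FG [Fc Fd]; split.
- by move=> x Ux; apply: near_eq_continuous (Fc x Ux); exact: near_eq.
- by [].
- by move=> x Ux; apply: near_eq_continuous (Fc x Ux); exact: near_eq.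
- move=> a; have [Fda FCk] := Fd a; split.
    move=> x Ux; apply: near_eq_derivable (Fda x Ux); exact: near_eq.
  apply: IH FCk => x Ux; apply: near_eq_derive; exact: near_eq.
Qed.

Lemma Ck_subset {V : normedModType R} k U U' (F : 'rV[R]_d -> V) :
  U' `<=` U -> Ck k U F -> Ck k U' F.
Proof.
move=> sU; elim: k F => [|k IH] F [Fc Fd]; split => //; first by move=> x /sU /Fc.
  by move=> x /sU /Fc.
by move=> a; have [Fda FCk] := Fd a; split; [move=> x /sU /Fda|exact: IH].
Qed.

Lemma Ck_pred {V : normedModType R} k U (F : 'rV[R]_d -> V) :
  Ck k.+1 U F -> Ck k U F.
Proof.
elim: k F => [|k IH] F [Fc Fd]; split => // a.
by have [Fda FCk] := Fd a; split => //; exact: IH.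
Qed.

Lemma Ck_Ck1 {V : normedModType R} k U (F : 'rV[R]_d -> V) : Ck k.+1 U F -> Ck 1 U F.
Proof. by elim: k => // k IH /Ck_pred. Qed.

Lemma derive_on {V : normedModType R} U (F1 F2 : 'rV[R]_d -> V) (x u : 'rV[R]_d) :
  open U -> U x -> (forall z, U z -> F1 z = F2 z) -> 'D_u F1 x = 'D_u F2 x.
Proof.
move=> Uo Ux F12; apply: near_eq_derive; apply: (@filterS _ _ (nbhs_filter x) U) => //.
exact: open_nbhs_nbhs.
Qed.

Lemma Ck_cst {V : normedModType R} k U (w : V) : Ck k U (fun=> w).
Proof.
have c w' (x : 'rV[R]_d) : {for x, continuous (fun=> w' : V)} by exact: cst_continuous.
elim: k w => [|k IH] w; split=> //.
move=> a; split; first by move=> x _; exact: derivable_cst.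
have -> : (fun x : 'rV[R]_d => 'D_(bvec a) (fun=> w) x) = fun=> 0.
  by apply/funext => x; exact: derive_cst.
exact: IH.
Qed.

Lemma CkD {V : normedModType R} k U (F G : 'rV[R]_d -> V) : open U ->
  Ck k U F -> Ck k U G -> Ck k U (fun x => F x + G x).
Proof.
move=> Uo; elim: k F G => [|k IH] F G [Fc Fd] [Gc Gd].
  by split=> [x Ux|]; [apply: continuousD; [exact: Fc|exact: Gc]|].
split=> [x Ux|a]; first by apply: continuousD; [exact: Fc|exact: Gc].
have [Fda FCk] := Fd a; have [Gda GCk] := Gd a; split.
  by move=> x Ux; apply: derivableD; [exact: Fda|exact: Gda].
apply: Ck_eq Uo _ (IH _ _ FCk GCk) => x Ux.
by rewrite -deriveD //; [exact: Fda|exact: Gda].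
Qed.

Lemma Ck_sum {V : normedModType R} k U (I : Type) (r : seq I) (F : I -> 'rV[R]_d -> V) :
  open U -> (forall i, Ck k U (F i)) -> Ck k U (fun x => \sum_(i <- r) F i x).
Proof.
move=> Uo Fk; elim: r => [|i r IH].
  by apply: Ck_eq Uo _ (Ck_cst _ _ 0) => x _; rewrite big_nil.
by apply: Ck_eq Uo _ (CkD Uo (Fk i) IH) => x _; rewrite big_cons.
Qed.

Lemma CkZl {V : normedModType R} k U (f : 'rV[R]_d -> R) (w : V) : open U ->
  Ck k U f -> Ck k U (fun x => f x *: w).
Proof.
move=> Uo; elim: k f => [|k IH] f [fc fd].
  by split=> [x Ux|]; [apply: continuousZr_tmp; exact: fc|].
split=> [x Ux|a]; first by apply: continuousZr_tmp; exact: fc.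
have [fda fCk] := fd a.
have key x : U x -> is_derive x (bvec a) (fun x => f x *: w) ('D_(bvec a) f x *: w).
  move=> Ux; have [fx _] := derivableP (fda x Ux).
  have cv : (fun h : R => h^-1 *: (f (h *: bvec a + x) *: w - f x *: w)) @ 0^'
     --> 'D_(bvec a) f x *: w.
    have -> : (fun h : R => h^-1 *: (f (h *: bvec a + x) *: w - f x *: w))
       = (fun h : R => (h^-1 *: (f (h *: bvec a + x) - f x)) *: w).
      by apply/funext => h; rewrite -scalerBl scalerA.
    by apply: cvgZ; [exact: fda|exact: cvg_cst].
  by apply: DeriveDef; [apply/cvg_ex; eexists; exact: cv|exact: cvg_lim].
split; first by move=> x Ux; case: (key x Ux).
by apply: Ck_eq Uo _ (IH _ fCk) => x Ux; case: (key x Ux).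
Qed.

Lemma CkM k U (f g : 'rV[R]_d -> R) : open U ->
  Ck k U f -> Ck k U g -> Ck k U (fun x => f x * g x).
Proof.
move=> Uo; elim: k f g => [|k IH] f g [fc fd] [gc gd].
  by split=> [x Ux|]; [apply: continuousM; [exact: fc|exact: gc]|].
split=> [x Ux|a]; first by apply: continuousM; [exact: fc|exact: gc].
have [fda fCk] := fd a; have [gda gCk] := gd a; split.
  by move=> x Ux; apply: derivableM; [exact: fda|exact: gda].
have Cf : Ck k U f by apply: Ck_pred.
have Cg : Ck k U g by apply: Ck_pred.
apply: Ck_eq Uo _ (CkD Uo (IH _ _ Cf gCk) (IH _ _ Cg fCk)) => x Ux.
by rewrite (deriveM (fda x Ux) (gda x Ux)).
Qed.

Lemma Ck_entry k U p q (F : 'rV[R]_d -> 'M[R]_(p, q)) i j : open U ->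
  Ck k U F -> Ck k U (fun x => F x i j).
Proof.
move=> Uo; elim: k F => [|k IH] F [Fc Fd].
  by split=> [x Ux|]; [exact: entry_continuous (Fc x Ux)|].
split=> [x Ux|a]; first exact: entry_continuous (Fc x Ux).
have [Fda FCk] := Fd a; split.
  by move=> x Ux; have /derivable_mxP := Fda x Ux; apply.
apply: Ck_eq Uo _ (IH _ FCk) => x Ux.
by rewrite derive_mx ?mxE //; exact: Fda.
Qed.

Lemma Ck_mx k U p q (F : 'rV[R]_d -> 'M[R]_(p, q)) : open U ->
  (forall i j, Ck k U (fun x => F x i j)) -> Ck k U F.
Proof.
move=> Uo Fk; apply: (@Ck_eq _ _ _ (fun y => \sum_i \sum_j F y i j *: delta_mx i j)) => //.
  by move=> x _; rewrite -matrix_sum_delta.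
apply: Ck_sum => // i; apply: Ck_sum => // j.
exact: (@CkZl _ _ _ (fun y => F y i j)).
Qed.

Lemma Ck1_differentiable_scalar U (f : 'rV[R]_d -> R) (x : 'rV[R]_d) :
  open U -> Ck 1 U f -> U x -> differentiable f x.
Proof.
move=> Uo [_ fd] Ux; have H := @C1_differentiable_scalar d U f x Uo Ux; apply: H => a.
  by move=> y Uy; have [+ _] := fd a; apply.
by have [_ [+ _]] := fd a; apply.
Qed.

Lemma Ck1_differentiable U p q (F : 'rV[R]_d -> 'M[R]_(p, q)) (x : 'rV[R]_d) :
  open U -> Ck 1 U F -> U x -> differentiable F x.
Proof.
move=> Uo Fk Ux; apply: differentiable_mx => i j.
exact: (Ck1_differentiable_scalar Uo (Ck_entry i j Uo Fk) Ux).
Qed.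

End Ck_theory.

End Differentiation.

(** * Mixed derivatives, product rules and the chain rule *)

Section Calculus.
Context {R : realType}.

(** The second difference is an increment along v of y |-> f(y + s u) - f(y). The mean value theorem
    along v, then along u for the derivative of f in direction v, leaves a single mixed
    derivative. *)
Lemma second_difference {V : normedModType R} (f : V -> R) (x u v : V) (s : R) :
  0 <= s ->
  (forall a b, 0 <= a <= s -> 0 <= b <= s ->
    derivable f (x + a *: u + b *: v) v /\
    derivable (fun y => 'D_v f y) (x + a *: u + b *: v) u) ->
  exists a b, [/\ 0 <= a <= s, 0 <= b <= s &
    f (x + s *: u + s *: v) - f (x + s *: u) - (f (x + s *: v) - f x)
    = s * (s * 'D_u (fun y => 'D_v f y) (x + a *: u + b *: v))].
Proof.
move=> s0 fd; have s0' : 0 <= s <= s by rewrite s0 lexx.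
have z0 : 0 <= (0:R) <= s by rewrite lexx.
pose phi y := f (y + s *: u) - f y.
have dphi b : 0 <= b <= s -> is_derive (x + b *: v) v phi
    ('D_v f (x + s *: u + b *: v) - 'D_v f (x + b *: v)).
  move=> b0s; have [d1 _] := fd s b s0' b0s; have [d2 _] := fd 0 b z0 b0s.
  rewrite scale0r addr0 in d2.
  apply: is_deriveB; last exact: derivableP.
  have E : (fun h : R => h^-1 *: (f (h *: v + (x + b *: v) + s *: u) - f (x + b *: v + s
    *: u)))
     = (fun h : R => h^-1 *: (f (h *: v + (x + s *: u + b *: v)) - f (x + s *: u + b *:
       v))).
    by apply/funext => h; rewrite -!addrA (addrC (b *: v)).
  by apply: DeriveDef; [rewrite /derivable E|rewrite /derive E].
have [b b0s|b b0s Eb] := @directional_MVT _ _ phi x v s s0.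
  by have [] := dphi b b0s.
have [a a0s|a a0s Ea] := @directional_MVT _ _ (fun y => 'D_v f y) (x + b *: v) u s s0.
  by have [_] := fd a b a0s b0s; rewrite addrAC.
exists a, b; split => //; rewrite (addrAC x (a *: u)) -Ea.
have [_ Ed] := dphi b b0s; rewrite Ed in Eb.
move: Eb; rewrite /phi (addrAC x (b *: v)) => <-; rewrite (addrAC x (s *: v)); ring.
Qed.

(* Both mixed derivatives are limits of the same second difference quotient. *)
Lemma schwarz_scalar {V : normedModType R} (f : V -> R) (x u v : V) :
  (\forall y \near x, [/\ derivable f y u, derivable f y v,
     derivable (fun y => 'D_v f y) y u & derivable (fun y => 'D_u f y) y v]) ->
  {for x, continuous (fun y => 'D_u (fun z => 'D_v f z) y)} ->
  {for x, continuous (fun y => 'D_v (fun z => 'D_u f z) y)} ->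
  'D_u (fun z => 'D_v f z) x = 'D_v (fun z => 'D_u f z) x.
Proof.
move=> fd c1 c2; apply/eqP; rewrite -subr_eq0 -normr_le0; apply/ler_addgt0Pl => e e0.
rewrite addr0; have e20 : 0 < e / 2 by rewrite divr_gt0.
move/cvgrPdist_le : c1 => /(_ _ e20) n1; move/cvgrPdist_le : c2 => /(_ _ e20) n2.
have := @filterI _ _ (nbhs_filter x) _ _ fd (@filterI _ _ (nbhs_filter x) _ _ n1 n2).
move=> /(iffLR (@nbhs_normP R V _ _))[r /= r0 rU].
(* Small enough for the parallelogram spanned by s u and s v to stay in the ball; the summand 1
   avoids a zero denominator and makes the bound strict. *)
pose s := r / (1 + `|u| + `|v|).
have nuv : 0 < 1 + `|u| + `|v| by rewrite -addrA ltr_pwDl // addr_ge0.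
have s0 : 0 < s by rewrite divr_gt0.
have inr a b : 0 <= a <= s -> 0 <= b <= s -> ball_ Num.Def.normr x r (x + a *: u + b *: v).
  move=> /andP[a0 as'] /andP[b0 bs]; rewrite /ball_ /= -addrA opprD addNKr normrN.
  rewrite (le_lt_trans (ler_normD _ _)) // !normrZ (ger0_norm a0) (ger0_norm b0).
  have -> : r = s * (1 + `|u| + `|v|) by rewrite /s divfK // gt_eqF.
  rewrite -addrA !mulrDr mulr1 ltr_pwDl // lerD // ler_wpM2r //.
have [a|a [b [a0s b0s]]] := second_difference (f := f) (x := x) (u := u) (v := v) (ltW s0).
  by move=> b a0s b0s; have [[]] := rU _ (inr a b a0s b0s).
have [b'|b' [a' [b0s' a0s']]] := second_difference (f := f) (x := x) (u := v) (v := u)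
  (ltW s0).
  by move=> a' b0s' a0s'; rewrite (addrAC x (b' *: v));
    have [[]] := rU _ (inr a' b' a0s' b0s').
rewrite (addrAC x (s *: v)) (addrAC x (b' *: v)).
have -> : f (x + s *: u + s *: v) - f (x + s *: v) - (f (x + s *: u) - f x)
  = f (x + s *: u + s *: v) - f (x + s *: u) - (f (x + s *: v) - f x) by ring.
move=> -> /(mulfI (lt0r_neq0 s0)) /(mulfI (lt0r_neq0 s0)) E.
have [_ [H1 _]] := rU _ (inr a b a0s b0s); have [_ [_ H2]] := rU _ (inr a' b' a0s' b0s').
have triangle (A B P Q : R) : `|A - P| <= e / 2 -> `|B - Q| <= e / 2 -> P = Q -> `|A - B|
  <= e.
  move=> AP BQ PQ; rewrite (splitr e) (le_trans (ler_distD P A B)) // lerD //.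
  by rewrite distrC PQ.
exact: (triangle _ _ _ _ H1 H2 (esym E)).
Qed.

Lemma linear_derive {V W : normedModType R} (F : V -> W) (x : V) a (u v : V) :
  differentiable F x -> 'D_(a *: u + v) F x = a *: 'D_u F x + 'D_v F x.
Proof. by move=> Fd; rewrite !deriveE // linearP. Qed.

Lemma derive_rV_sum {W : normedModType R} d (F : 'rV[R]_d -> W) (x u : 'rV[R]_d) :
  differentiable F x -> 'D_u F x = \sum_a u 0 a *: 'D_(bvec a) F x.
Proof.
move=> Fd; rewrite deriveE // {1}(row_sum_delta u) linear_sum.
by apply: eq_bigr => a _; rewrite linearZ deriveE.
Qed.

Lemma derive_comp {U V W : normedModType R} (y : U -> V) (F : V -> W) (x u : U) :
  differentiable y x -> differentiable F (y x) ->
  'D_u (fun z => F (y z)) x = 'D_('D_u y x) F (y x).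
Proof.
move=> yd Fd; have Fyd : differentiable (F \o y) x by exact: differentiable_comp.
by rewrite [LHS](deriveE _ Fyd) diff_comp //= !deriveE.
Qed.

Lemma is_derive_entry {V : normedModType R} p q (F : V -> 'M[R]_(p, q)) (x v : V) (dF :
  'M[R]_(p, q)) i j :
  is_derive x v F dF -> is_derive x v (fun z => F z i j) (dF i j).
Proof.
move=> [Fd <-]; rewrite derive_mx // mxE.
by apply: derivableP; have /derivable_mxP := Fd; apply.
Qed.

Lemma is_derive_mx {V : normedModType R} p q (F : V -> 'M[R]_(p, q)) (x v : V) (dF :
  'M[R]_(p, q)) :
  (forall i j, is_derive x v (fun z => F z i j) (dF i j)) -> is_derive x v F dF.
Proof.
move=> Fd; have D : derivable F x v by apply/derivable_mxP => i j; case: (Fd i j).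
by apply: DeriveDef => //; rewrite derive_mx //; apply/matrixP => i j; rewrite mxE;
  case: (Fd i j).
Qed.

Lemma is_derive_big {V W : normedModType R} (I : Type) (r : seq I)
    (F : I -> V -> W) (dF : I -> W) (x v : V) :
  (forall i, is_derive x v (F i) (dF i)) ->
  is_derive x v (fun y => \sum_(i <- r) F i y) (\sum_(i <- r) dF i).
Proof.
move=> Fd; elim: r => [|i r IH].
  rewrite big_nil; have -> : (fun y => \sum_(i <- [::]) F i y) = cst 0.
    by apply/funext => y; rewrite big_nil.
  exact: is_derive_cst.
rewrite big_cons; have -> : (fun y => \sum_(j <- i :: r) F j y) = F i + (fun y => \sum_(j
  <- r) F j y).
  by apply/funext => y; rewrite big_cons.
exact: is_deriveD.
Qed.

Lemma is_derive_mulmx {V : normedModType R} p q r (F : V -> 'M[R]_(p, q))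
    (G : V -> 'M[R]_(q, r)) (x v : V) (dF : 'M[R]_(p, q)) (dG : 'M[R]_(q, r)) :
  is_derive x v F dF -> is_derive x v G dG ->
  is_derive x v (fun z => F z *m G z) (dF *m G x + F x *m dG).
Proof.
move=> Fd Gd; apply: is_derive_mx => i j.
have -> : (fun z => (F z *m G z) i j) = fun z => \sum_k F z i k * G z k j.
  by apply/funext => z; rewrite mxE.
have -> : (dF *m G x + F x *m dG) i j = \sum_k (dF i k * G x k j + F x i k * dG k j).
  by rewrite !mxE -big_split.
apply: is_derive_big => k.
have := is_deriveM (is_derive_entry i k Fd) (is_derive_entry k j Gd).
move=> H; apply: (is_derive_eq H); rewrite addrC; congr (_ + _); exact: mulrC.
Qed.

Lemma is_derive_scale {V : normedModType R} p q (f : V -> R) (F : V -> 'M[R]_(p, q))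
    (x v : V) (df : R) (dF : 'M[R]_(p, q)) :
  is_derive x v f df -> is_derive x v F dF ->
  is_derive x v (fun z => f z *: F z) (df *: F x + f x *: dF).
Proof.
move=> fd Fd; apply: is_derive_mx => i j.
have -> : (fun z => (f z *: F z) i j) = fun z => f z * F z i j.
  by apply/funext => z; rewrite mxE.
have := is_deriveM fd (is_derive_entry i j Fd).
by move=> H; apply: (is_derive_eq H); rewrite !mxE addrC; congr (_ + _); exact: mulrC.
Qed.

Lemma is_derive_trmx {V : normedModType R} p q (F : V -> 'M[R]_(p, q)) (x v : V) (dF :
  'M[R]_(p, q)) :
  is_derive x v F dF -> is_derive x v (fun z => (F z)^T) dF^T.
Proof.
move=> Fd; apply: is_derive_mx => i j.
have -> : (fun z => (F z)^T i j) = fun z => F z j i by apply/funext => z; rewrite mxE.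
by rewrite mxE; exact: is_derive_entry.
Qed.

Lemma differentiable_mulmx {V : normedModType R} p q r (F : V -> 'M[R]_(p, q))
    (G : V -> 'M[R]_(q, r)) (x : V) :
  differentiable F x -> differentiable G x -> differentiable (fun z => F z *m G z) x.
Proof.
move=> Fd Gd; apply: differentiable_mx => i j.
have -> : (fun z => (F z *m G z) i j) = fun z => \sum_k F z i k * G z k j.
  by apply/funext => z; rewrite mxE.
apply: differentiable_big => k.
by apply: differentiableM; exact: differentiable_entry.
Qed.

Lemma derive0_segment {V : normedModType R} (f : V -> R) (x u : V) :
  (forall t, 0 <= t <= 1 -> derivable f (x + t *: u) u /\ 'D_u f (x + t *: u) = 0) ->
  f (x + u) = f x.
Proof.
move=> fd; have [t t01|t t01] := @directional_MVT _ _ f x u 1 ler01.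
  by have [] := fd t t01.
by have [_ ->] := fd t t01; rewrite scale1r mulr0 => /eqP; rewrite subr_eq0 => /eqP.
Qed.

(** Induction on k through the chain rule: the partial derivatives of the composite are sums of
    products of those of y with those of f along y, and the latter fall under the induction
    hypothesis. *)
Lemma Ck_comp d e k (U : set 'rV[R]_d) (U' : set 'rV[R]_e)
    (y : 'rV[R]_d -> 'rV[R]_e) (f : 'rV[R]_e -> R) :
  open U -> open U' -> (forall x, U x -> U' (y x)) ->
  Ck k U y -> Ck k U' f -> Ck k U (fun x => f (y x)).
Proof.
move=> Uo Uo' yU; elim: k f => [|k IH] f yk fk.
  split=> // x Ux; apply: (@continuous_comp _ _ _ y f); first exact: yk.1.
  by apply: fk.1; exact: yU.
have [yc yd] := yk; have [fc fd] := fk.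
split=> [x Ux|a].
  by apply: (@continuous_comp _ _ _ y f); [exact: yc|apply: fc; exact: yU].
have yD (x : 'rV[R]_d) : U x -> differentiable y x.
  exact: (@Ck1_differentiable _ _ U) (Ck_Ck1 yk).
have fD (x : 'rV[R]_e) : U' x -> differentiable f x.
  exact: (@Ck1_differentiable_scalar _ _ U') (Ck_Ck1 fk).
split.
  move=> x Ux; apply: diff_derivable; apply: (@differentiable_comp _ _ _ _ y f).
    exact: yD.
  by apply: fD; exact: yU.
apply: (@Ck_eq _ _ _ _ _ (fun x => \sum_b ('D_(bvec a) y x) 0 b * 'D_(bvec b) f (y x))) =>
  //.
  move=> x Ux; rewrite (@derive_comp _ _ _ y f x) //; [|exact: yD|apply: fD; exact: yU].
  by rewrite [RHS]derive_rV_sum //; apply: fD; exact: yU.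
apply: Ck_sum => // b; apply: CkM => //.
  by apply: Ck_entry => //; have [] := yd a.
by apply: (IH (fun z => 'D_(bvec b) f z)); [exact: Ck_pred|have [] := fd b].
Qed.

End Calculus.

(** * Levi-Civita calculus in a chart *)

Section InnerProduct.
Context {R : realType} {d : nat}.
Implicit Types (G : 'M[R]_d) (u v w : 'rV[R]_d).

Lemma ipDl G u v w : ip G (u + v) w = ip G u w + ip G v w.
Proof. by rewrite /ip !mulmxDl mxE. Qed.
Lemma ipDr G u v w : ip G w (u + v) = ip G w u + ip G w v.
Proof. by rewrite /ip linearD /= mulmxDr mxE. Qed.
Lemma ipZl G a u w : ip G (a *: u) w = a * ip G u w.
Proof. by rewrite /ip -!scalemxAl mxE. Qed.
Lemma ipZr G a u w : ip G w (a *: u) = a * ip G w u.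
Proof. by rewrite /ip linearZ /= -scalemxAr mxE. Qed.
Lemma ipNl G u w : ip G (- u) w = - ip G u w.
Proof. by rewrite -scaleN1r ipZl mulN1r. Qed.
Lemma ipNr G u w : ip G w (- u) = - ip G w u.
Proof. by rewrite -scaleN1r ipZr mulN1r. Qed.
Lemma ip0l G w : ip G 0 w = 0.
Proof. by rewrite /ip !mul0mx mxE. Qed.
Lemma ip0r G w : ip G w 0 = 0.
Proof. by rewrite /ip trmx0 mulmx0 mxE. Qed.
Lemma ipBl G u v w : ip G (u - v) w = ip G u w - ip G v w.
Proof. by rewrite ipDl ipNl. Qed.
Lemma ipBr G u v w : ip G w (u - v) = ip G w u - ip G w v.
Proof. by rewrite ipDr ipNr. Qed.
Lemma ip_addl G G' u v : ip (G + G') u v = ip G u v + ip G' u v.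
Proof. by rewrite /ip mulmxDr mulmxDl mxE. Qed.
Lemma ip_sumr (I : Type) (r : seq I) (F : I -> 'rV[R]_d) G w :
  ip G w (\sum_(i <- r) F i) = \sum_(i <- r) ip G w (F i).
Proof. by elim/big_rec2: _ => [|i x y _ <-]; rewrite ?ip0r // ipDr. Qed.

Lemma ipC G u v : G^T = G -> ip G u v = ip G v u.
Proof.
move=> Gs; rewrite /ip -[in LHS](trmxK (u *m G *m v^T)) mxE.
by rewrite !trmx_mul trmxK Gs mulmxA.
Qed.

Lemma ip_mull G (T : 'M[R]_d) u v : ip G (u *m T) v = ip (T *m G) u v.
Proof. by rewrite /ip mulmxA. Qed.
Lemma ip_mulr G (T : 'M[R]_d) u v : ip G u (v *m T) = ip (G *m T^T) u v.
Proof. by rewrite /ip trmx_mul !mulmxA. Qed.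

Lemma ip_bvec G a b : ip G (bvec a) (bvec b) = G a b.
Proof. by rewrite /ip /bvec -rowE trmx_delta -colE !mxE. Qed.

Definition posdef G := forall u, u != 0 -> 0 < ip G u u.

Lemma posdef_eq0 G u : posdef G -> ip G u u = 0 -> u = 0.
Proof.
by move=> Gp E; apply/eqP/negPn/negP => /Gp; rewrite E ltxx.
Qed.

Lemma posdef_ge0 G u : posdef G -> 0 <= ip G u u.
Proof. by move=> Gp; have [->|/Gp/ltW//] := eqVneq u 0; rewrite ip0l. Qed.

Lemma posdef_unitmx G : posdef G -> G \in unitmx.
Proof.
move=> Gp; rewrite -row_free_unit -kermx_eq0; apply/rowV0P => u /sub_kermxP uG.
by apply: posdef_eq0 Gp _; rewrite /ip uG mul0mx mxE.
Qed.

Lemma ip_invmx G u a : G^T = G -> G \in unitmx ->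
  ip G (\row_k \sum_l invmx G k l * u 0 l) (bvec a) = u 0 a.
Proof.
move=> Gs Gu; have -> : \row_k \sum_l invmx G k l * u 0 l = u *m (invmx G)^T.
  by apply/rowP => k; rewrite !mxE; apply: eq_bigr => l _; rewrite mxE mulrC.
by rewrite trmx_inv Gs /ip -!mulmxA mulKmx // trmx_delta -colE mxE.
Qed.

Lemma ip_exp M u v : ip M u v = \sum_i \sum_j M i j * u 0 i * v 0 j.
Proof.
rewrite /ip mxE exchange_big /=; apply: eq_bigr => j _.
by rewrite !mxE mulr_suml; apply: eq_bigr => i _; rewrite (mulrC (u 0 i)).
Qed.

Lemma ip_expr M u c : ip M u (bvec c) = \sum_i M i c * u 0 i.
Proof.
by rewrite /ip trmx_delta -colE !mxE; apply: eq_bigr => i _; exact: mulrC.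
Qed.

(* [christoffel_form] with the derivative of the metric replaced by a linear map. *)
Definition koszul_form G (D : 'rV[R]_d -> 'M[R]_d) u v : 'rV[R]_d :=
  \row_k \sum_i \sum_j (2^-1 * \sum_l invmx G k l *
    (D (bvec i) j l + D (bvec j) i l - D (bvec l) i j)) * u 0 i * v 0 j.

(** Koszul formula. [koszul_form] raises the index of a covector with the inverse of G, and pairing
    with G lowers it again; linearity in w reduces to coordinate vectors. *)
Lemma koszul_formE G (D : 'rV[R]_d -> 'M[R]_d) u v w : G^T = G -> G \in unitmx ->
  linear D ->
  ip G (koszul_form G D u v) w = 2^-1 * (ip (D u) v w + ip (D v) u w - ip (D w) u v).
Proof.
move=> Gs Gu Dlin.
have DZD a z z' t t' : ip (D (a *: z + z')) t t' = a * ip (D z) t t' + ip (D z') t t'.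
  by rewrite Dlin ip_addl /ip -scalemxAr -scalemxAl mxE.
have D0 t t' : ip (D 0) t t' = 0.
  by have := DZD (-1) 0 0 t t'; rewrite scaler0 addr0 mulN1r addNr.
have Dg_sum z t t' : ip (D z) t t' = \sum_c z 0 c * ip (D (bvec c)) t t'.
  rewrite {1}(row_sum_delta z).
  have := big_morph (fun z => ip (D z) t t') (id1 := 0) (op1 := +%R) _ (D0 t t') => ->.
    by apply: eq_bigr => c _; have := DZD (z 0 c) (bvec c) 0 t t'; rewrite addr0 D0 addr0.
  by move=> z1 z2; have := DZD 1 z1 z2 t t'; rewrite scale1r mul1r.
suff H : forall c, ip G (koszul_form G D u v) (bvec c) = 2^-1 * (ip (D u) v (bvec c)
    + ip (D v) u (bvec c) - ip (D (bvec c)) u v).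
  have wE M t : ip M t w = \sum_c w 0 c * ip M t (bvec c).
    by rewrite {1}(row_sum_delta w) ip_sumr; apply: eq_bigr => c _; rewrite ipZr.
  rewrite (Dg_sum w) !wE -big_split -sumrB mulr_sumr /=.
  by apply: eq_bigr => c _; rewrite H; ring.
(* The covector before its index is raised. *)
move=> c; pose L : 'rV[R]_d := \row_l (2^-1 * \sum_i \sum_j (D (bvec i) j l
   + D (bvec j) i l - D (bvec l) i j) * u 0 i * v 0 j).
have -> : koszul_form G D u v = \row_k \sum_l invmx G k l * L 0 l.
  apply/rowP => k; rewrite !mxE.
  under [in RHS]eq_bigr => l _ do rewrite mxE mulrA (mulrC _ 2^-1) -mulrA mulr_sumr.
  rewrite -mulr_sumr [in RHS]exchange_big mulr_sumr /=; apply: eq_bigr => i _.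
  under [in RHS]eq_bigr => l _ do rewrite mulr_sumr.
  rewrite [in RHS]exchange_big mulr_sumr /=; apply: eq_bigr => j _.
  rewrite -!mulrA mulr_suml; congr (_ * _).
  by apply: eq_bigr => l _; ring.
rewrite ip_invmx // mxE; congr (_ * _); rewrite (Dg_sum u) (Dg_sum v) ip_exp.
rewrite (_ : \sum_c0 u 0 c0 * _ = \sum_i \sum_j D (bvec i) j c * u 0 i * v 0 j); last first.
  by apply: eq_bigr => i _; rewrite ip_expr mulr_sumr; apply: eq_bigr => j _; ring.
rewrite (_ : \sum_c0 v 0 c0 * _ = \sum_i \sum_j D (bvec j) i c * u 0 i * v 0 j); last first.
  rewrite exchange_big; apply: eq_bigr => i _; rewrite ip_expr mulr_sumr.
  by apply: eq_bigr => j _ /=; ring.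
rewrite -big_split -sumrB; apply: eq_bigr => i _.
by rewrite -big_split -sumrB; apply: eq_bigr => j _ /=; ring.
Qed.

Lemma koszul_form_sym G (D : 'rV[R]_d -> 'M[R]_d) u v : G^T = G -> posdef G ->
  linear D -> (forall t, (D t)^T = D t) -> koszul_form G D u v = koszul_form G D v u.
Proof.
move=> Gs Gp Dl Ds; apply/eqP; rewrite -subr_eq0; apply/eqP; apply: (posdef_eq0 Gp).
by rewrite ipBl !koszul_formE ?posdef_unitmx // (ipC u v (Ds _)); ring.
Qed.

Lemma koszul_form_compat G (D : 'rV[R]_d -> 'M[R]_d) w u v : G^T = G -> posdef G ->
  linear D -> (forall t, (D t)^T = D t) ->
  ip (D w) u v = ip G (koszul_form G D w u) v + ip G u (koszul_form G D w v).
Proof.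
move=> Gs Gp Dl Ds; rewrite (ipC u _ Gs) !koszul_formE ?posdef_unitmx //.
by rewrite (ipC v u (Ds w)); field.
Qed.

End InnerProduct.

Section Metric.
Context {R : realType} {d : nat}.

(** The atlas-free part of [is_metric], relative to an arbitrary open set: it is used on the image
    of a chart and on the smaller domain of a map expressed in charts. *)
Record metric_chart (g : mfield R d) (U : set 'rV[R]_d) : Prop := MetricChart {
  mc_open : open U;
  mc_smooth : smooth_on U g;
  mc_sym : forall x, U x -> (g x)^T = g x;
  mc_pos : forall x, U x -> posdef (g x)
}.

Lemma derive_entry {V : normedModType R} p q (F : V -> 'M[R]_(p, q)) (x v : V) i j :
  derivable F x v -> 'D_v (fun z => F z i j) x = ('D_v F x) i j.
Proof. by move=> Fd; rewrite derive_mx // mxE. Qed.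

Lemma is_derive_diff {V W : normedModType R} (F : V -> W) (x u : V) :
  differentiable F x -> is_derive x u F ('D_u F x).
Proof. by move=> Fd; apply: derivableP; exact: diff_derivable. Qed.

Lemma smooth_differentiable p q (U : set 'rV[R]_d) (F : 'rV[R]_d -> 'M[R]_(p, q)) (x :
  'rV[R]_d) :
  open U -> smooth_on U F -> U x -> differentiable F x.
Proof. by move=> Uo Fs; exact: Ck1_differentiable (Fs 1%N). Qed.

Context (g : mfield R d) (U : set 'rV[R]_d) (gU : metric_chart g U).
Context (x : 'rV[R]_d) (Ux : U x).

Local Notation Gam := (christoffel_form g x).

Lemma metric_differentiable : differentiable g x.
Proof. by apply: smooth_differentiable Ux; [exact: mc_open gU|exact: mc_smooth gU]. Qed.

Lemma metric_ipC u v : ip (g x) u v = ip (g x) v u.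
Proof. by apply: ipC; exact: (mc_sym gU). Qed.

Lemma derive_metric_sym u : ('D_u g x)^T = 'D_u g x.
Proof.
have [_ <-] := is_derive_trmx (is_derive_diff u metric_differentiable).
exact: derive_on (mc_open gU) Ux (mc_sym gU).
Qed.

Lemma christoffel_lin_l a u u' v : Gam (a *: u + u') v = a *: Gam u v + Gam u' v.
Proof.
apply/rowP => k; rewrite !mxE mulr_sumr -big_split; apply: eq_bigr => i _.
rewrite mulr_sumr -big_split; apply: eq_bigr => j _ /=; rewrite !mxE; ring.
Qed.

Lemma christoffel_lin_r a u v v' : Gam u (a *: v + v') = a *: Gam u v + Gam u v'.
Proof.
apply/rowP => k; rewrite !mxE mulr_sumr -big_split; apply: eq_bigr => i _.
rewrite mulr_sumr -big_split; apply: eq_bigr => j _ /=; rewrite !mxE; ring.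
Qed.

Lemma christoffel0l v : Gam 0 v = 0.
Proof. by have := christoffel_lin_l (-1) 0 0 v; rewrite scaler0 addr0 scaleN1r addNr. Qed.
Lemma christoffel0r u : Gam u 0 = 0.
Proof. by have := christoffel_lin_r (-1) u 0 0; rewrite scaler0 addr0 scaleN1r addNr. Qed.
Lemma christoffelZr a u v : Gam u (a *: v) = a *: Gam u v.
Proof. by have := christoffel_lin_r a u v 0; rewrite addr0 christoffel0r addr0. Qed.

Let D t := 'D_t g x.

Lemma derive_metric_linear : linear D.
Proof. by move=> a t t'; exact: linear_derive metric_differentiable. Qed.

Lemma christoffel_formE u v : Gam u v = koszul_form (g x) D u v.
Proof.
have gd := metric_differentiable.
apply/rowP => k; rewrite /christoffel_form /koszul_form !mxE.
apply: eq_bigr => i _; apply: eq_bigr => j _.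
congr (_ * _ * _); rewrite /christoffel; congr (_ * _); apply: eq_bigr => l _.
by rewrite !derive_entry //; exact: diff_derivable.
Qed.

Lemma christoffel_sym u v : Gam u v = Gam v u.
Proof.
rewrite !christoffel_formE; apply: koszul_form_sym.
- exact: (mc_sym gU).
- exact: (mc_pos gU).
- exact: derive_metric_linear.
- exact: derive_metric_sym.
Qed.

Lemma metric_compat w u v :
  ip ('D_w g x) u v = ip (g x) (Gam w u) v + ip (g x) u (Gam w v).
Proof.
rewrite !christoffel_formE; apply: (@koszul_form_compat _ _ _ D).
- exact: (mc_sym gU).
- exact: (mc_pos gU).
- exact: derive_metric_linear.
- exact: derive_metric_sym.
Qed.

End Metric.

(** The shape common to [cov_end] and [hess]: two linear terms minus a third. *)
Lemma lin_comb3 {K : pzRingType} {V : lmodType K} a (p q r p' q' r' : V) :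
  a *: p + p' + (a *: q + q') - (a *: r + r') = a *: (p + q - r) + (p' + q' - r').
Proof.
by rewrite !scalerDr scalerN opprD (addrACA (a *: p)) (addrACA (a *: p + _)).
Qed.

(** * Covariant derivatives of vector fields and of endomorphisms *)

Section CovariantDerivative.
Context {R : realType} {d : nat} (g : mfield R d) (U : set 'rV[R]_d).
Context (gU : metric_chart g U) (x : 'rV[R]_d) (Ux : U x).
Local Notation Gam := (christoffel_form g x).

Lemma christoffelDr u v v' : Gam u (v + v') = Gam u v + Gam u v'.
Proof. by have := christoffel_lin_r g x 1 u v v'; rewrite !scale1r. Qed.
Lemma christoffelNr u v : Gam u (- v) = - Gam u v.
Proof. by rewrite -scaleN1r christoffelZr scaleN1r. Qed.

Definition cov (u : 'rV[R]_d) (Y : vfield R d) : 'rV[R]_d :=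
  'D_u Y x + Gam u (Y x).

(** By [metric_compat], the derivative of the metric is absorbed by the Christoffel terms of the two
    [cov]. *)
Lemma is_derive_ip u (Y Z : vfield R d) : differentiable Y x -> differentiable Z x ->
  is_derive x u (fun z => ip (g z) (Y z) (Z z))
    (ip (g x) (cov u Y) (Z x) + ip (g x) (Y x) (cov u Z)).
Proof.
move=> Yd Zd.
have H := is_derive_mulmx
  (is_derive_mulmx (is_derive_diff u Yd) (is_derive_diff u (metric_differentiable gU Ux)))
  (is_derive_trmx (is_derive_diff u Zd)).
apply: (is_derive_eq (is_derive_entry 0 0 H)).
rewrite mulmxDl [LHS]mxE [X in X + _ = _]mxE.
rewrite -[X in X + _ + _]/(ip (g x) ('D_u Y x) (Z x)).
rewrite -[X in _ + X + _]/(ip ('D_u g x) (Y x) (Z x)).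
rewrite -[X in _ + X = _]/(ip (g x) (Y x) ('D_u Z x)).
rewrite (metric_compat gU Ux) /cov ipDl ipDr.
set a := ip _ _ _; set b := ip _ _ _; set c := ip _ _ _; set e := ip _ _ _.
by rewrite !addrA (addrAC _ c e).
Qed.

(* (nabla_u T) v, a tensor in u and v. *)
Definition cov_end (T : mfield R d) (u v : 'rV[R]_d) : 'rV[R]_d :=
  v *m 'D_u T x + Gam u (v *m T x) - Gam u v *m T x.

Section Endo.
Context (T : mfield R d) (Ts : smooth_on U T).

Lemma endo_differentiable : differentiable T x.
Proof. exact: smooth_differentiable (mc_open gU) Ts Ux. Qed.

(** Tensoriality: the derivative of Y occurs in both terms of [nabla_end] and cancels. Conditions on
    vector fields thus become conditions on vectors, tested on constant fields. *)
Lemma nabla_endE (X Y : vfield R d) : differentiable Y x ->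
  nabla_end g T X Y x = cov_end T (X x) (Y x).
Proof.
move=> Yd; have Td := endo_differentiable.
have [_ E] := is_derive_mulmx (is_derive_diff (X x) Yd) (is_derive_diff (X x) Td).
rewrite /nabla_end /nabla /Lder /app_end /cov_end E mulmxDl opprD.
by rewrite addrA -(addrA ('D_(X x) Y x *m T x)) (addrC ('D_(X x) Y x *m T x)) addrK.
Qed.

Lemma cov_end_linl a u u' v : cov_end T (a *: u + u') v = a *: cov_end T u v + cov_end T
  u' v.
Proof.
rewrite /cov_end linear_derive; last exact: endo_differentiable.
rewrite !christoffel_lin_l mulmxDr mulmxDl -scalemxAr -scalemxAl.
exact: lin_comb3.
Qed.

Lemma cov_end_linr a u v v' : cov_end T u (a *: v + v') = a *: cov_end T u v + cov_end T u
  v'.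
Proof.
rewrite /cov_end !mulmxDl -!scalemxAl !christoffel_lin_r !mulmxDl -!scalemxAl.
exact: lin_comb3.
Qed.

Lemma cov_endDr u v v' : cov_end T u (v + v') = cov_end T u v + cov_end T u v'.
Proof. by have := cov_end_linr 1 u v v'; rewrite !scale1r. Qed.
Lemma cov_endDl u u' v : cov_end T (u + u') v = cov_end T u v + cov_end T u' v.
Proof. by have := cov_end_linl 1 u u' v; rewrite !scale1r. Qed.
Lemma cov_end0l v : cov_end T 0 v = 0.
Proof. by have := cov_end_linl (-1) 0 0 v; rewrite scaler0 addr0 scaleN1r addNr. Qed.
Lemma cov_end0r u : cov_end T u 0 = 0.
Proof. by have := cov_end_linr (-1) u 0 0; rewrite scaler0 addr0 scaleN1r addNr. Qed.
Lemma cov_endZl a u v : cov_end T (a *: u) v = a *: cov_end T u v.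
Proof. by have := cov_end_linl a u 0 v; rewrite addr0 cov_end0l addr0. Qed.
Lemma cov_endZr a u v : cov_end T u (a *: v) = a *: cov_end T u v.
Proof. by have := cov_end_linr a u v 0; rewrite addr0 cov_end0r addr0. Qed.
Lemma cov_endNl u v : cov_end T (- u) v = - cov_end T u v.
Proof. by rewrite -scaleN1r cov_endZl scaleN1r. Qed.
Lemma cov_end_alternating : (forall v, cov_end T v v = 0) ->
  forall u v, cov_end T u v = - cov_end T v u.
Proof.
move=> N u v; apply/eqP; rewrite -addr_eq0; apply/eqP.
by have := N (u + v); rewrite cov_endDl !cov_endDr !N add0r addr0.
Qed.

Lemma differentiable_mulT (v : 'rV[R]_d) : differentiable (fun z => v *m T z) x.
Proof.
apply: (@differentiable_mulmx _ _ _ _ _ (fun=> v)); last exact: endo_differentiable.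
exact: differentiable_cst.
Qed.

Lemma cov_cst (u v : 'rV[R]_d) : cov u (fun=> v) = Gam u v.
Proof. by rewrite /cov derive_cst add0r. Qed.

Lemma cov_mulT (u v : 'rV[R]_d) : cov u (fun z => v *m T z) = cov_end T u v + Gam u v *m T
  x.
Proof.
rewrite /cov /cov_end subrK; congr (_ + _).
have [_ ->] := @is_derive_mulmx R _ 1 d d (fun=> v) T x u _ _ (is_derive_cst v x u)
  (is_derive_diff u endo_differentiable).
by rewrite mul0mx add0r.
Qed.

(** Differentiate the skewness identity along w with u and v constant; the Christoffel terms pair
    off by skewness at x. *)
Lemma cov_end_skew : (forall z, U z -> forall u v,
    ip (g z) (u *m T z) v = - ip (g z) u (v *m T z)) ->
  forall w u v, ip (g x) (cov_end T w u) v = - ip (g x) u (cov_end T w v).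
Proof.
move=> skew w u v.
have [_ d1] := is_derive_ip w (differentiable_mulT u) (differentiable_cst v x).
have [_ d2] := is_derive_ip w (differentiable_cst u x) (differentiable_mulT v).
have E : 'D_w (fun z => ip (g z) (u *m T z) v) x = 'D_w (fun z => - ip (g z) u (v *m T z))
  x.
  by apply: (derive_on w (mc_open gU) Ux) => z Uz; exact: skew.
have [D2 _] := is_derive_ip w (differentiable_cst u x) (differentiable_mulT v).
move: E; rewrite d1 (deriveN (f := fun z => ip (g z) u (v *m T z))) // d2.
rewrite !cov_cst !cov_mulT ipDl ipDr (skew x Ux (Gam w u) v) (skew x Ux u (Gam w v)).
have cancel (a b c e : R) : a - b - c = - (b + (e + c)) -> a = - e by lra.
exact: cancel.
Qed.

Lemma nabla_fund_cst u v w :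
  nabla_fund g T (cfield u) (cfield v) (cfield w) x = ip (g x) v (cov_end T u w).
Proof.
have [_ d2] := is_derive_ip u (differentiable_cst v x) (differentiable_mulT w).
have nabc s t : nabla g (cfield s) (cfield t) x = Gam s t.
  by rewrite /nabla /Lder /cfield derive_cst add0r.
rewrite /nabla_fund /fund /ipf /app_end !nabc /Lder /cfield [X in X - _ - _]d2.
rewrite cov_cst cov_mulT ipDr.
have cancel (a b c : R) : a + (b + c) - a - c = b by ring.
exact: cancel.
Qed.

Lemma dfund_cst u v w :
  dfund g T (cfield u) (cfield v) (cfield w) x =
  ip (g x) v (cov_end T u w) + ip (g x) w (cov_end T v u) + ip (g x) u (cov_end T w v).
Proof. by rewrite /dfund !nabla_fund_cst. Qed.

(* P(uT, u) when u T^2 = - u. *)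
Definition twist (u : 'rV[R]_d) := cov_end T (u *m T x) u - cov_end T u (u *m T x).

(* [cov_end T w (u T)] is orthogonal to [u], so the remaining terms of the cyclic
   sum are those of the twist. *)
Lemma twist_dfund : (forall z, U z -> forall u v,
    ip (g z) (u *m T z) v = - ip (g z) u (v *m T z)) ->
  forall u, (forall w, ip (g x) (cov_end T w (u *m T x) + cov_end T w u *m T x) u = 0) ->
  forall w, ip (g x) (twist u) w
    = - dfund g T (cfield (u *m T x)) (cfield u) (cfield w) x.
Proof.
move=> skew u u0 w; have askew := cov_end_skew skew.
have q : ip (g x) (cov_end T w u *m T x) u = ip (g x) (cov_end T w (u *m T x)) u.
  by rewrite (skew x Ux (cov_end T w u) u) (metric_ipC gU Ux (cov_end T w u)) askew.
have p0 : ip (g x) (u *m T x) (cov_end T w u) = 0.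
  have := u0 w; rewrite ipDl q (askew w (u *m T x) u); lra.
rewrite dfund_cst p0 addr0 /twist ipBl (askew (u *m T x) u w).
by rewrite (metric_ipC gU Ux w) opprD.
Qed.

End Endo.
End CovariantDerivative.

(** * Almost contact metric charts *)

Lemma lin_comb2 {K : pzRingType} {V : lmodType K} a (p q p' q' : V) :
  a *: p + q + (a *: p' + q') = a *: (p + p') + (q + q').
Proof. by rewrite scalerDr addrACA. Qed.

Section ContactChart.
Context {R : realType} {d : nat}.
Implicit Types u v w : 'rV[R]_d.

Record acm_chart (S : acm_coords R d) (U : set 'rV[R]_d) : Prop := AcmChart {
  ac_metric : metric_chart (cg S) U;
  ac_phi : smooth_on U (cphi S);
  ac_xi : smooth_on U (cxi S);
  ac_eta : smooth_on U (ceta S);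
  ac_phi2 : forall x, U x -> forall u,
    u *m cphi S x *m cphi S x = - u + (u *m ceta S x) 0 0 *: cxi S x;
  ac_eta_xi : forall x, U x -> (cxi S x *m ceta S x) 0 0 = 1;
  ac_compat : forall x, U x -> forall u v,
    ip (cg S x) (u *m cphi S x) (v *m cphi S x)
    = ip (cg S x) u v - (u *m ceta S x) 0 0 * (v *m ceta S x) 0 0
}.

Context (S : acm_coords R d) (U : set 'rV[R]_d) (SU : acm_chart S U).

Local Notation eta x u := ((u *m ceta S x) 0 0).

Lemma etaDl x u v : eta x (u + v) = eta x u + eta x v.
Proof. by rewrite mulmxDl mxE. Qed.
Lemma etaZ x a u : eta x (a *: u) = a * eta x u.
Proof. by rewrite -scalemxAl mxE. Qed.
Lemma etaN x u : eta x (- u) = - eta x u.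
Proof. by rewrite mulNmx mxE. Qed.

Section Pointwise.
Context (x : 'rV[R]_d) (Ux : U x).
Local Notation G := (cg S x).
Local Notation Phi := (cphi S x).
Local Notation xi := (cxi S x).

Lemma acm_xi_neq0 : xi != 0.
Proof.
apply/eqP => E; have := ac_eta_xi SU Ux; rewrite E mul0mx mxE => /esym/eqP.
by rewrite oner_eq0.
Qed.

(** Computing the cube of Phi in two ways gives eta(u Phi) xi = eta(u) xi Phi. Moreover xi Phi^2 = 0
    makes xi Phi = c xi, and then c^2 xi = 0 forces c = 0. *)
Lemma eta_phi u : eta x (u *m Phi) = 0.
Proof.
have := ac_phi2 SU Ux (u *m Phi); rewrite (ac_phi2 SU Ux u) mulmxDl mulNmx -scalemxAl.
move/addrI => E; have /eqP := esym E.
have E2 := ac_phi2 SU Ux xi; rewrite (ac_eta_xi SU Ux) scale1r addNr in E2.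
pose c := eta x (xi *m Phi).
have xc : xi *m Phi = c *: xi.
  have := ac_phi2 SU Ux (xi *m Phi); rewrite E2 mul0mx => /esym/eqP.
  by rewrite addrC subr_eq0 => /eqP.
have c0 : c = 0.
  have := congr1 (fun w => w *m Phi) xc; rewrite E2 -scalemxAl xc scalerA => /esym/eqP.
  by rewrite scaler_eq0 (negbTE acm_xi_neq0) orbF mulf_eq0 orbb => /eqP.
rewrite xc c0 scale0r scaler0 scaler_eq0 (negbTE acm_xi_neq0) orbF => /eqP; exact.
Qed.

Lemma xi_phi : xi *m Phi = 0.
Proof.
have E2 := ac_phi2 SU Ux xi; rewrite (ac_eta_xi SU Ux) scale1r addNr in E2.
have := ac_phi2 SU Ux (xi *m Phi); rewrite E2 mul0mx eta_phi scale0r addr0 => /esym/eqP.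
by rewrite oppr_eq0 => /eqP.
Qed.

Lemma acm_ipC u v : ip G u v = ip G v u.
Proof. exact: (metric_ipC (ac_metric SU) Ux). Qed.

Lemma ip_xi u : ip G u xi = eta x u.
Proof.
have := ac_compat SU Ux u xi; rewrite xi_phi ip0r (ac_eta_xi SU Ux) mulr1.
by move/esym/eqP; rewrite subr_eq0 => /eqP.
Qed.

Lemma ip_xi_xi : ip G xi xi = 1.
Proof. by rewrite ip_xi (ac_eta_xi SU Ux). Qed.

(** Compatibility for u Phi and v: u Phi^2 differs from -u by a multiple of xi, which is orthogonal
    to the image of Phi. *)
Lemma phi_skew u v : ip G (u *m Phi) v = - ip G u (v *m Phi).
Proof.
have := ac_compat SU Ux (u *m Phi) v; rewrite (ac_phi2 SU Ux) eta_phi mul0r subr0 => <-.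
by rewrite ipDl ipNl ipZl (acm_ipC xi) ip_xi eta_phi mulr0 addr0.
Qed.

Lemma phi2_D u : eta x u = 0 -> u *m Phi *m Phi = - u.
Proof. by move=> u0; rewrite (ac_phi2 SU Ux) u0 scale0r addr0. Qed.

Lemma acm_ip_eq u v : (forall w, ip G u w = ip G v w) -> u = v.
Proof.
move=> uv; apply/eqP; rewrite -subr_eq0; apply/eqP.
by apply: (posdef_eq0 (mc_pos (ac_metric SU) Ux)); rewrite ipBl uv subrr.
Qed.

Lemma xi_differentiable : differentiable (cxi S) x.
Proof. exact: smooth_differentiable (mc_open (ac_metric SU)) (ac_xi SU) Ux. Qed.
Lemma eta_differentiable : differentiable (ceta S) x.
Proof. exact: smooth_differentiable (mc_open (ac_metric SU)) (ac_eta SU) Ux. Qed.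
Lemma phi_differentiable : differentiable (cphi S) x.
Proof. exact: smooth_differentiable (mc_open (ac_metric SU)) (ac_phi SU) Ux. Qed.

End Pointwise.

Section PointwiseDerivatives.
Context (x : 'rV[R]_d) (Ux : U x).
Local Notation G := (cg S x).
Local Notation Phi := (cphi S x).
Local Notation xi := (cxi S x).
Local Notation C u := (cov (cg S) x u (cxi S)).
Local Notation A := (cov_end (cg S) x (cphi S)).
Local Notation Gam := (christoffel_form (cg S) x).

Lemma cov_xi_linear a u v : C (a *: u + v) = a *: C u + C v.
Proof.
rewrite /cov linear_derive ?christoffel_lin_l; last exact: xi_differentiable.
exact: lin_comb2.
Qed.

Lemma eta_cov_xi u : eta x (C u) = 0.
Proof.
have xid := xi_differentiable Ux.
have [_ D1] := is_derive_ip (ac_metric SU) Ux u xid xid.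
have D2 : 'D_u (fun z => ip (cg S z) (cxi S z) (cxi S z)) x = 0.
  rewrite -[RHS](derive_cst (1 : R) x u);
    apply: (derive_on u (mc_open (ac_metric SU)) Ux) => z Uz.
  exact: ip_xi_xi.
move: D1; rewrite D2 (acm_ipC Ux xi) (ip_xi Ux); lra.
Qed.

Lemma cov_end_xi u : A u xi = - (C u *m Phi).
Proof.
have [_ D1] := is_derive_mulmx (is_derive_diff u (xi_differentiable Ux))
  (is_derive_diff u (phi_differentiable Ux)).
have D2 : 'D_u (fun z => cxi S z *m cphi S z) x = 0.
  rewrite -[RHS](derive_cst (0 : 'rV[R]_d) x u);
    apply: (derive_on u (mc_open (ac_metric SU)) Ux) => z Uz.
  exact: xi_phi.
move: D1; rewrite D2 /cov_end (xi_phi Ux) christoffel0r addr0 /cov mulmxDl opprD => /eqP.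
by rewrite eq_sym addrC addr_eq0 => /eqP ->.
Qed.

(** As eta is dual to xi, this is (nabla_u eta)(v) = g(v, nabla_u xi), with the connection spelled
    out on the constant field v. *)
Lemma derive_eta u v : (v *m 'D_u (ceta S) x) 0 0 = eta x (Gam u v) + ip G v (C u).
Proof.
have [_ D1] := is_derive_ip (ac_metric SU) Ux u (differentiable_cst v x)
  (xi_differentiable Ux).
have D2 := @is_derive_mulmx R _ 1 d 1 (fun=> v) (ceta S) x u _ _ (is_derive_cst v x u)
  (is_derive_diff u (eta_differentiable Ux)).
have [_ D3] := is_derive_entry 0 0 D2.
rewrite mul0mx add0r in D3; rewrite -[LHS]D3.
transitivity ('D_u (fun z => ip (cg S z) v (cxi S z)) x).
  by apply: (derive_on u (mc_open (ac_metric SU)) Ux) => z Uz; rewrite (ip_xi Uz).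
by rewrite D1 cov_cst (ip_xi Ux).
Qed.

(** The covariant derivative of phi^2 = -1 + eta tensor xi along u, with (nabla_u eta)(v) replaced
    by g(v, nabla_u xi). *)
Lemma cov_end_phi u v :
  A u (v *m Phi) + A u v *m Phi = ip G v (C u) *: xi + eta x v *: C u.
Proof.
have phid := is_derive_diff u (phi_differentiable Ux).
have [_ D1] := is_derive_mulmx phid phid.
have [_ D2] := is_deriveD (is_derive_cst (- 1%:M : 'M[R]_d) x u)
   (is_derive_mulmx (is_derive_diff u (eta_differentiable Ux))
     (is_derive_diff u (xi_differentiable Ux))).
have D3 : 'D_u (fun z => cphi S z *m cphi S z) x
    = 'D_u ((fun=> - 1%:M) + (fun z => ceta S z *m cxi S z)) x.
  apply: (derive_on u (mc_open (ac_metric SU)) Ux) => z Uz; apply/row_matrixP => i;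
    rewrite !rowE.
  rewrite mulmxA (ac_phi2 SU Uz) mulmxDr mulmxN mulmx1 mulmxA.
  by rewrite [delta_mx 0 i *m ceta S z]mx11_scalar mul_scalar_mx mxE eqxx.
have := etrans (esym D1) (etrans D3 D2); rewrite add0r => /(congr1 (fun M => v *m M)).
rewrite !mulmxDr !mulmxA [v *m 'D_u (ceta S) x]mx11_scalar [v *m ceta S x]mx11_scalar.
rewrite !mul_scalar_mx derive_eta.
rewrite /cov_end (ac_phi2 SU Ux v) christoffelDr christoffelNr christoffelZr.
rewrite mulmxBl mulmxDl (ac_phi2 SU Ux) [in X in _ -> _ = _ + X]/cov.
have rearrange (p q gam g2 gx dx X : 'rV[R]_d) (k h c : R) :
    p + q = (k + c) *: X + h *: dx ->
    q + (- gam + h *: gx) - g2 + (p + g2 - (- gam + k *: X)) = c *: X + h *: (dx + gx).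
  move=> E; apply/rowP => j; move/rowP: E => /(_ j); rewrite !mxE; lra.
rewrite [_%:M 0 0]mxE eqxx mulr1n; exact: rearrange.
Qed.

(** The derivatives of X and Y go into the bracket and the Christoffel terms cancel by symmetry,
    which leaves half of the antisymmetrised nabla eta. Hence d eta depends on values at x only. *)
Lemma deta_cov (X Y : vfield R d) : differentiable X x -> differentiable Y x ->
  deta S X Y x = 2^-1 * (ip G (Y x) (C (X x)) - ip G (X x) (C (Y x))).
Proof.
move=> Xd Yd.
have key (Z : vfield R d) u : differentiable Z x -> 'D_u (etaf S Z) x
    = eta x ('D_u Z x) + (eta x (Gam u (Z x)) + ip G (Z x) (C u)).
  move=> Zd; rewrite -derive_eta.
  have [_ ->] := is_derive_entry 0 0 (is_derive_mulmx (is_derive_diff u Zd)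
    (is_derive_diff u (eta_differentiable Ux))).
  by rewrite mxE.
rewrite /deta /Lder !key // /etaf /bracket /Lder etaDl etaN.
rewrite (christoffel_sym (ac_metric SU) Ux (Y x)).
have cancel (a b c e h : R) : a + (b + c) - (e + (b + h)) - (a - e) = c - h by ring.
by rewrite cancel.
Qed.

Lemma deta_cst u v :
  deta S (cfield u) (cfield v) x = 2^-1 * (ip G v (C u) - ip G u (C v)).
Proof. by rewrite deta_cov //; exact: differentiable_cst. Qed.

Lemma deta_xi v : deta S (cfield xi) (cfield v) x = 2^-1 * ip G v (C xi).
Proof. by rewrite deta_cst (acm_ipC Ux xi) (ip_xi Ux) eta_cov_xi subr0. Qed.

Lemma reeb_geodesic_of_deta :
  (forall v, deta S (cfield xi) (cfield v) x = 0) -> C xi = 0.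
Proof.
move=> H; apply: (acm_ip_eq Ux) => w; rewrite ip0l (acm_ipC Ux).
have /eqP := H w; rewrite deta_xi mulf_eq0 invr_eq0 pnatr_eq0 /=; exact/eqP.
Qed.

(** (nabla_xi phi) xi = -phi(nabla_xi xi), and nabla_xi xi lies in D, where phi is injective. *)
Lemma reeb_geodesic_of_cov_end : A xi xi = 0 -> C xi = 0.
Proof.
rewrite cov_end_xi => /eqP; rewrite oppr_eq0 => /eqP /(congr1 (fun w => w *m Phi)).
by rewrite mul0mx (ac_phi2 SU Ux) eta_cov_xi scale0r addr0 => /eqP;
  rewrite oppr_eq0 => /eqP.
Qed.

Local Notation twist := (twist (cg S) x (cphi S)).

(** [cov_end_phi] turns the vector in the hypothesis of [twist_dfund] into a multiple of xi, which
    is orthogonal to u in D. *)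
Lemma twist_ip u w : eta x u = 0 ->
  ip G (twist u) w = - dOmega S (cfield (u *m Phi)) (cfield u) (cfield w) x.
Proof.
move=> u0; apply: (twist_dfund (ac_metric SU) Ux (ac_phi SU)).
  by move=> z Uz a b; exact: phi_skew.
move=> t; rewrite cov_end_phi u0 scale0r addr0 ipZl (acm_ipC Ux xi) (ip_xi Ux) u0.
by rewrite mulr0.
Qed.

Lemma twist_dOmega_zero u : eta x u = 0 ->
  (forall a b c, dOmega S (cfield a) (cfield b) (cfield c) x = 0) -> twist u = 0.
Proof.
by move=> u0 H; apply: (acm_ip_eq Ux) => w; rewrite twist_ip // H oppr0 ip0l.
Qed.

(** In the cyclic sum only eta(w) Omega(phi u, u) survives, and Omega(phi u, u) = |phi u|^2 =
    |u|^2. *)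
Lemma twist_kenmotsu u beta : eta x u = 0 ->
  (forall a b c, dOmega S (cfield a) (cfield b) (cfield c) x
     = 2 * beta * eta_Omega S (cfield a) (cfield b) (cfield c) x) ->
  twist u = (- 2 * beta * ip G u u) *: xi.
Proof.
move=> u0 H; apply: (acm_ip_eq Ux) => w; rewrite twist_ip // H ipZl.
rewrite (acm_ipC Ux xi) (ip_xi Ux) /eta_Omega /etaf /cfield (eta_phi Ux) u0.
rewrite /Omega /fund /ipf /app_end (ac_compat SU Ux) u0; ring.
Qed.

(** As A is alternating, the twist of u is -2 A u (u Phi), and [cov_end_phi] gives A u (u Phi) = s
    xi. Skewness of A xi yields g(u, A xi (u Phi)) = -s, while [cov_end_phi] along xi yields the
    value s; hence s = 0. *)
Lemma twist_nearly u : eta x u = 0 -> (forall v, A v v = 0) -> twist u = 0.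
Proof.
move=> u0 N; have Aalt := cov_end_alternating (ac_metric SU) Ux (ac_phi SU) N.
have skew := cov_end_skew (ac_metric SU) Ux (ac_phi SU) (fun z Uz => phi_skew Uz).
pose s := ip G (u *m Phi) (A xi u).
have AuF : A u (u *m Phi) = ip G u (C u) *: xi.
  by have := cov_end_phi u u; rewrite N mul0mx addr0 u0 scale0r addr0.
have c1 : ip G u (C u) = s.
  have := congr1 (fun w => ip G w xi) AuF; rewrite ipZl ip_xi_xi // mulr1 => <-.
  by rewrite skew Aalt ipNr opprK.
have s1 : ip G u (A xi (u *m Phi)) = - s.
  by rewrite -[LHS]opprK -skew (acm_ipC Ux).
have s2 : ip G u (A xi (u *m Phi)) = s.
  have := cov_end_phi xi u; rewrite u0 scale0r addr0 => /eqP.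
  rewrite -(inj_eq (addIr (- (A xi u *m Phi)))) addrK => /eqP ->.
  by rewrite ipBr ipZr (ip_xi Ux) u0 mulr0 sub0r (acm_ipC Ux u) (phi_skew Ux) opprK
    (acm_ipC Ux).
have s0 : s = 0 by move: s1; rewrite s2; lra.
by rewrite /twist (Aalt (u *m Phi)) AuF c1 s0 scale0r oppr0 addr0.
Qed.

End PointwiseDerivatives.
End ContactChart.

(** * Second derivatives in arbitrary directions *)

Section Schwarz.
Context {R : realType} {d : nat}.
Implicit Types (u v w : 'rV[R]_d) (U : set 'rV[R]_d).

Lemma Ck_mulmx k U p q r (F : 'rV[R]_d -> 'M[R]_(p, q)) (G : 'rV[R]_d -> 'M[R]_(q, r)) :
  open U -> Ck k U F -> Ck k U G -> Ck k U (fun z => F z *m G z).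
Proof.
move=> Uo Fk Gk; apply: Ck_mx => // i j.
apply: (@Ck_eq _ _ _ _ _ (fun z => \sum_l F z i l * G z l j)) => //.
  by move=> z _; rewrite mxE.
by apply: Ck_sum => // l; apply: CkM => //; exact: Ck_entry.
Qed.

Lemma schwarz_bvec U (f : 'rV[R]_d -> R) (x : 'rV[R]_d) a b :
  open U -> U x -> Ck 2 U f ->
  'D_(bvec a) (fun z => 'D_(bvec b) f z) x = 'D_(bvec b) (fun z => 'D_(bvec a) f z) x.
Proof.
move=> Uo Ux [_ f2]; apply: schwarz_scalar.
- apply: (@filterS _ _ (nbhs_filter x) U); last exact: open_nbhs_nbhs.
  move=> y Uy; have [da [_ da2]] := f2 a; have [db [_ db2]] := f2 b; split.
  + exact: da.
  + exact: db.
  + by have [+ _] := db2 a; apply.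
  + by have [+ _] := da2 b; apply.
- by have [_ [_ db2]] := f2 b; have [_ [+ _]] := db2 a; apply.
- by have [_ [_ da2]] := f2 a; have [_ [+ _]] := da2 b; apply.
Qed.

Lemma derive2_sum U (f : 'rV[R]_d -> R) (x u v : 'rV[R]_d) : open U -> U x -> Ck 2 U f ->
  'D_u (fun z => 'D_v f z) x
  = \sum_b \sum_a v 0 b * (u 0 a * 'D_(bvec a) (fun z => 'D_(bvec b) f z) x).
Proof.
move=> Uo Ux fk; have [_ f2] := fk.
have -> : 'D_u (fun z => 'D_v f z) x = 'D_u (fun z => \sum_b v 0 b *: 'D_(bvec b) f z) x.
  apply: (derive_on _ Uo Ux) => z Uz; apply: derive_rV_sum.
  by apply: (Ck1_differentiable_scalar Uo) => //; exact: Ck_pred.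
have fb b : differentiable (fun z => 'D_(bvec b) f z) x.
  by apply: (Ck1_differentiable_scalar Uo) => //; have [] := f2 b.
have [_ ->] := @is_derive_big R _ _ _ (index_enum 'I_d) (fun b z => v 0 b *: 'D_(bvec b) f
  z)
  (fun b => v 0 b *: 'D_u (fun z => 'D_(bvec b) f z) x) x u
  (fun b => is_deriveZ (v 0 b) (is_derive_diff u (fb b))).
apply: eq_bigr => b _; rewrite (derive_rV_sum u (fb b)) scaler_sumr.
by apply: eq_bigr.
Qed.

Lemma schwarz U (f : 'rV[R]_d -> R) (x u v : 'rV[R]_d) : open U -> U x -> Ck 2 U f ->
  'D_u (fun z => 'D_v f z) x = 'D_v (fun z => 'D_u f z) x.
Proof.
move=> Uo Ux fk; rewrite !(derive2_sum _ _ Uo Ux fk) exchange_big /=.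
apply: eq_bigr => a _; apply: eq_bigr => b _; rewrite (schwarz_bvec a b Uo Ux fk).
by rewrite mulrCA.
Qed.

Lemma Ck_derive k U (f : 'rV[R]_d -> R) u : open U -> Ck k.+1 U f ->
  Ck k U (fun z => 'D_u f z).
Proof.
move=> Uo fk; have f1 := Ck_Ck1 fk.
apply: (@Ck_eq _ _ _ _ _ (fun z => \sum_a u 0 a * 'D_(bvec a) f z)) => //.
  move=> z Uz; rewrite [RHS]derive_rV_sum //.
  exact: Ck1_differentiable_scalar Uz.
apply: Ck_sum => // a; apply: CkM => //; first exact: Ck_cst.
by have [_ /(_ a) []] := fk.
Qed.

End Schwarz.

Section AlphaContact.
Context {R : realType} {d : nat} (S : acm_coords R d) (U : set 'rV[R]_d) (SU : acm_chart S
  U).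
Implicit Types (u v w : 'rV[R]_d).

(* [alpha dOmega] is a multiple of [d(d eta)], which vanishes by Schwarz's theorem;
   the Christoffel terms of the cyclic sum cancel. *)
Lemma dOmega_zero_of_deta alpha : alpha != 0 ->
  (forall u v x, U x -> deta S (cfield u) (cfield v) x
     = alpha * Omega S (cfield u) (cfield v) x) ->
  forall x, U x -> forall u v w, dOmega S (cfield u) (cfield v) (cfield w) x = 0.
Proof.
move=> a0 H x Ux u v w.
have Uo := mc_open (ac_metric SU).
pose f (t z : 'rV[R]_d) : R := (t *m ceta S z) 0 0.
have fk t : Ck 2 U (f t).
  have Ft : Ck 2 U (fun z => t *m ceta S z).
    by have := @Ck_mulmx R d 2 U 1 d 1 (fun=> t) (ceta S) Uo (Ck_cst _ _ _) (ac_eta SU 2%N).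
  exact: (Ck_entry 0 0 Uo Ft).
(* Constant fields commute, so here d eta is half a difference of first derivatives of components of
   eta. *)
have OE s t z : U z -> Omega S (cfield s) (cfield t) z
    = (2 * alpha)^-1 * ('D_s (f t) z - 'D_t (f s) z).
  move=> Uz; apply: (mulfI a0); rewrite -H // /deta /Lder /bracket /Lder /etaf /cfield.
  rewrite !derive_cst subrr mul0mx [X in _ - X]mxE subr0 invfM mulrA.
  by rewrite [alpha * _]mulrCA divff // mulr1.
have fd s t : differentiable (fun z => 'D_s (f t) z) x.
  by apply: (Ck1_differentiable_scalar Uo) => //; apply: Ck_derive.
have DO r s t : 'D_r (fun z => Omega S (cfield s) (cfield t) z) x
    = (2 * alpha)^-1 * ('D_r (fun z => 'D_s (f t) z) x - 'D_r (fun z => 'D_t (f s) z) x).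
  rewrite (derive_on (F2 := fun z => (2 * alpha)^-1 *: ('D_s (f t) z - 'D_t (f s) z)) _ Uo
    Ux).
    have [_ ->] := is_deriveZ (2 * alpha)^-1
     (is_deriveB (is_derive_diff r (fd s t)) (is_derive_diff r (fd t s))) => //.
  by move=> z /OE.
have skewO s t : ip (cg S x) s (t *m cphi S x) = - ip (cg S x) t (s *m cphi S x).
  by rewrite (acm_ipC SU Ux) (phi_skew SU Ux).
rewrite /dOmega /dfund /nabla_fund.
have nabc s t : nabla (cg S) (cfield s) (cfield t) x = christoffel_form (cg S) x s t.
  by rewrite /nabla /Lder /cfield derive_cst add0r.
rewrite /Lder (DO u v w) (DO v w u) (DO w u v).
rewrite (schwarz u v Uo Ux (fk w)) (schwarz u w Uo Ux (fk v)) (schwarz v w Uo Ux (fk u)).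
rewrite /fund /ipf /app_end !nabc /cfield.
have csym := christoffel_sym (ac_metric SU) Ux.
rewrite (csym v u) (csym w u) (csym w v).
pose Gam := christoffel_form (cg S) x.
rewrite (skewO v (Gam u w)) (skewO w (Gam u v)) (skewO u (Gam v w)).
have cancel (a p q r e1 e2 e3 : R) :
  a * (p - q) - e1 - - e2 + (a * (r - p) - e3 - - e1) + (a * (q - r) - e2 - - e3) = 0 by
    ring.
exact: cancel.
Qed.

End AlphaContact.

(** * The second fundamental form of a map *)

Section MapChart.
Context {R : realType} {d e : nat}.
Implicit Types (u v w : 'rV[R]_d).

Definition jac (y : 'rV[R]_d -> 'rV[R]_e) (z : 'rV[R]_d) : 'M[R]_(d, e) :=
  \matrix_(a, b) ('D_(bvec a) y z) 0 b.

Context (y : 'rV[R]_d -> 'rV[R]_e) (U : set 'rV[R]_d) (Uo : open U) (ys : smooth_on U y).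
Local Notation J := (jac y).

Lemma map_differentiable (z : 'rV[R]_d) : U z -> differentiable y z.
Proof. exact: smooth_differentiable. Qed.

Lemma derive_jac (z : 'rV[R]_d) u : U z -> 'D_u y z = u *m J z.
Proof.
move=> Uz; rewrite (derive_rV_sum u (map_differentiable Uz)).
apply/rowP => b; rewrite !mxE summxE; apply: eq_bigr => a _.
by rewrite /jac !mxE.
Qed.

Lemma jac_smooth : smooth_on U J.
Proof.
move=> k; apply: (Ck_mx Uo) => a b.
have [_ /(_ a) [_ Dk]] := ys k.+1.
apply: (Ck_eq Uo) (Ck_entry 0 b Uo Dk) => z _.
by rewrite /jac mxE.
Qed.

Lemma jac_differentiable (z : 'rV[R]_d) : U z -> differentiable J z.
Proof. exact: smooth_differentiable Uo jac_smooth. Qed.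

Lemma derive_jac_sym (x : 'rV[R]_d) u v : U x -> v *m 'D_u J x = u *m 'D_v J x.
Proof.
move=> Ux; have yk b : Ck 2 U (fun z => y z 0 b) by apply: (Ck_entry 0 b Uo (ys 2%N)).
have key s t b : (t *m 'D_s J x) 0 b = 'D_s (fun z => 'D_t (fun z => y z 0 b) z) x.
  have [_ D1] := is_derive_entry 0 b (@is_derive_mulmx R _ 1 d e (fun=> t) J x s _ _
    (is_derive_cst t x s) (is_derive_diff s (jac_differentiable Ux))).
  rewrite mul0mx add0r in D1; rewrite -[LHS]D1.
  apply: (derive_on _ Uo Ux) => z Uz.
  rewrite -derive_jac // derive_entry //.
  exact: diff_derivable (map_differentiable Uz).
apply/rowP => b.
exact: etrans (key u v b) (etrans (schwarz u v Uo Ux (yk b)) (esym (key v u b))).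
Qed.

Context (g : mfield R d) (gU : metric_chart g U).
Context (h : mfield R e) (U' : set 'rV[R]_e) (hU : metric_chart h U').
Context (yU : forall z, U z -> U' (y z)).
Context (x : 'rV[R]_d) (Ux : U x).
Let Uy : U' (y x) := yU Ux.

(* [sff g h y] on the tangent vectors u and v, see [sff_hess]. *)
Definition hess u v : 'rV[R]_e :=
  v *m 'D_u J x + christoffel_form h (y x) (u *m J x) (v *m J x)
  - christoffel_form g x u v *m J x.

(** Schwarz for the second derivatives of y, absence of torsion for the two connections. *)
Lemma hess_sym u v : hess u v = hess v u.
Proof.
rewrite /hess derive_jac_sym // (christoffel_sym gU Ux).
by rewrite (christoffel_sym hU Uy).
Qed.

Lemma hess_linr a u v v' : hess u (a *: v + v') = a *: hess u v + hess u v'.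
Proof.
rewrite /hess !mulmxDl -!scalemxAl !christoffel_lin_r mulmxDl -scalemxAl.
exact: lin_comb3.
Qed.

Lemma hess_linl a u v v' : hess (a *: v + v') u = a *: hess v u + hess v' u.
Proof. by rewrite hess_sym hess_linr (hess_sym u) (hess_sym u). Qed.

Lemma hess0r u : hess u 0 = 0.
Proof. by have := hess_linr (-1) u 0 0; rewrite scaler0 addr0 scaleN1r addNr. Qed.
Lemma hessNr u v : hess u (- v) = - hess u v.
Proof. by have := hess_linr (-1) u v 0; rewrite hess0r !addr0 !scaleN1r. Qed.

Lemma sff_hess (X Y : vfield R d) : differentiable Y x ->
  sff g h y X Y x = hess (X x) (Y x).
Proof.
move=> Yd; rewrite /sff /nabla_along /pushf /Lder /nabla /Lder !derive_jac //.
have -> : 'D_(X x) (fun z => 'D_(Y z) y z) x = 'D_(X x) (fun z => Y z *m J z) x.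
  by apply: (derive_on _ Uo Ux) => z Uz; rewrite derive_jac.
have [_ ->] := is_derive_mulmx (is_derive_diff (X x) Yd)
  (is_derive_diff (X x) (jac_differentiable Ux)).
rewrite /hess mulmxDl.
have cancel (a b c f : 'rV[R]_e) : a + b + c - (a + f) = b + c - f.
  by rewrite opprD addrA -(addrA a) (addrC a) addrK.
exact: cancel.
Qed.

Lemma tension_hess : tension g h y x
  = \sum_a \sum_b invmx (g x) a b *: hess (bvec a) (bvec b).
Proof.
apply: eq_bigr => a _; apply: eq_bigr => b _; congr (_ *: _).
by rewrite sff_hess //; exact: differentiable_cst.
Qed.

Lemma derive_comp_jac {W : normedModType R} (F : 'rV[R]_e -> W) u :
  differentiable F (y x) ->
  is_derive x u (fun z => F (y z)) ('D_(u *m J x) F (y x)).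
Proof.
move=> Fd; have Fyd : differentiable (F \o y) x.
  by apply: differentiable_comp => //; exact: map_differentiable.
have := is_derive_diff u Fyd => H; apply: (is_derive_eq H).
by rewrite (derive_comp (y := y)) ?derive_jac //; exact: map_differentiable.
Qed.

Section Holomorphic.
Context (Phi : mfield R d) (Phis : smooth_on U Phi) (Psi : mfield R e) (Psis : smooth_on
  U' Psi).
Context (s : R) (holo : forall z, U z -> Phi z *m J z = s *: (J z *m Psi (y z))).

(* The derivative of Phi J = s J Psi along u, applied to v. *)
Lemma hess_phi u v : hess u (v *m Phi x)
  = s *: (hess u v *m Psi (y x) + cov_end h (y x) Psi (u *m J x) (v *m J x))
    - cov_end g x Phi u v *m J x.
Proof.
have Phid := is_derive_diff u (endo_differentiable gU Ux Phis).
have Jd := is_derive_diff u (jac_differentiable Ux).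
have Psid := derive_comp_jac u (endo_differentiable hU Uy Psis).
have [_ D1] := is_derive_mulmx Phid Jd.
have [_ D2] := is_deriveZ s (is_derive_mulmx Jd Psid).
have E := etrans (esym D1) (etrans (derive_on u Uo Ux holo) D2).
have := congr1 (fun M => v *m M) E; rewrite mulmxDr -scalemxAr mulmxDr !mulmxA.
move=> {D1 D2}E.
have F w : w *m Phi x *m J x = s *: (w *m J x *m Psi (y x)).
  by rewrite -!mulmxA holo // -scalemxAr.
have rearrange (p q r t c c' k m : 'rV[R]_e) : p + q = s *: (r + t) ->
    q + s *: c - k = s *: (r + c' - m + (t + c - c')) - (p + k - s *: m).
  move=> H; apply/rowP => j; move/rowP: H => /(_ j); rewrite !mxE; lra.
rewrite /hess /cov_end F christoffelZr !mulmxBl !mulmxDl F.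
exact: rearrange.
Qed.

(* Difference of [hess_phi] at (u Phi, u) and at (u, u Phi). *)
Lemma hess_twist u : s * s = 1 -> u *m Phi x *m Phi x = - u ->
  hess u u + hess (u *m Phi x) (u *m Phi x)
  = twist h (y x) Psi (u *m J x) - twist g x Phi u *m J x.
Proof.
move=> s1 u2; have F : u *m Phi x *m J x = s *: (u *m J x *m Psi (y x)).
  by rewrite -!mulmxA holo // -scalemxAr.
have H1 := hess_phi (u *m Phi x) u.
have := hess_phi u (u *m Phi x); rewrite u2 hessNr => H2.
rewrite (hess_sym u (u *m Phi x)) in H2.
have -> : hess u u = - - hess u u by rewrite opprK.
have rearrange (b c c' m m' : 'rV[R]_e) :
    - (s *: (b + s *: c) - m) + (s *: (b + s *: c') - m') = c' - c - (m' - m).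
  rewrite !scalerDr !scalerA s1 !scale1r; apply/rowP => j; rewrite !mxE; lra.
rewrite H1 H2 F (cov_endZl hU Uy Psis) cov_endZr rearrange.
by rewrite -mulmxBl.
Qed.

End Holomorphic.

Section Reeb.
Context (xi : vfield R d) (xid : differentiable xi x).
Context (gam : vfield R e) (gamd : differentiable gam (y x)).
Context (lam : 'rV[R]_d -> R) (lamd : differentiable lam x).
Context (xiJ : forall z, U z -> xi z *m J z = lam z *: gam (y z)).

(** The derivative of xi J = lam gam along u. Keeping gam and lam general also covers almost
    Hermitian targets, where both are taken to be zero. *)
Lemma hess_xi u : hess u (xi x)
  = 'D_u lam x *: gam (y x) + lam x *: cov h (y x) (u *m J x) gam
    - cov g x u xi *m J x.
Proof.
have Jd := is_derive_diff u (jac_differentiable Ux).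
have [_ D1] := is_derive_mulmx (is_derive_diff u xid) Jd.
have [_ D2] := is_derive_scale (is_derive_diff u lamd) (derive_comp_jac u gamd).
have E := etrans (esym D1) (etrans (derive_on u Uo Ux xiJ) D2).
rewrite /hess /cov xiJ // christoffelZr mulmxDl.
have rearrange (p q r t a b : 'rV[R]_e) (l : R) : p + q = r + l *: t ->
    q + l *: a - b = r + l *: (t + a) - (p + b).
  move=> H; apply/rowP => j; move/rowP: H => /(_ j); rewrite !mxE; lra.
exact: rearrange.
Qed.

End Reeb.
End MapChart.

(** * Traces with respect to the metric and over the contact distribution *)

Section Trace.
Context {R : realType}.

Lemma linear_bvec_sum d (V : lmodType R) (f : 'rV[R]_d -> V) (v : 'rV[R]_d) :
  linear f -> f v = \sum_b v 0 b *: f (bvec b).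
Proof.
move=> fl; have f0 : f 0 = 0.
  by have := fl (-1) 0 0; rewrite scaler0 addr0 scaleN1r addNr.
rewrite {1}(row_sum_delta v).
have -> := big_morph f (id1 := 0) (op1 := +%R) _ f0.
  by apply: eq_bigr => b _; have := fl (v 0 b) (bvec b) 0; rewrite f0 !addr0.
by move=> u w; have := fl 1 u w; rewrite !scale1r.
Qed.

Lemma trace_bilinear d e k (B : 'rV[R]_d -> 'rV[R]_d -> 'rV[R]_e) (Q : 'M[R]_(k, d)) :
  (forall u, linear (B u)) -> (forall u, linear (B ^~ u)) ->
  \sum_l B (row l Q) (row l Q)
  = \sum_a \sum_b (Q^T *m Q) a b *: B (bvec a) (bvec b).
Proof.
move=> Br Bl.
under eq_bigr => l _.
  rewrite (linear_bvec_sum (row l Q) (Bl _)).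
  under eq_bigr => a _ do rewrite (linear_bvec_sum (row l Q) (Br _)) scaler_sumr.
  over.
rewrite exchange_big /=; apply: eq_bigr => a _.
rewrite exchange_big /=; apply: eq_bigr => b _.
rewrite mxE scaler_suml; apply: eq_bigr => l _.
by rewrite !mxE scalerA.
Qed.

(* Gram-Schmidt: each new vector is taken in the kernel of [G Q^T]. *)
Lemma orthonormal_family d (G : 'M[R]_d) k : posdef G -> G^T = G -> (k <= d)%N ->
  exists Q : 'M[R]_(k, d), Q *m G *m Q^T = 1%:M.
Proof.
move=> Gp Gs; elim: k => [|k IH] kd.
  by exists 0; apply/matrixP => [[]].
have [Q QG] := IH (ltnW kd).
have : kermx (G *m Q^T) != 0.
  rewrite -mxrank_eq0 mxrank_ker subn_eq0 -ltnNge.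
  by rewrite (leq_ltn_trans (rank_leq_col _)).
move=> /rowV0Pn[v /sub_kermxP vQ v0].
have vv := Gp _ v0; pose w := (Num.sqrt (ip G v v))^-1 *: v.
have wQ : w *m G *m Q^T = 0 by rewrite -mulmxA -scalemxAl vQ scaler0.
have ww : w *m G *m w^T = 1%:M.
  rewrite [LHS]mx11_scalar; congr (_%:M); rewrite -/(ip G w w) ipZl ipZr mulrA -invfM.
  by rewrite -expr2 sqr_sqrtr ?ltW // mulVf // gt_eqF.
have Qw : Q *m G *m w^T = 0.
  by apply: trmx_inj; rewrite trmx0 !trmx_mul trmxK Gs mulmxA.
rewrite -addn1; exists (col_mx Q w).
rewrite mul_col_mx tr_col_mx mul_col_row QG Qw wQ ww.
by rewrite -scalar_mx_block.
Qed.

(** The rows of P form an orthonormal basis for G; inverting P G P^T = 1 gives the form in which the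
    trace of [tension] uses it. *)
Lemma posdef_factor d (G : 'M[R]_d) : posdef G -> G^T = G ->
  exists2 P : 'M[R]_d, P \in unitmx & P^T *m P = invmx G.
Proof.
move=> Gp Gs; have [P PG] := orthonormal_family Gp Gs (leqnn d).
have [Pu _] := mulmx1_unit (etrans (mulmxA _ _ _) PG).
exists P => //; have Gu := posdef_unitmx Gp.
have E : G *m P^T = invmx P.
  by rewrite -[LHS]mul1mx -(mulVmx Pu) -mulmxA [P *m (G *m _)]mulmxA PG mulmx1.
by rewrite -[LHS]mul1mx -(mulVmx Gu) -mulmxA [G *m _]mulmxA E mulVmx // mulmx1.
Qed.

End Trace.

Section ContactInverse.
Context {R : realType} {d : nat} (S : acm_coords R d) (U : set 'rV[R]_d) (SU : acm_chart S
  U).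
Context (x : 'rV[R]_d) (Ux : U x).
Local Notation G := (cg S x).
Local Notation Phi := (cphi S x).
Local Notation xi := (cxi S x).

Lemma acm_unitmx : G \in unitmx.
Proof. by apply: posdef_unitmx; exact: (mc_pos (ac_metric SU)). Qed.

(** The right-hand side is the inverse metric of D, so Phi maps an orthonormal basis to a family
    computing traces over D. Skewness moves Phi through the inverse of G, and Phi^2 = -1 + eta xi
    with eta = G xi^T does the rest. *)
Lemma invmx_phi : Phi^T *m invmx G *m Phi = invmx G - xi^T *m xi.
Proof.
have Gu := acm_unitmx.
have skew : Phi *m G = - (G *m Phi^T).
  apply/matrixP => a b; rewrite [RHS]mxE -!ip_bvec -ip_mull -ip_mulr.
  exact: (phi_skew SU Ux).
have Gxi : G *m xi^T = ceta S x.
  apply/row_matrixP => a; rewrite !rowE [RHS]mx11_scalar -(ip_xi SU Ux) mulmxA.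
  by rewrite [LHS]mx11_scalar.
have E1 : Phi^T *m invmx G = - (invmx G *m Phi).
  by rewrite -[Phi in RHS](mulmxK Gu) skew mulNmx mulmxN opprK -mulmxA mulKmx.
have P2 : Phi *m Phi = - 1%:M + ceta S x *m xi.
  apply/row_matrixP => i; rewrite !rowE mulmxA (ac_phi2 SU Ux) mulmxDr mulmxN mulmx1.
  by rewrite mulmxA [delta_mx 0 i *m ceta S x]mx11_scalar mul_scalar_mx mxE eqxx mulr1n.
rewrite E1 mulNmx -mulmxA P2 mulmxDr mulmxN mulmx1 opprD opprK; congr (_ - _).
by rewrite mulmxA -Gxi mulKmx.
Qed.

(** Both P Phi and P Phi^2 compute the trace of B over D, hence the factor 2. Each summand pairs a
    vector v of D with v Phi, the combination that [hess_D] controls. *)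
Lemma trace_contact e (B : 'rV[R]_d -> 'rV[R]_d -> 'rV[R]_e) (P : 'M[R]_d) :
  (forall u, linear (B u)) -> (forall u, linear (B ^~ u)) -> P^T *m P = invmx G ->
  2 *: (\sum_a \sum_b invmx G a b *: B (bvec a) (bvec b) - B xi xi)
  = \sum_l (B (row l P *m Phi) (row l P *m Phi)
            + B (row l P *m Phi *m Phi) (row l P *m Phi *m Phi)).
Proof.
move=> Br Bl PP.
have QQ : (P *m Phi)^T *m (P *m Phi) = invmx G - xi^T *m xi.
  by rewrite trmx_mul mulmxA -(mulmxA _ P^T) PP invmx_phi.
have QQ2 : (P *m Phi *m Phi)^T *m (P *m Phi *m Phi) = invmx G - xi^T *m xi.
  rewrite trmx_mul mulmxA -(mulmxA _ (P *m Phi)^T) QQ mulmxBr mulmxBl invmx_phi.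
  by rewrite mulmxA -trmx_mul (xi_phi SU Ux) trmx0 mul0mx mul0mx subr0.
have T Q : Q^T *m Q = invmx G - xi^T *m xi -> \sum_l B (row l Q) (row l Q)
    = \sum_a \sum_b invmx G a b *: B (bvec a) (bvec b) - B xi xi.
  move=> E; rewrite trace_bilinear // E.
  rewrite [X in _ = _ - X](linear_bvec_sum xi (Bl xi)) -sumrB.
  apply: eq_bigr => a _; rewrite (linear_bvec_sum xi (Br _)) scaler_sumr -sumrB.
  apply: eq_bigr => b _; rewrite scalerA -scalerBl; congr (_ *: _).
  by rewrite !mxE big_ord1 !mxE.
rewrite big_split /= scaler_nat mulr2n -{1}(T _ _ QQ) -(T _ _ QQ2).
by congr (_ + _); apply: eq_bigr => l _; rewrite !row_mul.
Qed.

(** For r > 0 every term of the nested sums over permutations contains a factor d eta. *)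
Lemma deta_zero_wedge r (X : 'I_(1 + r * 2) -> vfield R d) : (0 < r)%N ->
  (forall X Y : vfield R d, differentiable X x -> differentiable Y x -> deta S X Y x = 0) ->
  (forall k, differentiable (X k) x) ->
  wedge_form (eta_form S) (wedge_pow (deta_form S) r) X x = 0.
Proof.
case: r X => // r X _ H Xd.
rewrite /wedge_form big1 ?mulr0 // => s _.
rewrite /= /wedge_form big1 ?mulr0 // => t _.
by rewrite [deta_form _ _ _]H ?mulr0 ?mul0r //; exact: Xd.
Qed.

End ContactInverse.

(** * The differential of the Reeb factor lambda *)

Section ReebFactor.
Context {R : realType} {d : nat} (S : acm_coords R d) (U : set 'rV[R]_d) (SU : acm_chart S
  U).
Context (geo : forall z, U z -> cov (cg S) z (cxi S z) (cxi S) = 0).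

Local Notation eta x u := ((u *m ceta S x) 0 0).

Lemma eta_proj x (u : 'rV[R]_d) : U x -> eta x (u - eta x u *: cxi S x) = 0.
Proof. by move=> Ux; rewrite etaDl etaN etaZ (ac_eta_xi SU Ux) mulr1 subrr. Qed.

(** As nabla_xi xi = 0 and every nabla_u xi is orthogonal to xi, the vector xi is null for d eta. *)
Lemma deta_proj x (u v : 'rV[R]_d) : U x ->
  deta S (cfield (u - eta x u *: cxi S x)) (cfield (v - eta x v *: cxi S x)) x
  = deta S (cfield u) (cfield v) x.
Proof.
move=> Ux; rewrite !(deta_cst SU Ux).
have Cl a w : cov (cg S) x (w - a *: cxi S x) (cxi S) = cov (cg S) x w (cxi S).
  have := cov_xi_linear SU Ux (- a) (cxi S x) w.
  by rewrite geo // scaler0 add0r addrC scaleNr.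
have ipx a w w' : ip (cg S x) (w - a *: cxi S x) (cov (cg S) x w' (cxi S))
    = ip (cg S x) w (cov (cg S) x w' (cxi S)).
  by rewrite ipBl ipZl (acm_ipC SU Ux (cxi S x)) (ip_xi SU Ux) (eta_cov_xi SU Ux) mulr0
    subr0.
by rewrite !Cl !ipx.
Qed.

(* Here d lam = kap eta with kap = xi(lam), so that d(d lam) = 0 gives kap d eta = 0 on
   D, hence everywhere by [deta_proj]. *)
Lemma grad_zero_of_deta (lam : 'rV[R]_d -> R) x : U x -> Ck 2 U lam ->
  (forall z u, U z -> eta z u = 0 -> 'D_u lam z = 0) ->
  (exists u v, deta S (cfield u) (cfield v) x != 0) ->
  forall u, 'D_u lam x = 0.
Proof.
move=> Ux lam2 lamD [u0 [v0 uv0]].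
have Uo := mc_open (ac_metric SU).
have lamd z : U z -> differentiable lam z.
  by move=> Uz; apply: (Ck1_differentiable_scalar Uo) Uz; exact: Ck_pred.
pose kap z := 'D_(cxi S z) lam z.
have lamE u z : U z -> 'D_u lam z = kap z * (u *m ceta S z) 0 0.
  move=> Uz; have := lamD z _ Uz (eta_proj u Uz).
  have := linear_derive (- eta z u) (cxi S z) u (lamd z Uz) => E H.
  rewrite addrC -scaleNr in H.
  move: (etrans (esym E) H); rewrite -/(kap z) => /eqP.
  rewrite addrC scaleNr subr_eq0 => /eqP ->; exact: mulrC.
have kapd : differentiable kap x.
  have k1 : Ck 1 U (fun z => \sum_a cxi S z 0 a * 'D_(bvec a) lam z).
    apply: (Ck_sum _ Uo) => a; apply: (CkM Uo).
      by apply: (Ck_entry 0 a Uo); exact: (ac_xi SU).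
    exact: Ck_derive.
  apply: (Ck1_differentiable_scalar Uo _ Ux); apply: (Ck_eq Uo) k1 => z Uz.
  by rewrite /kap [RHS](derive_rV_sum _ (lamd z Uz)).
have key u v : 'D_u (fun z => 'D_v lam z) x
   = 'D_u kap x * eta x v + kap x * (v *m 'D_u (ceta S) x) 0 0.
  have E2 := is_derive_entry 0 0 (@is_derive_mulmx R _ 1 d 1 (fun=> v) (ceta S) x u _ _
    (is_derive_cst v x u) (is_derive_diff u (eta_differentiable SU Ux))).
  have [_ E] := is_deriveM (is_derive_diff u kapd) E2.
  rewrite mul0mx add0r in E.
  apply: etrans (derive_on u Uo Ux (lamE v)) _; apply: etrans E _.
  rewrite addrC; congr (_ + _); exact: mulrC.
have sym u v := etrans (esym (key u v)) (etrans (schwarz u v Uo Ux lam2) (key v u)).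
pose u := u0 - eta x u0 *: cxi S x; pose v := v0 - eta x v0 *: cxi S x.
have uvE : deta S (cfield u) (cfield v) x != 0 by rewrite deta_proj.
(* For u and v in D the terms with the derivative of kap drop out. Were kap nonzero at x, nabla eta
   would be symmetric on (u,v), against d eta(u,v) being nonzero. *)
have k0 : kap x = 0.
  have cancel (a b c f p q : R) : p = 0 -> q = 0 -> a * p + c = b * q + f -> c = f.
    by move=> -> ->; rewrite !mulr0 !add0r.
  have E := cancel _ _ _ _ _ _ (eta_proj v0 Ux) (eta_proj u0 Ux) (sym u v).
  apply/eqP; move: uvE; apply: contraNT => k0; rewrite (deta_cst SU Ux).
  have := etrans (esym (derive_eta SU Ux u v)) (etrans (mulfI k0 E) (derive_eta SU Ux v u)).
  rewrite (christoffel_sym (ac_metric SU) Ux u v) => /addrI ->.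
  by rewrite subrr mulr0.
by move=> w; rewrite lamE // k0 mul0r.
Qed.

End ReebFactor.

(** * Tension field on a contact source with zero twist *)

Section ContactSource.
Context {R : realType} {d e : nat}.
Context (S : acm_coords R d) (U : set 'rV[R]_d) (SU : acm_chart S U).
Context (geo : forall z, U z -> cov (cg S) z (cxi S z) (cxi S) = 0).
Context (twist0 : forall z u, U z -> (u *m ceta S z) 0 0 = 0 ->
  twist (cg S) z (cphi S) u = 0).
Context (y : 'rV[R]_d -> 'rV[R]_e) (ys : smooth_on U y).
Context (h : mfield R e) (U' : set 'rV[R]_e) (hU : metric_chart h U').
Context (yU : forall z, U z -> U' (y z)).
Context (Psi : mfield R e) (Psis : smooth_on U' Psi).
Context (s : R) (s2 : s * s = 1).
Context (holo : forall z, U z -> cphi S z *m jac y z = s *: (jac y z *m Psi (y z))).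
Context (x : 'rV[R]_d) (Ux : U x).

Let Uo : open U := mc_open (ac_metric SU).
Local Notation G := (cg S x).
Local Notation Phi := (cphi S x).
Local Notation xi := (cxi S x).
Local Notation J := (jac y x).
Local Notation hess := (hess y (cg S) h x).
Local Notation eta x u := ((u *m ceta S x) 0 0).

Lemma hess_D u : eta x u = 0 ->
  hess u u + hess (u *m Phi) (u *m Phi) = twist h (y x) Psi (u *m J).
Proof.
move=> u0; rewrite (hess_twist Uo ys (ac_metric SU) hU yU Ux (ac_phi SU) Psis holo s2).
  by rewrite twist0 // mul0mx subr0.
exact: (phi2_D SU Ux u0).
Qed.

(** Each pair v, v Phi of [trace_contact] contributes -2 b |v J|^2 gam, and the factor 2 cancels.
    Invertibility of P is recorded because [phi_jac_of_harmonic] has to pass from P Phi J = 0 to Phi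
    J = 0. *)
Lemma tension_contact b (gam : 'rV[R]_e) :
  (forall u, eta x u = 0 ->
    twist h (y x) Psi (u *m J) = (- 2 * b * ip (h (y x)) (u *m J) (u *m J)) *: gam) ->
  exists2 P : 'M[R]_d, P \in unitmx &
  tension (cg S) h y x = hess xi xi
   - (b * \sum_l ip (h (y x)) (row l P *m Phi *m J) (row l P *m Phi *m J)) *: gam.
Proof.
move=> tw; have [P Pu PP] := posdef_factor (mc_pos (ac_metric SU) Ux) (mc_sym (ac_metric
  SU) Ux).
exists P => //; rewrite (tension_hess Uo ys _ _ Ux).
have Br u : linear (hess u) by move=> a v w; exact: hess_linr.
have Bl u : linear (hess ^~ u).
  by move=> a v w; exact: (hess_linl Uo ys (ac_metric SU) hU yU Ux).
have := trace_contact SU Ux Br Bl PP.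
under [RHS]eq_bigr => l _ do rewrite hess_D ?(eta_phi SU Ux) // tw ?(eta_phi SU Ux) //.
rewrite -scaler_suml -mulr_sumr => E.
apply/eqP; rewrite -subr_eq0 opprD addrA opprK; apply/eqP.
have two0 : (2 : R) != 0 by rewrite pnatr_eq0.
apply: (scalerI two0); rewrite scaler0 scalerDr E scalerA -scalerDl.
rewrite [X in X *: _](_ : _ = 0) ?scale0r //; ring.
Qed.

End ContactSource.

(** * Holomorphic maps between contact charts *)

Section ContactTarget.
Context {R : realType} {d e : nat}.
Context (S : acm_coords R d) (U : set 'rV[R]_d) (SU : acm_chart S U).
Context (geo : forall z, U z -> cov (cg S) z (cxi S z) (cxi S) = 0).
Context (S' : acm_coords R e) (U' : set 'rV[R]_e) (SU' : acm_chart S' U').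
Context (geo' : forall z, U' z -> cov (cg S') z (cxi S' z) (cxi S') = 0).
Context (y : 'rV[R]_d -> 'rV[R]_e) (ys : smooth_on U y).
Context (yU : forall z, U z -> U' (y z)).
Context (s : R) (s2 : s * s = 1).
Context (holo : forall z, U z ->
  cphi S z *m jac y z = s *: (jac y z *m cphi S' (y z))).

Let Uo : open U := mc_open (ac_metric SU).
Local Notation eta z u := ((u *m ceta S z) 0 0).
Local Notation eta' z u := ((u *m ceta S' z) 0 0).
Local Notation hess x := (hess y (cg S) (cg S') x).

Lemma phi_jac z (u : 'rV[R]_d) : U z ->
  u *m cphi S z *m jac y z = s *: (u *m jac y z *m cphi S' (y z)).
Proof. by move=> Uz; rewrite -!mulmxA holo // -scalemxAr. Qed.

(** D is the image of phi, and holomorphy sends it into the image of the target endomorphism, on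
    which eta' vanishes. *)
Lemma eta_jac_D z (u : 'rV[R]_d) : U z -> eta z u = 0 -> eta' (y z) (u *m jac y z) = 0.
Proof.
move=> Uz u0; have -> : u = - (u *m cphi S z *m cphi S z).
  by rewrite (phi2_D SU Uz u0) opprK.
by rewrite mulNmx etaN phi_jac // etaZ (eta_phi SU' (yU Uz)) mulr0 oppr0.
Qed.

(** The function lambda of the chart, as eta' of the image of xi: it is available when no global
    lambda is given, and it is as smooth as the data. *)
Definition reeb_factor z := (cxi S z *m jac y z *m ceta S' (y z)) 0 0.

Lemma reeb_factorE z : U z -> cxi S z *m jac y z = reeb_factor z *: cxi S' (y z).
Proof.
move=> Uz; have := phi_jac (cxi S z) Uz; rewrite (xi_phi SU Uz) mul0mx => /esym/eqP.
have s0 : s != 0 by apply: contra_eq_neq s2 => ->; rewrite mul0r eq_sym oner_eq0.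
rewrite scaler_eq0 (negbTE s0) /= => /eqP /(congr1 (fun w => w *m cphi S' (y z))).
rewrite mul0mx (ac_phi2 SU' (yU Uz)) => /eqP; rewrite addrC subr_eq0 => /eqP.
exact: esym.
Qed.

Lemma reeb_factor_Ck k : Ck k U reeb_factor.
Proof.
apply: (Ck_entry 0 0 Uo); apply: (Ck_mulmx Uo).
  by apply: (Ck_mulmx Uo); [exact: (ac_xi SU)|exact: (jac_smooth Uo ys)].
apply: (Ck_mx Uo) => a b.
apply: (Ck_comp (f := fun z => ceta S' z a b) Uo (mc_open (ac_metric SU')) yU (ys k)).
by apply: Ck_entry; [exact: mc_open (ac_metric SU')|exact: (ac_eta SU')].
Qed.

Section AtPoint.
Context (lam : 'rV[R]_d -> R) (lam1 : Ck 1 U lam).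
Context (xiJ : forall z, U z -> cxi S z *m jac y z = lam z *: cxi S' (y z)).
Context (x : 'rV[R]_d) (Ux : U x).

Lemma hess_reeb (u : 'rV[R]_d) : hess x u (cxi S x)
  = 'D_u lam x *: cxi S' (y x) + lam x *: cov (cg S') (y x) (u *m jac y x) (cxi S')
    - cov (cg S) x u (cxi S) *m jac y x.
Proof.
apply: (hess_xi Uo ys (cg S) (cg S') Ux (xi_differentiable SU Ux)
  (xi_differentiable SU' (yU Ux)) _ xiJ).
exact: (Ck1_differentiable_scalar Uo lam1 Ux).
Qed.

Lemma hess_reeb_reeb : hess x (cxi S x) (cxi S x)
  = 'D_(cxi S x) lam x *: cxi S' (y x).
Proof.
rewrite hess_reeb geo // mul0mx subr0 xiJ //.
have := cov_xi_linear SU' (yU Ux) (lam x) (cxi S' (y x)) 0.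
rewrite addr0 (geo' (yU Ux)) => ->; rewrite scaler0 add0r.
have := cov_xi_linear SU' (yU Ux) (-1) 0 0; rewrite scaler0 addr0 scaleN1r addNr => ->.
by rewrite scaler0 addr0.
Qed.

(* u(lam) and 0 are the gamma-components of hess u xi and of hess xi u. *)
Lemma reeb_factor_derive_D (u : 'rV[R]_d) : eta x u = 0 -> 'D_u lam x = 0.
Proof.
move=> u0; have Uy := yU Ux.
have E1 : eta' (y x) (hess x u (cxi S x)) = 'D_u lam x.
  rewrite hess_reeb !etaDl etaN etaZ etaZ (eta_cov_xi SU' Uy) (ac_eta_xi SU' Uy) mulr0.
  by rewrite (eta_jac_D Ux (eta_cov_xi SU Ux u)) oppr0 !addr0 mulr1.
have E2 : eta' (y x) (hess x (cxi S x) u) = 0.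
  (* As an image of Phi, u can be fed to [hess_phi], whose psi-term has no gamma-component. *)
  have -> : u = (- (u *m cphi S x)) *m cphi S x by rewrite mulNmx (phi2_D SU Ux u0) opprK.
  set w := - _.
  rewrite (hess_phi Uo ys (ac_metric SU) (ac_metric SU') yU Ux (ac_phi SU) (ac_phi SU')
    holo).
  rewrite etaDl etaN etaZ etaDl (eta_phi SU' Uy) add0r xiJ //.
  rewrite (cov_endZl (ac_metric SU') Uy (ac_phi SU')) etaZ.
  (* Skewness turns this gamma-component into an inner product with (nabla_gamma phi') gamma, which
     is zero because gamma is geodesic. The same argument on M then puts (nabla_xi phi) w in D. *)
  have -> : eta' (y x) (cov_end (cg S') (y x) (cphi S') (cxi S' (y x)) (w *m jac y x)) = 0.
    rewrite -(ip_xi SU' Uy).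
    rewrite (cov_end_skew (ac_metric SU') Uy (ac_phi SU') (fun z Uz => phi_skew SU' Uz)).
    by rewrite (cov_end_xi SU' Uy) geo' // mul0mx oppr0 ip0r oppr0.
  rewrite !mulr0 add0r eta_jac_D ?oppr0 // -(ip_xi SU Ux).
  rewrite (cov_end_skew (ac_metric SU) Ux (ac_phi SU) (fun z Uz => phi_skew SU Uz)).
  by rewrite (cov_end_xi SU Ux) geo // mul0mx oppr0 ip0r oppr0.
by rewrite -E1 (hess_sym Uo ys (ac_metric SU) (ac_metric SU') yU Ux) E2.
Qed.

End AtPoint.

Lemma reeb_factor_grad (lam : 'rV[R]_d -> R) x : Ck 2 U lam ->
  (forall z, U z -> cxi S z *m jac y z = lam z *: cxi S' (y z)) -> U x ->
  (exists u v, deta S (cfield u) (cfield v) x != 0) ->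
  forall u, 'D_u lam x = 0.
Proof.
move=> lam2 xiJ Ux; apply: (grad_zero_of_deta SU geo Ux lam2) => z u Uz.
by apply: reeb_factor_derive_D => //; exact: Ck_pred.
Qed.

End ContactTarget.

(** * The classes of almost Hermitian and almost contact metric manifolds *)

Section Hermitian.
Context {R : realType} {d : nat} (g T : mfield R d) (U : set 'rV[R]_d).
Context (gU : metric_chart g U) (Ts : smooth_on U T).
Context (T2 : forall x, U x -> forall u : 'rV[R]_d, u *m T x *m T x = - u).
Context (Tg : forall x, U x -> forall u v, ip (g x) (u *m T x) (v *m T x) = ip (g x) u v).
Implicit Types (u v w : 'rV[R]_d).

Lemma hermitian_skew x u v : U x -> ip (g x) (u *m T x) v = - ip (g x) u (v *m T x).
Proof. by move=> Ux; rewrite -[LHS]Tg // T2 // ipNl. Qed.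

Context (x : 'rV[R]_d) (Ux : U x).
Local Notation A := (cov_end g x T).

Lemma hermitian_cov_end u v : A u (v *m T x) + A u v *m T x = 0.
Proof.
have Td := is_derive_diff u (endo_differentiable gU Ux Ts).
have [_ D1] := is_derive_mulmx Td Td.
have D2 : 'D_u (fun z => T z *m T z) x = 'D_u (fun=> - 1%:M : 'M[R]_d) x.
  apply: (derive_on u (mc_open gU) Ux) => z Uz.
  by apply/row_matrixP => i; rewrite !rowE mulmxA T2 // mulmxN mulmx1.
have := congr1 (fun M => v *m M) (etrans (esym D1) (etrans D2 (derive_cst _ _ _))).
rewrite mulmx0 mulmxDr !mulmxA => E.
rewrite /cov_end T2 // christoffelNr !mulmxBl !mulmxDl T2 //.
have rearrange (p q b c : 'rV[R]_d) : p + q = 0 -> q - b - c + (p + c - - b) = 0.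
  by move=> H; apply/rowP => j; move/rowP: H => /(_ j); rewrite !mxE; lra.
exact: rearrange.
Qed.

Lemma hermitian_twist_almost u :
  (forall a b c, dfund g T (cfield a) (cfield b) (cfield c) x = 0) ->
  twist g x T u = 0.
Proof.
move=> H; apply: (posdef_eq0 (mc_pos gU Ux)).
rewrite (twist_dfund gU Ux Ts) ?H ?oppr0 //.
  by move=> z Uz a b; exact: hermitian_skew.
by move=> w; rewrite hermitian_cov_end ip0l.
Qed.

Lemma hermitian_twist_nearly u : (forall v, A v v = 0) -> twist g x T u = 0.
Proof.
move=> N; have E : A u (u *m T x) = 0.
  by have := hermitian_cov_end u u; rewrite N mul0mx addr0.
by rewrite /twist (cov_end_alternating gU Ux Ts N (u *m T x)) E oppr0 addr0.
Qed.

End Hermitian.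

(** * Geodesic Reeb field and twist of the contact classes *)

Section ContactClasses.
Context {R : realType} {m : nat} {M : manifold R (2 * m).+1} (S : almost_contact_metric M).
Local Notation d := (2 * m).+1.
Implicit Types (u v w : 'rV[R]_d).

Definition reeb_geodesic := forall i x, im i x ->
  cov (cg (S i)) x (cxi (S i) x) (cxi (S i)) = 0.

(* The classes A1, A4 and B1 have [b = 0]; [b] is theta for A3 and beta for B3. *)
Definition twist_kenmotsu_type (b : M -> R) := forall i x u, im i x ->
  (u *m ceta (S i) x) 0 0 = 0 -> twist (cg (S i)) x (cphi (S i)) u
   = (- 2 * b (chart_inv i x) * ip (cg (S i) x) u u) *: cxi (S i) x.

Lemma acm_chart_im i : acm_chart (S i) (im i).
Proof.
have [gs gsym gpos _] := acm_metric S; have [phis _] := acm_phi S.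
have [xis _] := acm_xi S; have [etas _] := acm_eta S.
split; [|exact: phis|exact: xis|exact: etas|exact: acm_phi2|exact: acm_eta_xi|exact:
  acm_compat].
split; [exact: im_open|exact: gs|exact: gsym|exact: gpos].
Qed.

Section InChart.
Context (i : idx M) (x : 'rV[R]_d) (ix : im i x).
Let SU := acm_chart_im i.
Let gU := ac_metric SU.
Local Notation A := (cov_end (cg (S i)) x (cphi (S i))).

Lemma smooth_cfield u : smooth_on (im i) (cfield u).
Proof. by move=> k; exact: Ck_cst. Qed.

Lemma nabphiE (X Y : vfield R d) : differentiable Y x ->
  nabphi (S i) X Y x = A (X x) (Y x).
Proof. exact: (nabla_endE gU ix (ac_phi SU)). Qed.

Lemma nabphi_cst u v : nabphi (S i) (cfield u) (cfield v) x = A u v.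
Proof. by rewrite nabphiE //; exact: differentiable_cst. Qed.

Lemma phif_differentiable (X : vfield R d) : differentiable X x ->
  differentiable (phif (S i) X) x.
Proof. by move=> Xd; apply: differentiable_mulmx => //;
  exact: (phi_differentiable SU ix). Qed.

Lemma Pten_cst u v : Pten (S i) (cfield u) (cfield v) x
  = A u v + A (u *m cphi (S i) x) (v *m cphi (S i) x).
Proof.
rewrite /Pten nabphi_cst nabphiE //; apply: phif_differentiable.
exact: differentiable_cst.
Qed.

Lemma twist_Pten u : (u *m ceta (S i) x) 0 0 = 0 ->
  Pten (S i) (cfield (u *m cphi (S i) x)) (cfield u) x = twist (cg (S i)) x (cphi (S i)) u.
Proof.
by move=> u0; rewrite Pten_cst (phi2_D SU ix u0) (cov_endNl gU ix (ac_phi SU)).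
Qed.

Lemma Pten_xi u : Pten (S i) (cfield u) (cfield (cxi (S i) x)) x = A u (cxi (S i) x).
Proof. by rewrite Pten_cst (xi_phi SU ix) cov_end0r addr0. Qed.

Lemma bracket_phi_xi (Y : vfield R d) : bracket (phif (S i) (cxi (S i))) Y x = 0.
Proof.
rewrite /bracket /Lder [phif _ _ x](xi_phi SU ix) derive0 sub0r.
rewrite (derive_on (F2 := fun=> 0) _ (mc_open gU) ix) ?derive_cst ?oppr0 // => z iz.
exact: (xi_phi SU iz).
Qed.

Lemma hten_xi : hten (S i) (cxi (S i)) x = 0.
Proof.
have bC (X Y : vfield R d) : bracket X Y x = - bracket Y X x by rewrite /bracket opprB.
rewrite /hten bC bracket_phi_xi oppr0 /phif /app_end /bracket subrr mul0mx subr0.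
by rewrite scaler0.
Qed.

(** Take X = xi in the normality condition and apply eta: every term of the Nijenhuis tensor is an
    image of phi or a bracket with phi xi = 0, so only 2 d eta(xi, v) remains. *)
Lemma normal_deta_xi v : normal_acm S -> deta (S i) (cfield (cxi (S i) x)) (cfield v) x = 0.
Proof.
move=> N; have := N i (cxi (S i)) (cfield v) (ac_xi SU) (smooth_cfield v) x ix.
have aux (p q r : 'rV[R]_d) (c : R) : p *m cphi (S i) x *m cphi (S i) x + 0
    - q *m cphi (S i) x - r *m cphi (S i) x + c *: cxi (S i) x = 0 -> c = 0.
  move=> /(congr1 (fun w => (w *m ceta (S i) x) 0 0)).
  rewrite addr0 !etaDl !etaN etaZ !(eta_phi SU ix) (ac_eta_xi SU ix).
  by rewrite !subr0 add0r mulr1 mul0mx [RHS]mxE.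
rewrite /nijenhuis bracket_phi_xi => /aux /eqP; rewrite mulf_eq0 pnatr_eq0 /= => /eqP.
have xid := xi_differentiable SU ix.
by rewrite !(deta_cov SU ix) //; exact: differentiable_cst.
Qed.

Lemma deta_zero_reeb :
  (forall v, deta (S i) (cfield (cxi (S i) x)) (cfield v) x = 0) ->
  cov (cg (S i)) x (cxi (S i) x) (cxi (S i)) = 0.
Proof. exact: (reeb_geodesic_of_deta SU ix). Qed.

End InChart.

Lemma normal_reeb : normal_acm S -> reeb_geodesic.
Proof. by move=> N i x ix; apply: deta_zero_reeb => // v; exact: normal_deta_xi. Qed.

Lemma deta_zero_reeb_geodesic : deta_zero S -> reeb_geodesic.
Proof.
move=> H i x ix; apply: deta_zero_reeb => // v.
by apply: H ix; exact: smooth_cfield.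
Qed.

Lemma dOmega_zero_twist : dOmega_zero S -> twist_kenmotsu_type (fun=> 0).
Proof.
move=> H i x u ix u0; rewrite mulr0 mul0r scale0r.
apply: (twist_dOmega_zero (acm_chart_im i) ix u0) => a b c.
by apply: H ix; exact: smooth_cfield.
Qed.

Lemma twist_kenmotsu_type0 : (forall i x u, im i x -> (u *m ceta (S i) x) 0 0 = 0 ->
   twist (cg (S i)) x (cphi (S i)) u = 0) -> twist_kenmotsu_type (fun=> 0).
Proof. by move=> H i x u ix u0; rewrite mulr0 mul0r scale0r; exact: H. Qed.

(** The twist is P(phi u, u), and g(phi u, u) = 0 by skewness. This serves the classes defined by a
    formula for P. *)
Lemma Pten_twist :
  (forall i x u v, im i x -> (v *m ceta (S i) x) 0 0 = 0 -> exists a,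
    Pten (S i) (cfield u) (cfield v) x = (a * ip (cg (S i) x) u v) *: cxi (S i) x) ->
  twist_kenmotsu_type (fun=> 0).
Proof.
move=> H; apply: twist_kenmotsu_type0 => i x u ix u0; have SU := acm_chart_im i.
have [a] := H i x (u *m cphi (S i) x) u ix u0; rewrite twist_Pten // => ->.
have : ip (cg (S i) x) (u *m cphi (S i) x) u = 0.
  have := phi_skew SU ix u u; rewrite (acm_ipC SU ix u); lra.
by move=> ->; rewrite mulr0 scale0r.
Qed.

Lemma cov_end_reeb : (forall i x, im i x ->
    cov_end (cg (S i)) x (cphi (S i)) (cxi (S i) x) (cxi (S i) x) = 0) -> reeb_geodesic.
Proof. by move=> H i x ix; apply: (reeb_geodesic_of_cov_end (acm_chart_im i) ix);
  exact: H. Qed.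

Definition geodesic_untwisted := reeb_geodesic /\ twist_kenmotsu_type (fun=> 0).

(** Omega is closed as a multiple of d(d eta), and d eta(xi, v) = alpha Omega(xi, v) = 0. *)
Lemma alpha_contact_untwisted alpha : alpha != 0 -> deta_alpha_Omega S alpha ->
  geodesic_untwisted.
Proof.
move=> a0 H.
have Hc i x u v : im i x -> deta (S i) (cfield u) (cfield v) x
    = alpha * Omega (S i) (cfield u) (cfield v) x.
  by move=> ix; apply: H ix; exact: smooth_cfield.
split; last first.
  apply: twist_kenmotsu_type0 => i x u ix u0;
    apply: (twist_dOmega_zero (acm_chart_im i) ix u0) => a b c.
  by apply: (dOmega_zero_of_deta (acm_chart_im i) a0) ix a b c => u' v' z iz; exact: Hc.
move=> i x ix; apply: deta_zero_reeb => // v; rewrite Hc //.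
have SU := acm_chart_im i.
by rewrite /Omega /fund /ipf /app_end /cfield (acm_ipC SU ix) (ip_xi SU ix) (eta_phi SU
  ix) mulr0.
Qed.

Lemma class_A1_untwisted : class_A1 S -> geodesic_untwisted.
Proof.
case=> [[alpha [a0]]|QC|QK|[[H _]|[[alpha [a0 H]] _]]].
- exact: alpha_contact_untwisted.
- split.
    apply: cov_end_reeb => i x ix; have SU := acm_chart_im i.
    have xid := xi_differentiable SU ix.
    (* Evaluated on the field xi and not on the constant field with its value, so that [hten_xi]
       applies; the right-hand side is 2 xi - (xi + xi + 0). *)
    have := QC i _ _ (ac_xi SU) (ac_xi SU) x ix.
    rewrite /Pten !nabphiE //; last exact: phif_differentiable.
    rewrite [phif _ _ x](xi_phi SU ix) cov_end0r addr0 => ->.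
    rewrite hten_xi // /gf /ipf (ip_xi_xi SU ix) /etaf (ac_eta_xi SU ix) addr0 !scale1r.
    by rewrite mulr1 scaler_nat mulr2n subrr.
  apply: Pten_twist => i x u v ix v0; exists 2.
  rewrite (QC i _ _ (smooth_cfield i u) (smooth_cfield i v) x ix).
  by rewrite /etaf /cfield v0 scale0r subr0.
- split.
    apply: cov_end_reeb => i x ix; have SU := acm_chart_im i.
    (* P(xi, xi) = 2 xi - 2 xi + nabla_{phi xi} xi, and phi xi = 0. *)
    rewrite -Pten_xi // (QK i _ _ (smooth_cfield i _) (smooth_cfield i _) x ix).
    rewrite /etaf /gf /ipf /cfield (ac_eta_xi SU ix) (ip_xi_xi SU ix) subrr add0r scale1r.
    rewrite /nab /nabla /Lder /phif /app_end (xi_phi SU ix) derive0 add0r.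
    exact: christoffel0l.
  apply: Pten_twist => i x u v ix v0; exists 2.
  rewrite (QK i _ _ (smooth_cfield i u) (smooth_cfield i v) x ix).
  by rewrite /etaf /cfield v0 mulr0 !scale0r subr0 addr0.
- by apply: alpha_contact_untwisted H; rewrite oner_eq0.
- exact: alpha_contact_untwisted H.
Qed.

Lemma class_A4_untwisted : class_A4 S -> geodesic_untwisted.
Proof. by move=> [N O _]; split; [exact: normal_reeb|exact: dOmega_zero_twist]. Qed.

Lemma nearly_cosymplectic_untwisted : nearly_cosymplectic S -> geodesic_untwisted.
Proof.
move=> N; have Nc i x v : im i x -> cov_end (cg (S i)) x (cphi (S i)) v v = 0.
  by move=> ix; rewrite -nabphi_cst //; apply: N ix; exact: smooth_cfield.
split; first by apply: cov_end_reeb => i x ix; exact: Nc.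
apply: twist_kenmotsu_type0 => i x u ix u0;
  apply: (twist_nearly (acm_chart_im i) ix u0) => v.
exact: Nc.
Qed.

Lemma class_B1_untwisted : class_B1 S -> geodesic_untwisted.
Proof.
case=> [[H O _]|[H O]|N|[[N _]|Q]].
- by split; [exact: deta_zero_reeb_geodesic|exact: dOmega_zero_twist].
- by split; [exact: deta_zero_reeb_geodesic|exact: dOmega_zero_twist].
- exact: nearly_cosymplectic_untwisted.
- exact: nearly_cosymplectic_untwisted.
- split.
    apply: cov_end_reeb => i x ix; have SU := acm_chart_im i.
    rewrite -Pten_xi // (Q i _ _ (smooth_cfield i _) (smooth_cfield i _) x ix).
    rewrite /nab /nabla /Lder /phif /app_end /cfield (xi_phi SU ix) derive0 add0r.
    by rewrite christoffel0l scaler0.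
  apply: Pten_twist => i x u v ix v0; exists 0.
  rewrite (Q i _ _ (smooth_cfield i u) (smooth_cfield i v) x ix).
  by rewrite /etaf /cfield v0 mul0r !scale0r.
Qed.

(** The wp-terms of the twist are multiples of g(phi u, u) = 0; its theta-part is the difference of
    -|u|^2 xi and |phi u|^2 xi = |u|^2 xi. *)
Lemma class_A3_twisted : class_A3 S ->
  reeb_geodesic /\ exists b : M -> R, (forall p, b p != 0) /\ twist_kenmotsu_type b.
Proof.
move=> [wp [theta [_ _ _ th0 [_ H _]]]].
have Hc i x u v : im i x -> cov_end (cg (S i)) x (cphi (S i)) u v
    = wp (chart_inv i x) *: (ip (cg (S i) x) u v *: cxi (S i) x - (v *m ceta (S i) x) 0 0
      *: u)
     + theta (chart_inv i x) *: (ip (cg (S i) x) (u *m cphi (S i) x) v *: cxi (S i) x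
         - (v *m ceta (S i) x) 0 0 *: (u *m cphi (S i) x)).
  move=> ix; rewrite -nabphi_cst //.
  by rewrite (H i _ _ (smooth_cfield i u) (smooth_cfield i v) x ix).
split.
  apply: cov_end_reeb => i x ix; have SU := acm_chart_im i; rewrite Hc //.
  rewrite (xi_phi SU ix) ip0l (ip_xi_xi SU ix) (ac_eta_xi SU ix) subrr scale0r !scaler0.
  by rewrite subr0 scaler0 addr0.
exists theta; split=> // i x u ix u0; have SU := acm_chart_im i.
rewrite /twist !Hc // (eta_phi SU ix) u0 !scale0r !subr0 (phi2_D SU ix u0) ipNl.
rewrite (ac_compat SU ix) u0 mul0r subr0 (phi_skew SU ix) -(acm_ipC SU ix).
have -> : ip (cg (S i) x) (u *m cphi (S i) x) u = 0.
  have := phi_skew SU ix u u; rewrite (acm_ipC SU ix u); lra.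
rewrite oppr0 !scale0r !scaler0 !add0r !scalerA -scalerBl; congr (_ *: _); ring.
Qed.

Lemma class_B3_twisted : class_B3 S ->
  reeb_geodesic /\ exists b : M -> R, (forall p, b p != 0) /\ twist_kenmotsu_type b.
Proof.
move=> [b H].
have {H} [[_ b0] H1 H2 _] : almost_beta_kenmotsu S b by case: H => [|[]|[]].
split; first exact: deta_zero_reeb_geodesic.
exists b; split=> // i x u ix u0; apply: (twist_kenmotsu (acm_chart_im i) ix u0) => p q r.
by apply: H1 ix; exact: smooth_cfield.
Qed.

End ContactClasses.

(** * Maps between manifolds *)

Section LocallyConstant.

(** The fibre through q is open, and so is its complement. *)
Lemma connected_locally_constant (T : topologicalType) (A : Type) (F : T -> A) :
  connected [set: T] -> (forall p, \forall q \near p, F q = F p) -> constant_map F.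
Proof.
move=> Tc Floc p q; pose B := [set r | F r = F q].
have Bo : open B.
  rewrite openE => r /= Br; apply: (@filterS _ _ (nbhs_filter r) _ _ _ (Floc r)) => t Ft.
  exact: etrans Ft Br.
have Bc : closed B.
  rewrite -[B]setCK; apply: open_closedC; rewrite openE => r /= Br.
  apply: (@filterS _ _ (nbhs_filter r) _ _ _ (Floc r)) => t Ft Bt.
  by apply: Br; exact: etrans (esym Ft) Bt.
have BT : B = [set: T].
  apply: Tc; first by exists q.
  - by exists B => //; rewrite setTI.
  - by exists B => //; rewrite setTI.
by have : B p by rewrite BT.
Qed.

Context {R : realType} {d : nat}.

Lemma grad_zero_near (U : set 'rV[R]_d) (f : 'rV[R]_d -> R) (x : 'rV[R]_d) :
  open U -> U x -> (forall z, U z -> differentiable f z) ->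
  (forall z u, U z -> 'D_u f z = 0) -> \forall z \near x, f z = f x.
Proof.
move=> Uo Ux fd f0; have := open_nbhs_nbhs (conj Uo Ux).
move=> /(iffLR (@nbhs_normP R 'rV[R]_d _ _))[r /= r0 rU].
apply: (iffRL (@nbhs_normP R 'rV[R]_d _ _)); exists r => //= z /= zr.
have -> : z = x + (z - x) by rewrite addrC subrK.
apply: derive0_segment => t /andP[t0 t1].
have Ut : U (x + t *: (z - x)).
  apply: rU; rewrite /ball_ /= opprD addNKr normrN normrZ (ger0_norm t0).
  by rewrite (le_lt_trans _ zr) // distrC ler_piMl.
by split; [apply: diff_derivable; exact: fd|exact: f0].
Qed.

End LocallyConstant.

Section Charts.
Context {R : realType} {d : nat} {M : manifold R d}.

Lemma im_chart (i : idx M) p : dom i p -> im i (chart i p).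
Proof. by move=> ip; exists p. Qed.

Lemma near_chart (i : idx M) p (P : 'rV[R]_d -> Prop) (Q : M -> Prop) : dom i p ->
  (\forall z \near chart i p, P z) -> (forall q, dom i q -> P (chart i q) -> Q q) ->
  \forall q \near p, Q q.
Proof.
move=> ip Pn PQ; have nP : \forall q \near p, P (chart i q) := chart_cont ip Pn.
apply: filterS2 (open_nbhs_nbhs (conj (@dom_open _ _ M i) ip)) nP.
exact: PQ.
Qed.

End Charts.

Section MapsInCharts.
Context {R : realType} {d e : nat} {M : manifold R d} {N : manifold R e}.
Context (f : M -> N) (fs : smooth_map f).

Lemma locdom_open i j : open (locdom f i j).
Proof.
suff H (x : 'rV[R]_d) : locdom f i j x -> nbhs x (locdom f i j).
  by rewrite openE => x; exact: H.
move=> [ix jx]; have n1 : nbhs x (im i).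
  by apply: open_nbhs_nbhs; split => //; exact: im_open.
have fc : {for x, continuous (f \o chart_inv i)}.
  by apply: continuous_comp; [exact: chart_inv_cont|exact: fs.1].
have n2 : nbhs x [set z | dom j (f (chart_inv i z))].
  by apply: fc; apply: open_nbhs_nbhs; split => //; exact: dom_open.
exact: (@filterI _ _ (nbhs_filter x) _ _ n1 n2).
Qed.

Lemma loc_im i j x : locdom f i j x -> im j (loc f i j x).
Proof. by move=> [_ jx]; exact: im_chart. Qed.

Lemma locdom_ex i x : im i x -> exists j, locdom f i j x.
Proof. by move=> ix; have [j jx] := dom_cover (f (chart_inv i x)); exists j. Qed.

Lemma constant_map_of_derive : connected [set: M] ->
  (forall i j x u, locdom f i j x -> 'D_u (loc f i j) x = 0) -> constant_map f.
Proof.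
move=> Mc f0; apply: connected_locally_constant Mc _ => p.
have [i ip] := dom_cover p; have [j jp] := dom_cover (f p).
have Ux : locdom f i j (chart i p).
  by split; [exact: im_chart|rewrite chartK].
have Uo := @locdom_open i j.
have yd z : locdom f i j z -> differentiable (loc f i j) z.
  by move=> Uz; apply: (smooth_differentiable Uo) Uz; exact: fs.2.
have near_eq : \forall z \near chart i p, locdom f i j z /\ loc f i j z = loc f i j (chart
  i p).
  apply: filterS2 (open_nbhs_nbhs (conj Uo Ux)) _ => [z Uz H|]; first by split; [|exact: H].
  have H b : \forall z \near chart i p, loc f i j z 0 b = loc f i j (chart i p) 0 b.
    apply: (grad_zero_near Uo Ux) => [z Uz|z u Uz].
      by apply: differentiable_entry; exact: yd.
    by rewrite derive_entry ?f0 ?mxE //; apply: diff_derivable; exact: yd.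
  have Hall := @filter_forall _ _ _ _ (nbhs_filter (chart i p)) H.
  by apply: (@filterS _ _ (nbhs_filter (chart i p)) _ _ _ Hall) => z Hz; apply/rowP.
apply: (near_chart ip near_eq) => q iq [[_ jq] E].
move: E jq; rewrite /loc !chartK // => E jq.
by rewrite -(chartK jq) E chartK.
Qed.

Lemma constant_fun_of_derive (lam : M -> R) : connected [set: M] -> smooth_fun lam ->
  (forall i x u, im i x -> 'D_u (fun z => lam (chart_inv i z)) x = 0) -> constant_map lam.
Proof.
move=> Mc ls l0; apply: connected_locally_constant Mc _ => p.
have [i ip] := dom_cover p; have ix := im_chart ip.
pose l (z : 'rV[R]_d) : R := lam (chart_inv i z).
have ld (z : 'rV[R]_d) : im i z -> differentiable l z.
  move=> iz.
  have H := (@Ck1_differentiable_scalar R d (im i) l z (@im_open _ _ M i) (ls i 1%N) iz).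
    exact: H.
have := grad_zero_near (@im_open _ _ M i) ix ld (fun z u iz => l0 i z u iz) => H.
apply: (near_chart ip H) => q iq E.
by move: (E : lam (chart_inv i (chart i q)) = lam (chart_inv i (chart i p)));
  rewrite !chartK.
Qed.

End MapsInCharts.

(** * Tension field under a constant rescaling of the metric *)

Section ScaledMetric.
Context {R : realType} {d e : nat}.

Lemma christoffel_scaled (g g' : mfield R d) (U : set 'rV[R]_d) (x : 'rV[R]_d) (a : R) :
  open U -> U x -> a != 0 -> differentiable g x -> g x \in unitmx ->
  (forall z, U z -> g' z = a *: g z) ->
  forall u v, christoffel_form g' x u v = christoffel_form g x u v.
Proof.
move=> Uo Ux a0 gd gu E u v; apply/rowP => k; rewrite !mxE.
apply: eq_bigr => i _; apply: eq_bigr => j _; congr (_ * _ * _).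
have agu : a *: g x \in unitmx by rewrite unitmxZ ?unitfE.
have D c p q : 'D_(bvec c) (fun z => g' z p q) x = a * 'D_(bvec c) (fun z => g z p q) x.
  have gpq := is_derive_diff (bvec c) (differentiable_entry p q gd).
  have [_ H] := is_deriveZ a gpq.
  by apply: etrans H; apply: (derive_on _ Uo Ux) => z Uz; rewrite E // mxE.
rewrite /christoffel; congr (_ * _); apply: eq_bigr => l _.
rewrite !D E // invmxZ // mxE; set p := 'D_(_) _ _; set q := 'D_(_) _ _;
  set r := 'D_(_) _ _.
by field.
Qed.

(** The connection does not change, so only the inverse metric in the trace is rescaled. This serves
    for the minimal image, where the induced metric is c^2 g. *)
Lemma tension_scaled (g g' : mfield R d) (h : mfield R e) y (U : set 'rV[R]_d)
    (x : 'rV[R]_d) (a : R) :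
  open U -> U x -> a != 0 -> differentiable g x -> g x \in unitmx ->
  (forall z, U z -> g' z = a *: g z) ->
  tension g' h y x = a^-1 *: tension g h y x.
Proof.
move=> Uo Ux a0 gd gu E; rewrite /tension scaler_sumr; apply: eq_bigr => p _.
rewrite scaler_sumr; apply: eq_bigr => q _.
have agu : a *: g x \in unitmx by rewrite unitmxZ ?unitfE.
have -> : invmx (g' x) p q = a^-1 * invmx (g x) p q by rewrite E // invmxZ // mxE.
have aux (k l : R) (v w : 'rV[R]_e) : v = w -> (k * l) *: v = k *: (l *: w).
  by move=> ->; rewrite scalerA.
apply: aux; have H := christoffel_scaled Uo Ux a0 gd gu E (bvec p) (bvec q).
pose X : vfield R d := cfield (bvec p); pose Y : vfield R d := cfield (bvec q).
have E2 : nabla g' X Y x = nabla g X Y x := congr1 (fun w => Lder X Y x + w) H.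
exact: (congr1 (fun w => nabla_along h y X (pushf y Y) x - 'D_w y x) E2).
Qed.

End ScaledMetric.

(** * Maps from a quasi-Sasakian manifold, in charts *)

Section QuasiSasakianSource.
Context {R : realType} {m : nat} {M : manifold R (2 * m).+1} (SM : almost_contact_metric M).
Context (MA4 : class_A4 SM).
Local Notation d := (2 * m).+1.

(** Were d eta zero at x on constant fields, tensoriality would make it zero there on all fields,
    against eta wedge (d eta)^r being nonzero with r >= 1. *)
Lemma quasi_sasakian_deta_neq0 i x : im i x ->
  exists u v, deta (SM i) (cfield u) (cfield v) x != 0.
Proof.
move=> ix; apply: contrapT => H.
have H0 u v : deta (SM i) (cfield u) (cfield v) x = 0.
  by apply: contrapT => /eqP H1; apply: H; exists u, v.
have SU := acm_chart_im SM i.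
have Hf (X Y : vfield R d) : differentiable X x -> differentiable Y x -> deta (SM i) X Y x
  = 0.
  by move=> Xd Yd; have := H0 (X x) (Y x); rewrite (deta_cst SU ix) (deta_cov SU ix).
have [_ _ [r [/andP[r1 _] Hr _]]] := MA4.
have [X [Xs]] := Hr i x ix; apply/negP; rewrite negbK; apply/eqP.
apply: deta_zero_wedge => // k.
exact: (smooth_differentiable (mc_open (ac_metric SU)) (Xs k) ix).
Qed.

(** A vector killed by phi is a multiple of xi, hence null for d eta, which does not vanish. This
    supplies a nonzero vector of D on which to test conformality. *)
Lemma quasi_sasakian_phi_neq0 i x : im i x ->
  exists u : 'rV[R]_d, u *m cphi (SM i) x != 0.
Proof.
move=> ix; have [u [v uv]] := quasi_sasakian_deta_neq0 ix; have SU := acm_chart_im SM i.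
exists u; apply: contraNneq uv => u0.
have geo := (class_A4_untwisted MA4).1.
rewrite -(deta_proj SU (geo i) u v ix).
have -> : u - (u *m ceta (SM i) x) 0 0 *: cxi (SM i) x = 0.
  have := ac_phi2 SU ix u; rewrite u0 mul0mx => /esym /eqP.
  by rewrite addrC subr_eq0 => /eqP ->; rewrite subrr.
rewrite (deta_cst SU ix) ip0l subr0.
have := cov_xi_linear SU ix (-1) 0 0; rewrite scaler0 addr0 scaleN1r addNr => ->.
by rewrite ip0r mulr0.
Qed.

Section Maps.
Context {e : nat} {N : manifold R e} (f : M -> N) (fs : smooth_map f).
Context (h : idx N -> mfield R e) (Psi : idx N -> mfield R e).
Context (hm : forall j, metric_chart (h j) (im j)) (Psis : forall j, smooth_on (im j) (Psi
  j)).
Context (sgn : bool) (fholo : holomorphic_sign (acm_endo SM) Psi sgn f).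
Let s : R := (-1) ^+ sgn.

Lemma sign_sq : s * s = 1.
Proof. by rewrite /s -expr2 sqrr_sign. Qed.

Lemma acm_chart_locdom i j : acm_chart (SM i) (locdom f i j).
Proof.
have [[go gs gsym gp] ps xs es p2 ex cp] := acm_chart_im SM i.
have sub : locdom f i j `<=` im i by move=> z [].
have subS p q (F : 'rV[R]_d -> 'M[R]_(p, q)) : smooth_on (im i) F -> smooth_on (locdom f i
  j) F.
  by move=> Fs k; exact: Ck_subset sub (Fs k).
split; try (by apply: subS); try (by move=> z /sub; auto).
split; [exact: locdom_open|exact: subS|by move=> z /sub; auto|by move=> z /sub; auto].
Qed.

Lemma loc_smooth i j : smooth_on (locdom f i j) (loc f i j).
Proof. exact: fs.2. Qed.

Lemma loc_holo i j z : locdom f i j z ->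
  cphi (SM i) z *m jac (loc f i j) z = s *: (jac (loc f i j) z *m Psi j (loc f i j z)).
Proof.
move=> iz; have Dj := derive_jac (@locdom_open _ _ _ _ _ _ fs i j) (@loc_smooth i j).
apply/row_matrixP => a; rewrite !rowE -scalemxAr !mulmxA.
by rewrite -!Dj //; exact: fholo.
Qed.

Lemma derive_loc i j z (u : 'rV[R]_d) : locdom f i j z -> 'D_u (loc f i j) z = u *m jac
  (loc f i j) z.
Proof. exact: (derive_jac (@locdom_open _ _ _ _ _ _ fs i j) (@loc_smooth i j)). Qed.

Lemma source_reeb i j z : locdom f i j z ->
  cov (cg (SM i)) z (cxi (SM i) z) (cxi (SM i)) = 0.
Proof. by move=> [iz _]; exact: (class_A4_untwisted MA4).1. Qed.

Lemma source_twist i j z (u : 'rV[R]_d) : locdom f i j z -> (u *m ceta (SM i) z) 0 0 = 0 ->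
  twist (cg (SM i)) z (cphi (SM i)) u = 0.
Proof.
move=> [iz _] u0; have := (class_A4_untwisted MA4).2 i z u iz u0.
by rewrite mulr0 mul0r scale0r.
Qed.

Lemma D_pluriharmonic_of_twist0 :
  (forall i j x u, locdom f i j x -> (u *m ceta (SM i) x) 0 0 = 0 ->
     twist (h j) (loc f i j x) (Psi j) (u *m jac (loc f i j) x) = 0) ->
  D_pluriharmonic SM h f.
Proof.
move=> tw0 i j X [Xs X0] x xU; have [ix _] := xU.
have SU := acm_chart_locdom i j.
have Uo := mc_open (ac_metric SU).
have Xd : differentiable X x.
  exact: (smooth_differentiable (mc_open (ac_metric (acm_chart_im SM i))) Xs ix).
rewrite !(sff_hess Uo (@loc_smooth i j)) //; last exact: phif_differentiable.
rewrite (hess_D SU (@source_twist i j) (@loc_smooth i j) (hm j) (@loc_im _ _ _ _ _ f i j)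
  (Psis j) sign_sq (@loc_holo i j) xU) ?tw0 //; exact: X0.
Qed.

(** Constant fields need not lie in D, but their images under phi do, so basis vectors are tested
    after applying phi. *)
Lemma phi_jac_constant i j x : locdom f i j x -> constant_along_D SM f ->
  cphi (SM i) x *m jac (loc f i j) x = 0.
Proof.
move=> xU fD; have [ix _] := xU; have SU := acm_chart_im SM i.
apply/row_matrixP => a; rewrite !rowE mulmx0 mulmxA -derive_loc //.
apply: (fD i j (fun z => delta_mx 0 a *m cphi (SM i) z)) => //; split.
  move=> k; apply: (Ck_mulmx (mc_open (ac_metric SU))); first exact: Ck_cst.
  exact: (ac_phi SU).
by move=> z iz; exact: (eta_phi SU iz).
Qed.

Lemma constant_along_D_of_phi_jac :
  (forall i j x, locdom f i j x -> cphi (SM i) x *m jac (loc f i j) x = 0) ->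
  constant_along_D SM f.
Proof.
move=> H i j X [_ X0] x xU; have [ix _] := xU; have SU := acm_chart_im SM i.
rewrite /pushf derive_loc //.
have -> : X x = - (X x *m cphi (SM i) x *m cphi (SM i) x).
  by rewrite (phi2_D SU ix (X0 x ix)) opprK.
by rewrite mulNmx -(mulmxA _ _ (jac _ _)) H // mulmx0 oppr0.
Qed.

Lemma constant_of_conformal_zero (mu : M -> R) : connected [set: M] ->
  conformal_with (acm_g SM) h f mu -> (forall i x, im i x -> mu (chart_inv i x) = 0) ->
  constant_map f.
Proof.
move=> Mc [_ fc] mu0; apply: (constant_map_of_derive fs Mc) => i j x u xU.
apply: (posdef_eq0 (mc_pos (hm j) (loc_im xU))).
by have [ix _] := xU; rewrite fc // mu0 // expr0n mul0r.
Qed.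

(** Conformality is tested on a nonzero vector u Phi, whose image vanishes. *)
Lemma conformal_zero_of_phi_jac (mu : M -> R) : conformal_with (acm_g SM) h f mu ->
  forall i j x, locdom f i j x -> cphi (SM i) x *m jac (loc f i j) x = 0 ->
  mu (chart_inv i x) = 0.
Proof.
move=> [_ fc] i j x xU H; have [ix _] := xU; have [u u0] := quasi_sasakian_phi_neq0 ix.
have := fc i j x xU (u *m cphi (SM i) x) (u *m cphi (SM i) x).
rewrite derive_loc // -mulmxA H mulmx0 ip0l => /esym/eqP.
rewrite mulf_eq0 sqrf_eq0 => /orP[/eqP //|/eqP E].
have := posdef_eq0 (mc_pos (ac_metric (acm_chart_im SM i)) ix) E.
by move/eqP; rewrite (negbTE u0).
Qed.

(** The vector gam is left free so that contact targets, with their Reeb field, and almost Hermitian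
    targets, with b and gam zero, share the formula. *)
Lemma tension_eq i j x b (gam : 'rV[R]_e) : locdom f i j x ->
  hess (loc f i j) (cg (SM i)) (h j) x (cxi (SM i) x) (cxi (SM i) x) = 0 ->
  (forall u, (u *m ceta (SM i) x) 0 0 = 0 ->
    twist (h j) (loc f i j x) (Psi j) (u *m jac (loc f i j) x)
    = (- 2 * b * ip (h j (loc f i j x)) (u *m jac (loc f i j) x) (u *m jac (loc f i j) x))
       *: gam) ->
  exists2 P : 'M[R]_d, P \in unitmx &
  tension (acm_g SM i) (h j) (loc f i j) x = - (b * \sum_l
      ip (h j (loc f i j x)) (row l P *m cphi (SM i) x *m jac (loc f i j) x)
        (row l P *m cphi (SM i) x *m jac (loc f i j) x)) *: gam.
Proof.
move=> xU h0 tw; have SU := acm_chart_locdom i j.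
have [P Pu E] := tension_contact SU (@source_twist i j) (@loc_smooth i j) (hm j)
  (@loc_im _ _ _ _ _ f i j) (Psis j) sign_sq (@loc_holo i j) xU tw.
by exists P => //; rewrite [LHS]E h0 sub0r scaleNr.
Qed.

End Maps.
End QuasiSasakianSource.

(** * Almost contact metric targets *)

Section ContactTargets.
Context {R : realType} {m : nat} {M : manifold R (2 * m).+1} (SM : almost_contact_metric M).
Context (Mconn : connected [set: M]) (MA4 : class_A4 SM).
Context {n : nat} {N : manifold R (2 * n).+1} (SN : almost_contact_metric N).
Context (f : M -> N) (fs : smooth_map f) (sgn : bool).
Context (fholo : holomorphic_sign (acm_endo SM) (acm_endo SN) sgn f).
Context (geoN : reeb_geodesic SN) (b : N -> R) (twN : twist_kenmotsu_type SN b).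

Let chartM i j := acm_chart_locdom SM fs i j.
Let chartN j := acm_chart_im SN j.
Let geoM i j := @source_reeb R m M SM MA4 _ N f i j.
Let locs i j : smooth_on (locdom f i j) (loc f i j) := @loc_smooth _ _ _ _ _ _ fs i j.
Let locU i j := @loc_im _ _ _ _ _ f i j.
Let s : R := (-1) ^+ sgn.
Let holo i j : forall z, locdom f i j z -> cphi (SM i) z *m jac (loc f i j) z
  = s *: (jac (loc f i j) z *m cphi (SN j) (loc f i j z)) :=
  @loc_holo _ _ _ SM _ _ _ fs (acm_endo SN) sgn fholo i j.
Let s2 : s * s = 1 := @sign_sq R sgn.
Let metricN j : metric_chart (acm_g SN j) (im j) := ac_metric (chartN j).
Let phiN j : smooth_on (im j) (acm_endo SN j) := ac_phi (chartN j).

Lemma xi_factor_constant lam : xi_factor SM SN f lam -> constant_map lam.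
Proof.
move=> [ls xiE]; apply: (constant_fun_of_derive Mconn ls) => i x u ix.
have [j xU] := locdom_ex f ix.
have lam2 : Ck 2 (locdom f i j) (fun z => lam (chart_inv i z)).
  by apply: Ck_subset (ls i 2%N) => z [].
apply: (reeb_factor_grad (chartM i j) (@geoM i j) (chartN j) (@geoN j) (@locs i j)
  (@locU i j) (@holo i j) lam2 _ xU) => [z zU|].
  by rewrite -(derive_loc fs) //; exact: xiE.
exact: (quasi_sasakian_deta_neq0 MA4).
Qed.

(** [reeb_factor] plays the part of lambda chart by chart, so that the tension formula is available
    in statements that mention no lambda. *)
Lemma hess_reeb_zero i j x : locdom f i j x ->
  hess (loc f i j) (cg (SM i)) (cg (SN j)) x (cxi (SM i) x) (cxi (SM i) x) = 0.
Proof.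
move=> xU; have [ix _] := xU.
pose lam := reeb_factor (SM i) (SN j) (loc f i j).
have lamk k : Ck k (locdom f i j) lam.
  exact: (reeb_factor_Ck (chartM i j) (chartN j) (@locs i j) (@locU i j)).
have lamE z : locdom f i j z ->
    cxi (SM i) z *m jac (loc f i j) z = lam z *: cxi (SN j) (loc f i j z).
  exact: (reeb_factorE (chartM i j) (chartN j) (@locU i j) s2 (@holo i j)).
rewrite (hess_reeb_reeb (chartM i j) (@geoM i j) (chartN j) (@geoN j) (@locs i j)
  (@locU i j) (lamk 1%N) lamE xU).
have -> : 'D_(cxi (SM i) x) lam x = 0.
  apply: (reeb_factor_grad (chartM i j) (@geoM i j) (chartN j) (@geoN j) (@locs i j)
    (@locU i j) (@holo i j) (lamk 2%N) lamE xU).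
  exact: (quasi_sasakian_deta_neq0 MA4).
exact: scale0r.
Qed.

Lemma twist_jac i j x u : locdom f i j x -> (u *m ceta (SM i) x) 0 0 = 0 ->
  twist (acm_g SN j) (loc f i j x) (acm_endo SN j) (u *m jac (loc f i j) x)
  = (- 2 * b (chart_inv j (loc f i j x)) * ip (acm_g SN j (loc f i j x))
      (u *m jac (loc f i j) x) (u *m jac (loc f i j) x)) *: cxi (SN j) (loc f i j x).
Proof.
move=> xU u0; apply: twN; first exact: locU.
exact: (eta_jac_D (chartM i j) (chartN j) (@locU i j) (@holo i j) xU u0).
Qed.

Lemma tension_contact_target i j x : locdom f i j x ->
  exists2 P : 'M[R]_((2 * m).+1), P \in unitmx &
  tension (acm_g SM i) (acm_g SN j) (loc f i j) x
  = - (b (chart_inv j (loc f i j x)) * \sum_l ip (acm_g SN j (loc f i j x))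
        (row l P *m cphi (SM i) x *m jac (loc f i j) x)
        (row l P *m cphi (SM i) x *m jac (loc f i j) x)) *: cxi (SN j) (loc f i j x).
Proof.
move=> xU; apply: (tension_eq MA4 fs metricN phiN fholo xU (hess_reeb_zero xU)) => u u0.
exact: twist_jac.
Qed.

Lemma harmonic_of_phi_jac :
  (forall i j x, locdom f i j x -> cphi (SM i) x *m jac (loc f i j) x = 0) ->
  harmonic_map (acm_g SM) (acm_g SN) f.
Proof.
move=> H i j x xU; have [P _ ->] := tension_contact_target xU.
rewrite big1 ?mulr0 ?oppr0 ?scale0r // => l _.
by rewrite -(mulmxA (row l P)) H // mulmx0 ip0l.
Qed.

(** A vanishing sum of squared norms kills every row of P Phi J, and P is invertible. *)
Lemma phi_jac_of_harmonic : (forall q, b q != 0) ->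
  harmonic_map (acm_g SM) (acm_g SN) f ->
  forall i j x, locdom f i j x -> cphi (SM i) x *m jac (loc f i j) x = 0.
Proof.
move=> b0 fh i j x xU; have [P Pu E] := tension_contact_target xU.
have Uy := locU xU; have hp := mc_pos (metricN j) Uy.
move: (fh i j x xU); rewrite E => /eqP.
rewrite scaler_eq0 (negbTE (acm_xi_neq0 (chartN j) Uy)) orbF oppr_eq0 mulf_eq0.
rewrite (negbTE (b0 _)) /= psumr_eq0 => [/allP H|l _]; last exact: posdef_ge0.
suff E0 : P *m (cphi (SM i) x *m jac (loc f i j) x) = 0.
  by rewrite -[LHS](mulKmx Pu) E0 mulmx0.
apply/row_matrixP => l; rewrite row_mul row0 mulmxA.
apply: (posdef_eq0 hp); apply/eqP; exact: (H l (mem_index_enum l)).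
Qed.

Lemma harmonic_of_untwisted : (forall q, b q = 0) -> harmonic_map (acm_g SM) (acm_g SN) f.
Proof.
move=> b0 i j x xU; have [P _ ->] := tension_contact_target xU.
by rewrite b0 mul0r oppr0 scale0r.
Qed.

Lemma D_pluriharmonic_of_untwisted : (forall q, b q = 0) -> D_pluriharmonic SM (acm_g SN) f.
Proof.
move=> b0; apply: (D_pluriharmonic_of_twist0 MA4 fs metricN phiN fholo) => i j x u xU u0.
by rewrite twist_jac // b0 mulr0 mul0r scale0r.
Qed.

Lemma constant_of_harmonic_conformal : (forall q, b q != 0) ->
  harmonic_map (acm_g SM) (acm_g SN) f ->
  weakly_conformal (acm_g SM) (acm_g SN) f -> constant_map f.
Proof.
move=> b0 fh [mu fc]; apply: (constant_of_conformal_zero fs metricN Mconn fc) => i x ix.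
have [j xU] := locdom_ex f ix.
by apply: (conformal_zero_of_phi_jac MA4 fs fc xU); exact: phi_jac_of_harmonic.
Qed.

(** On xi, conformality reads mu^2 = lambda^2, and lambda is constant; hence so is mu. The induced
    metric is then mu^2 g, and harmonicity gives minimality through [tension_scaled]. *)
Lemma homothetic_minimal lam : (forall q, b q = 0) -> xi_factor SM SN f lam ->
  weakly_conformal (acm_g SM) (acm_g SN) f ->
  homothetic (acm_g SM) (acm_g SN) f /\ minimal_image (acm_g SN) f.
Proof.
move=> b0 flam [mu [mu0 fc]]; have lc := xi_factor_constant flam; have [_ xiE] := flam.
have mulam i j x : locdom f i j x -> mu (chart_inv i x) ^+ 2 = lam (chart_inv i x) ^+ 2.
  move=> xU; have [ix _] := xU; have := fc i j x xU (cxi (SM i) x) (cxi (SM i) x).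
  have := xiE i j x xU; rewrite /pushf => ->; rewrite ipZl ipZr.
  rewrite (ip_xi_xi (chartN j) (locU xU)) (ip_xi_xi (acm_chart_im SM i) ix) !mulr1.
  by move=> <-.
(* A base point is needed to read off the constant; an empty M is settled vacuously. *)
have [[p0 _]|Mempty] := pselect (exists p : M, True); last first.
  have noM (p : M) : False by apply: Mempty; exists p.
  split; last by left=> p; case: (noM p).
  by exists 0; split => // i j x xU; case: (noM (chart_inv i x)).
pose c := `|lam p0|.
have hom : conformal_with (acm_g SM) (acm_g SN) f (fun=> c).
  split=> [p|i j x xU u v]; first exact: normr_ge0.
  by rewrite fc // (mulam i j x xU) (lc _ p0) real_normK ?num_real.
split; first by exists c.
(* A zero factor makes f constant, a nonzero one makes it an immersion. *)
have [c0|c0] := eqVneq c 0.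
  left; apply: (constant_of_conformal_zero fs metricN Mconn hom) => i x _; exact: c0.
right; split=> [i j x xU u Du0|i j x xU].
  have [ix _] := xU; apply: (posdef_eq0 (mc_pos (ac_metric (acm_chart_im SM i)) ix)).
  have := hom.2 i j x xU u u; rewrite Du0 ip0l => /esym/eqP.
  by rewrite mulf_eq0 sqrf_eq0 (negbTE c0) /= => /eqP.
have [ix _] := xU; have gM := ac_metric (chartM i j).
have c20 : c ^+ 2 != 0 by rewrite sqrf_eq0.
rewrite (tension_scaled (g := acm_g SM i) (a := c ^+ 2) _ _ (mc_open gM) xU c20).
- by rewrite harmonic_of_untwisted // scaler0.
- exact: (metric_differentiable gM xU).
- by apply: posdef_unitmx; exact: (mc_pos gM).
- move=> z zU; apply/matrixP => p q; rewrite !mxE hom.2 //.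
  by rewrite ip_bvec.
Qed.

End ContactTargets.

(** * Almost Hermitian targets *)

Section HermitianTargets.
Context {R : realType} {m : nat} {M : manifold R (2 * m).+1} (SM : almost_contact_metric M).
Context (Mconn : connected [set: M]) (MA4 : class_A4 SM).
Context {n : nat} {H : manifold R (2 * n)} (K : almost_hermitian H) (KC1 : class_C1 K).
Context (f : M -> H) (fs : smooth_map f) (sgn : bool).
Context (fholo : holomorphic_sign (acm_endo SM) (ah_J K) sgn f).

Lemma hermitian_metric j : metric_chart (ah_g K j) (im j).
Proof. by have [gs gsym gpos _] := ah_metric K; split;
  [exact: im_open|exact: gs|exact: gsym|exact: gpos]. Qed.

Lemma hermitian_smooth j : smooth_on (im j) (ah_J K j).
Proof. by have [Js _] := ah_endo K. Qed.

Lemma class_C1_twist j x u : im j x -> twist (ah_g K j) x (ah_J K j) u = 0.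
Proof.
move=> jx; have gU := hermitian_metric j; have Js := @hermitian_smooth j.
have J2 : forall z, im j z -> forall u : 'rV[R]_(2 * n), u *m ah_J K j z *m ah_J K j z = -
  u.
  exact: ah_J2.
have Jg := @ah_compat _ _ _ K j.
have nE (X Y : vfield R (2 * n)) : differentiable Y x ->
    nabJ K j X Y x = cov_end (ah_g K j) x (ah_J K j) (X x) (Y x).
  exact: (nabla_endE gU jx Js).
have nc a b : nabJ K j (cfield a) (cfield b) x = cov_end (ah_g K j) x (ah_J K j) a b.
  by rewrite nE //; exact: differentiable_cst.
have sc a : smooth_on (im j) (cfield a) by move=> k; exact: Ck_cst.
case: KC1 => [KK|NK|AK|QK].
- by rewrite /twist -!nc !(KK j _ _ (sc _) (sc _) x jx) subrr.
- apply: (hermitian_twist_nearly gU Js J2 jx) => v.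
  by rewrite -nc (NK j _ (sc v) x jx).
- apply: (hermitian_twist_almost gU Js J2 Jg jx) => a b c.
  exact: (AK j _ _ _ (sc a) (sc b) (sc c) x jx).
(* The quasi-Kaehler condition is the vanishing of the twist itself. *)
- have := QK j _ (sc u) x jx; rewrite !nE //.
  exact: (differentiable_mulT gU jx Js).
Qed.

(** phi xi = 0 and holomorphy make the image of xi a vector killed by the almost complex structure,
    which is invertible. *)
Lemma reeb_jac i j z : locdom f i j z -> cxi (SM i) z *m jac (loc f i j) z = 0.
Proof.
move=> zU; have [iz _] := zU; have SU := acm_chart_im SM i.
have := loc_holo fs fholo zU; move/(congr1 (fun A => cxi (SM i) z *m A)).
rewrite mulmxA (xi_phi SU iz) mul0mx -scalemxAr mulmxA => /esym/eqP.
rewrite scaler_eq0 signr_eq0 /= => /eqP /(congr1 (fun w => w *m ah_J K j (loc f i j z))).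
by rewrite mul0mx (ah_J2 K (loc_im zU)) => /eqP; rewrite oppr_eq0 => /eqP.
Qed.

Lemma hermitian_harmonic : harmonic_map (acm_g SM) (ah_g K) f.
Proof.
move=> i j x xU; have SU := acm_chart_locdom SM fs i j.
have h0 : hess (loc f i j) (cg (SM i)) (ah_g K j) x (cxi (SM i) x) (cxi (SM i) x) = 0.
  (* With lambda and gamma zero, B(xi,xi) reduces to minus the image of nabla_xi xi, which is
     zero. *)
  rewrite (@hess_xi _ _ _ _ _ (mc_open (ac_metric SU)) (loc_smooth fs i j)
    _ _ _ xU _ (xi_differentiable SU xU) (fun=> 0) (differentiable_cst _ _)
    (fun=> 0) (differentiable_cst _ _)).
    by rewrite scaler0 scale0r add0r (source_reeb MA4 xU) mul0mx subr0.
  by move=> z zU; rewrite scaler0; exact: reeb_jac.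
have [u u0|P _ ->] := tension_eq MA4 fs hermitian_metric hermitian_smooth fholo xU h0
   (b := 0) (gam := 0).
  by rewrite scaler0; apply: class_C1_twist; exact: loc_im.
exact: scaler0.
Qed.

Lemma hermitian_D_pluriharmonic : D_pluriharmonic SM (ah_g K) f.
Proof.
apply: (D_pluriharmonic_of_twist0 MA4 fs hermitian_metric hermitian_smooth fholo).
by move=> i j x u xU _; apply: class_C1_twist; exact: loc_im.
Qed.

(** Conformality is tested on the unit field xi, which df kills. *)
Lemma hermitian_conformal_constant : weakly_conformal (acm_g SM) (ah_g K) f ->
  constant_map f.
Proof.
move=> [mu fc]; apply: (constant_of_conformal_zero fs hermitian_metric Mconn fc) => i x ix.
have [j xU] := locdom_ex f ix; have := fc.2 i j x xU (cxi (SM i) x) (cxi (SM i) x).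
rewrite (derive_loc fs) // reeb_jac // ip0l (ip_xi_xi (acm_chart_im SM i) ix) mulr1.
by move/esym/eqP; rewrite sqrf_eq0 => /eqP.
Qed.

End HermitianTargets.

Theorem theorem4p5 (R : realType) (m : nat) (M : manifold R (2 * m).+1)
    (SM : almost_contact_metric M)
    (Mconn : connected [set: M])
    (MA4 : class_A4 SM) :
  (forall (n : nat) (N : manifold R (2 * n).+1)
      (SN : almost_contact_metric N) (f : M -> N),
    smooth_map f -> pm_holomorphic (acm_endo SM) (acm_endo SN) f ->
    (class_A1 SN \/ class_A4 SN \/ class_B1 SN ->
      (forall lam : M -> R, xi_factor SM SN f lam ->
        (harmonic_map (acm_g SM) (acm_g SN) f <-> constant_along_xi SM lam) /\
        (constant_along_xi SM lam <-> constant_map lam)) /\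
      D_pluriharmonic SM (acm_g SN) f) /\
    (class_A1 SN \/ class_A4 SN \/ class_B1 SN ->
      weakly_conformal (acm_g SM) (acm_g SN) f ->
      forall lam : M -> R, xi_factor SM SN f lam ->
      constant_along_xi SM lam ->
      homothetic (acm_g SM) (acm_g SN) f /\ minimal_image (acm_g SN) f) /\
    (class_A3 SN \/ class_B3 SN ->
      (forall lam : M -> R, xi_factor SM SN f lam ->
        (constant_along_xi SM lam -> constant_map lam) /\
        (harmonic_map (acm_g SM) (acm_g SN) f -> constant_along_xi SM lam ->
           constant_along_D SM f) /\
        (harmonic_map (acm_g SM) (acm_g SN) f -> constant_along_D SM f ->
           constant_along_xi SM lam) /\
        (constant_along_xi SM lam -> constant_along_D SM f ->
           harmonic_map (acm_g SM) (acm_g SN) f)) /\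
      (harmonic_map (acm_g SM) (acm_g SN) f ->
       weakly_conformal (acm_g SM) (acm_g SN) f -> constant_map f)))
  /\
  (forall (n : nat) (H : manifold R (2 * n)) (K : almost_hermitian H)
      (f : M -> H),
    smooth_map f -> pm_holomorphic (acm_endo SM) (ah_J K) f ->
    class_C1 K ->
    (harmonic_map (acm_g SM) (ah_g K) f /\ D_pluriharmonic SM (ah_g K) f) /\
    (weakly_conformal (acm_g SM) (ah_g K) f -> constant_map f)).
Proof.
split=> [n N SN f fs [sgn fh]|n H K f fs [sgn fh] KC].
  have untw : class_A1 SN \/ class_A4 SN \/ class_B1 SN -> geodesic_untwisted SN.
    case=> [|[]]; [exact: class_A1_untwisted|exact: class_A4_untwisted|exact:
      class_B1_untwisted].
  have tw : class_A3 SN \/ class_B3 SN -> reeb_geodesic SN /\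
      exists b : N -> R, (forall p, b p != 0) /\ twist_kenmotsu_type SN b.
    case; [exact: class_A3_twisted|exact: class_B3_twisted].
  have along lam : constant_map lam -> constant_along_xi SM lam.
    move=> lc i x ix; rewrite /Lder.
    have -> : (fun z => lam (chart_inv i z)) = fun=> lam (chart_inv i x).
      by apply/funext => z; exact: lc.
    exact: derive_cst.
  split; [|split].
  - move=> /untw[geo tw0]; split; last exact: (D_pluriharmonic_of_untwisted MA4 fs fh tw0).
    move=> lam flam; have lc := xi_factor_constant Mconn MA4 fs fh geo flam.
    have fharm := harmonic_of_untwisted MA4 fs fh geo tw0 (fun=> erefl).
    by split; split=> _; [exact: along|exact: fharm|exact: lc|exact: along].
  - move=> /untw[geo tw0] fc lam flam _.
    exact: (homothetic_minimal Mconn MA4 fs fh geo tw0 (fun=> erefl) flam fc).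
  - move=> /tw[geo [b [b0 twb]]]; split; last first.
      exact: (constant_of_harmonic_conformal Mconn MA4 fs fh geo twb b0).
    move=> lam flam; have lc := xi_factor_constant Mconn MA4 fs fh geo flam.
    split; [by []|split; [|split]].
    + move=> fharm _; apply: (constant_along_D_of_phi_jac fs).
      exact: (phi_jac_of_harmonic MA4 fs fh geo twb b0 fharm).
    + by move=> _ _; exact: along.
    + move=> _ fD; apply: (harmonic_of_phi_jac MA4 fs fh geo twb) => i j x xU.
      exact: (phi_jac_constant fs xU fD).
split; first by split; [exact: (hermitian_harmonic MA4 KC fs fh)|
  exact: (hermitian_D_pluriharmonic MA4 KC fs fh)].
exact: (hermitian_conformal_constant Mconn fs fh).
Qed.
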